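(* Let $f:\mathbb{R}^d\to\mathbb{R}$ be Lipschitz with Lipschitz constant $L_f$. Let $a(x)=\frac1m\sum_{i=1}^m b(x,\xi_i)$ and suppose that there are $L,K>0$ such that for all $x,y\in\mathbb{R}^d$ and $\xi\in\mathbb{R}^n$, $|b(x,\xi)-b(y,\xi)|\le L|x-y|$ and $\langle x-y,b(x,\xi)-b(y,\xi)\rangle\le -K|x-y|^2$. Suppose also that $a=(a_1,\dots,a_d)$ is twice differentiable and that for each $i$ there are constants $C_{a_i^{(1)}},C_{a_i^{(2)}}$ with $|\nabla a_i(x)|\le C_{a_i^{(1)}}$ and $\|\nabla^2a_i(x)\|_{\mathrm{op}}\le C_{a_i^{(2)}}$ for all $x\in\mathbb{R}^d$. Consider the SDE $dX_t=a(X_t)\,dt+\beta\,dW_t$ with $\beta=m^{-1/2}$ and invariant measure $\pi$, and the estimator $$\widehat\pi^{\mathrm{EM}}_{k,N_p}(f):=\frac1{N_p}\sum_{i=1}^{N_p}f(\theta_k^{\,i}),$$ where $(\theta^{\,i}_k)_{k\ge0}$, $i=1,\dots,N_p$, are i.i.d. copies of the Euler--Maruyama scheme $\theta_{k+1}=\theta_k+ha(\theta_k)+\beta\sqrt h\,Z_{k+1}$ for this SDE. Then one can choose $N_p$, $h$ and $k$ so that $$\mathbb{E}_W\big[|\pi(f)-\widehat\pi^{\mathrm{EM}}_{k,N_p}(f)|^2\big]\le\varepsilon^2$$ with total computational cost satisfying $$\mathrm{Cost}(\mathrm{EM})\asymp\max(\varepsilon^{-2}m^{-1},1)\,\log(\varepsilon^{-1})\,\varepsilon^{-1}\,m.$$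 In particular, $$\mathrm{Cost}(\mathrm{EM})\asymp\begin{cases}\varepsilon^{-3}\log(\varepsilon^{-1}),&\text{if }m<\varepsilon^{-2},\\ m\,\varepsilon^{-1}\log(\varepsilon^{-1}),&\text{if }m\ge\varepsilon^{-2}.\end{cases}$$
   Context: $b:\mathbb{R}^d\times\mathbb{R}^n\to\mathbb{R}^d$ is a function, $\xi_1,\dots,\xi_m\in\mathbb{R}^n$ are data points, $m\ge1$. $W$ is a standard Brownian motion in $\mathbb{R}^d$ on $(\Omega_W,\mathcal{F}^W,\{\mathcal F^W_t\}_{t\ge0},\mathbb{P}_W)$, with expectation $\mathbb{E}_W$, and $X_0\in L^2(\Omega_W)$. In the Euler--Maruyama scheme $h>0$ is the step size, $t_k=kh$, $\theta_0=X_0$, and the $Z_k\sim\mathcal N(0,I_d)$ are i.i.d. (and independent of $\theta_0$). $\pi(f)=\int f\,d\pi$, where $\pi$ is the invariant probability measure of the SDE. The total computational cost is (number of paths) $\times$ (simulation time per path) $\times$ (number of steps per unit time) $\times$ (sampling cost), i.e. $\mathrm{Cost}(\mathrm{EM})$ is $N_p\cdot t_k\cdot\frac1h\cdot m$, since each step evaluates all $m$ terms of the drift. For non-negative quantities $A,B$ depending on $(\varepsilon,m)$, $A\lesssim B$ means $A\le CB$ with a constant $C>0$ independent of $\varepsilon$ and $m$, and $A\asymp B$ means $A\lesssim B$ and $B\lesssim A$. The implicit constants may depend on the fixed problem parameters, such as $d,K,L,L_f$, the initial condition, $|a(0)|$, and the constants $C_{a_i^{(1)}},C_{a_i^{(2)}}$,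 all of which are taken (bounded) independently of $\varepsilon$ and $m$. The accuracy $\varepsilon$ ranges over $(0,\varepsilon_0]$ for some fixed $\varepsilon_0\in(0,1)$. *)

(* Defs.v *)
From HB Require Import structures.
From mathcomp Require Import all_boot all_order all_algebra.
From mathcomp Require Import all_classical all_reals all_analysis.

Set Implicit Arguments.
Unset Strict Implicit.
Unset Printing Implicit Defensive.

Import Order.TTheory GRing.Theory Num.Theory.
Import numFieldNormedType.Exports.

Local Open Scope classical_set_scope.
Local Open Scope ring_scope.

(* R^d with its Borel sigma-algebra; convertible to 'rV[R]_d. *)
Definition borel_rV (R : realType) (d : nat) :=
  g_sigma_algebraType (@open 'rV[R]_d).

Section euclidean.
Context {R : realType}.

Definition dotp {d} (u v : 'rV[R]_d) : R := \sum_j u 0 j * v 0 j.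

(* The library norm `|u| on 'rV[R]_d is the sup norm, hence this definition.
   The two norms are equivalent, so continuity and differentiability below can
   be the library's. *)
Definition enorm {d} (u : 'rV[R]_d) : R := Num.sqrt (dotp u u).

Definition opnorm {d} (A : 'M[R]_d) : R :=
  sup [set enorm (v *m A) | v in [set v : 'rV[R]_d | enorm v <= 1]].

Definition gradient {d} (g : 'rV[R]_d -> R) (x : 'rV[R]_d) : 'rV[R]_d :=
  \row_j 'D_(delta_mx 0 j) g x.

Definition hessian {d} (g : 'rV[R]_d -> R) (x : 'rV[R]_d) : 'M[R]_d :=
  jacobian (gradient g) x.

Definition component {d} (a : 'rV[R]_d -> 'rV[R]_d) (i : 'I_d) :
  'rV[R]_d -> R := fun x => a x 0 i.

Definition twice_differentiable {d} (a : 'rV[R]_d -> 'rV[R]_d) : Prop :=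
  (forall x, differentiable a x) /\
  (forall i x, differentiable (gradient (component a i)) x).

End euclidean.

Section probability_notions.
Context {R : realType} {disp : measure_display} {T : measurableType disp}.
Variable P : probability T R.

Definition random_vector {d} (X : T -> 'rV[R]_d) : Prop :=
  measurable_fun [set: T] (X : T -> borel_rV R d).

Definition same_law {d} (X Y : T -> 'rV[R]_d) : Prop :=
  forall B : set (borel_rV R d), measurable B -> P (X @^-1` B) = P (Y @^-1` B).

(* The centred Gaussian law with covariance s^2 I_d, s > 0, is the product of d
   copies of N(0, s^2); it is prescribed here on measurable rectangles. *)
Definition isotropic_gaussian {d} (s : R) (Z : T -> 'rV[R]_d) : Prop :=
  random_vector Z /\
  forall B : 'I_d -> set R, (forall j, measurable (B j)) ->
    P [set w | forall j, B j (Z w 0 j)] = (\prod_j normal_prob 0 s (B j))%E.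

Definition sigma_of {d} (X : T -> 'rV[R]_d) : set_system T :=
  g_sigma_algebra_preimage (X : T -> borel_rV R d).

Definition independent_systems (G H : set_system T) : Prop :=
  forall A B, G A -> H B -> P (A `&` B) = (P A * P B)%E.

Definition mutually_independent {I : eqType} (G : I -> set_system T) : Prop :=
  forall (J : seq I) (A : I -> set T), uniq J ->
    (forall i, i \in J -> G i (A i)) ->
    P (\bigcap_(i in [set` J]) A i) = (\prod_(i <- J) P (A i))%E.

(* Only the restriction of F to nonnegative times is constrained. *)
Definition filtration (F : R -> set_system T) : Prop :=
  [/\ forall t, 0 <= t -> sigma_algebra [set: T] (F t),
      forall t, 0 <= t -> F t `<=` measurable &
      forall s t, 0 <= s -> s <= t -> F s `<=` F t].

Definition adapted {d} (F : R -> set_system T) (X : R -> T -> 'rV[R]_d) : Prop :=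
  forall t, 0 <= t -> sigma_of (X t) `<=` F t.

Definition continuous_paths {d} (X : R -> T -> 'rV[R]_d) : Prop :=
  {ae P, forall w, {within `[0, +oo[, continuous (X ^~ w)}}.

Definition brownian_motion {d} (F : R -> set_system T)
    (W : R -> T -> 'rV[R]_d) : Prop :=
  [/\ adapted F W,
      {ae P, forall w, W 0 w = 0},
      continuous_paths W &
      forall s t, 0 <= s -> s < t ->
        isotropic_gaussian (Num.sqrt (t - s)) (fun w => W t w - W s w) /\
        independent_systems (F s) (sigma_of (fun w => W t w - W s w))].

(* dX_t = a(X_t) dt + beta dW_t, X_0 = x. The diffusion coefficient is
   constant, so the stochastic integral is beta * W_t and the equation is
   pathwise; at t = 0 it gives X_0 = x almost surely. *)
Definition sde_solution {d} (F : R -> set_system T) (W : R -> T -> 'rV[R]_d)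
    (a : 'rV[R]_d -> 'rV[R]_d) (beta : R) (x : 'rV[R]_d)
    (X : R -> T -> 'rV[R]_d) : Prop :=
  [/\ adapted F X, continuous_paths X &
      {ae P, forall w, forall t, 0 <= t ->
        X t w = x + (\row_i \int[lebesgue_measure]_(s in `[0, t]) a (X s w) 0 i)
                  + beta *: W t w}].

(* X x is the solution started at x, so that x |-> P (X x t \in B) is the
   transition probability p_t(x, B), and the condition is pi p_t = pi. *)
Definition invariant_measure {d} (X : 'rV[R]_d -> R -> T -> 'rV[R]_d)
    (pi : probability (borel_rV R d) R) : Prop :=
  forall t, 0 <= t -> forall B : set (borel_rV R d), measurable B ->
    (\int[pi]_x P (X x t @^-1` B))%E = pi B.

(* Z k is the noise of the step from theta_k to theta_(k+1). *)
Fixpoint euler_maruyama {d} (a : 'rV[R]_d -> 'rV[R]_d) (beta h : R)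
    (theta0 : T -> 'rV[R]_d) (Z : nat -> T -> 'rV[R]_d) (k : nat) :
    T -> 'rV[R]_d :=
  if k is k'.+1 then fun w =>
    let th := euler_maruyama a beta h theta0 Z k' w in
    th + h *: a th + (beta * Num.sqrt h) *: Z k' w
  else theta0.

(* Inputs of N i.i.d. copies of the scheme: the initial values (index None) have
   the law of X0, the noises are N(0, I_d), and everything is independent. *)
Definition iid_em_inputs {d} (X0 : T -> 'rV[R]_d) (N : nat)
    (theta0 : 'I_N -> T -> 'rV[R]_d) (Z : 'I_N -> nat -> T -> 'rV[R]_d) : Prop :=
  [/\ forall i, random_vector (theta0 i) /\ same_law (theta0 i) X0,
      forall i k, isotropic_gaussian 1 (Z i k) &
      mutually_independent (fun p : 'I_N * option nat =>
        sigma_of (if p.2 is Some k then Z p.1 k else theta0 p.1))].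

Definition em_estimator {d} (f : 'rV[R]_d -> R) (a : 'rV[R]_d -> 'rV[R]_d)
    (beta h : R) (N : nat) (theta0 : 'I_N -> T -> 'rV[R]_d)
    (Z : 'I_N -> nat -> T -> 'rV[R]_d) (k : nat) : T -> R :=
  fun w => N%:R^-1 * \sum_(i < N)
    f (euler_maruyama a beta h (theta0 i) (Z i) k w).

End probability_notions.

Section cost.
Context {R : realType}.

Definition average_drift {d n m : nat} (b : 'rV[R]_d -> 'rV[R]_n -> 'rV[R]_d)
    (xi : 'I_m -> 'rV[R]_n) : 'rV[R]_d -> 'rV[R]_d :=
  fun x => m%:R^-1 *: \sum_(i < m) b x (xi i).

(* paths * simulated time t_k = k h * steps per unit time * drift terms *)
Definition em_cost (N k : nat) (h : R) (m : nat) : R :=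
  N%:R * (k%:R * h) * h^-1 * m%:R.

(* A and B are comparable up to the factor C; "A \asymp B" is obtained by
   choosing C before the quantities on which it must not depend. *)
Definition asymp_with (C A B : R) : Prop := A <= C * B /\ B <= C * A.

End cost.

(* Main.v *)
(* The mean square error is at most the variance of one particle divided by N plus
   the squared bias. With Q the transition operator of the scheme, Q contracts
   Lipschitz constants by 1 - K h / 2, and conditioning on the previous step bounds the
   variance by C (q^k + beta^2), where beta^2 = 1 / m. For the bias, a step of the
   equation and a step of the scheme driven by the same Brownian increment differ by
   O(h^2) in mean and O(h^(3/2)) in mean square (Taylor expansion of the drift), so
   V(x, y) = |x - y|^2 + kappa h^2 |x|^2 satisfies
   E V(X_h, Y_h) <= (1 - K h / 4) V(x, y) + C h^3. Starting from
   f(x) - f(y) <= V(x, y) Lf^2 / h + h, duality carries this inequality through k steps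
   and integration against pi and the initial law yields a bias O(q^k / h + h). Then
   h ~ eps, k ~ eps^-1 log(eps^-1) and N ~ max(eps^-2 m^-1, 1) suffice. *)
Require Import Defs.
From HB Require Import structures.
From mathcomp Require Import all_boot all_order all_algebra.
From mathcomp Require Import all_classical all_reals all_analysis.
From mathcomp Require Import measurable_realfun.
From mathcomp Require Import ring lra.

Set Implicit Arguments.
Unset Strict Implicit.
Unset Printing Implicit Defensive.

Import Order.TTheory GRing.Theory Num.Theory.
Import numFieldNormedType.Exports.

Local Open Scope classical_set_scope.
Local Open Scope ring_scope.

(** The solutions are given for deterministic initial states only: neither measurability in [x] nor
    a flow property is part of the data, so a stationary solution is not at hand to be coupled with
    the chain path by path. Hence the equation is used over a single time step [h], invariance of
    [pi] is used at time [h], and operators on Lipschitz functions are iterated. Pathwise Lipschitz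
    dependence on the initial state supplies measurability in [x]. The measure [pi] comes without
    moments; these are drawn from its invariance. A weak expansion would call for smoother test
    functions than [f]; a squared distance does not. Its one-step error [h^3], summed against a
    contraction rate of order [h], leaves [h^2], which Young's inequality with parameter [h] turns
    into [h]. The variance gains [beta^2 h] per step and loses a fraction of order [h], so it stays
    of order [beta^2] uniformly in [h]. The error estimates see [m] only through [beta <= 1] and
    [beta^2 = 1 / m], so their constants do not depend on it. *)

Notation integrableR mu f := (mu.-integrable setT (EFin \o f)).

Lemma eqW (R : realFieldType) (x y : R) : x = y -> x <= y.
Proof. by move=> ->. Qed.

(** * Euclidean norm *)

Section euclidean_space.
Context {R : realType} {d : nat}.
Implicit Types (u v w : 'rV[R]_d) (c : R).

Lemma dotpC u v : dotp u v = dotp v u.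
Proof. by apply: eq_bigr => j _; rewrite mulrC. Qed.

Lemma dotpDl u v w : dotp (u + v) w = dotp u w + dotp v w.
Proof. by rewrite -big_split; apply: eq_bigr => j _; rewrite mxE mulrDl. Qed.

Lemma dotpZl c u v : dotp (c *: u) v = c * dotp u v.
Proof. by rewrite mulr_sumr; apply: eq_bigr => j _; rewrite mxE mulrA. Qed.

Lemma dotpNl u v : dotp (- u) v = - dotp u v.
Proof. by rewrite -scaleN1r dotpZl mulN1r. Qed.

Lemma dotpDr u v w : dotp u (v + w) = dotp u v + dotp u w.
Proof. by rewrite dotpC dotpDl !(dotpC u). Qed.

Lemma dotpZr c u v : dotp u (c *: v) = c * dotp u v.
Proof. by rewrite dotpC dotpZl dotpC. Qed.

Lemma dotpNr u v : dotp u (- v) = - dotp u v.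
Proof. by rewrite dotpC dotpNl dotpC. Qed.

Lemma dotp_ge0 u : 0 <= dotp u u.
Proof. by apply: sumr_ge0 => j _; rewrite -expr2 sqr_ge0. Qed.

Lemma sqr_enorm u : enorm u ^+ 2 = dotp u u.
Proof. by rewrite sqr_sqrtr// dotp_ge0. Qed.

Lemma sqr_enorm_sum u : enorm u ^+ 2 = \sum_j u 0 j ^+ 2.
Proof. by rewrite sqr_enorm; apply: eq_bigr => j _; rewrite expr2. Qed.

Lemma enorm_ge0 u : 0 <= enorm u.
Proof. exact: sqrtr_ge0. Qed.

Lemma sqr_enormD u v :
  enorm (u + v) ^+ 2 = enorm u ^+ 2 + 2 * dotp u v + enorm v ^+ 2.
Proof. rewrite !sqr_enorm dotpDl !dotpDr (dotpC v u); ring. Qed.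

Lemma enormZ c u : enorm (c *: u) = `|c| * enorm u.
Proof.
rewrite /enorm dotpZl dotpZr mulrA -expr2 sqrtrM ?sqr_ge0//.
by rewrite sqrtr_sqr.
Qed.

Lemma enormN u : enorm (- u) = enorm u.
Proof. by rewrite -scaleN1r enormZ normrN1 mul1r. Qed.

Lemma enorm0 : enorm (0 : 'rV[R]_d) = 0.
Proof. by rewrite -(scale0r (0 : 'rV[R]_d)) enormZ normr0 mul0r. Qed.

Lemma enormB u v : enorm (u - v) = enorm (v - u).
Proof. by rewrite -enormN opprB. Qed.

Lemma dotp_enorm0 u v : enorm u = 0 -> dotp u v = 0.
Proof.
move=> u0; have uj j : u 0 j = 0.
  have := sqr_enorm_sum u; rewrite u0 expr0n/= => /esym/eqP.
  rewrite psumr_eq0 => [|i _]; last exact: sqr_ge0.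
  by move=> /allP/(_ j (mem_index_enum _)); rewrite sqrf_eq0 => /eqP.
by rewrite /dotp big1// => j _; rewrite uj mul0r.
Qed.

(** Cauchy-Schwarz, from the nonnegativity of the squared norm of [enorm v *: u - enorm u *: v]. *)
Lemma dotp_le u v : dotp u v <= enorm u * enorm v.
Proof.
have [u0|u0] := eqVneq (enorm u) 0; first by rewrite u0 mul0r dotp_enorm0.
have [v0|v0] := eqVneq (enorm v) 0.
  by rewrite v0 mulr0 dotpC dotp_enorm0.
have up : 0 < enorm u by rewrite lt_neqAle eq_sym u0 enorm_ge0.
have vp : 0 < enorm v by rewrite lt_neqAle eq_sym v0 enorm_ge0.
have := dotp_ge0 (enorm v *: u - enorm u *: v).
rewrite dotpDl !dotpDr !dotpNl !dotpNr !dotpZl !dotpZr (dotpC v u) -!sqr_enorm.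
move: (enorm u) (enorm v) up vp => a b a0 b0 H.
rewrite -(ler_pM2l (mulr_gt0 a0 b0)); nra.
Qed.

Lemma normr_dotp_le u v : `|dotp u v| <= enorm u * enorm v.
Proof.
rewrite ler_norml dotp_le andbT lerNl -dotpNl -(enormN u).
exact: dotp_le.
Qed.

Lemma enorm_triangle u v : enorm (u + v) <= enorm u + enorm v.
Proof.
rewrite -(ler_pXn2r (_ : (0 < 2)%N)) ?nnegrE ?addr_ge0 ?enorm_ge0//.
rewrite sqr_enormD; have := dotp_le u v; nra.
Qed.

Lemma enorm_distD u v w : enorm (u - w) <= enorm (u - v) + enorm (v - w).
Proof. by apply: le_trans (enorm_triangle _ _); rewrite addrA subrK. Qed.

Lemma sqr_enormD_le u v :
  enorm (u + v) ^+ 2 <= 2 * enorm u ^+ 2 + 2 * enorm v ^+ 2.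
Proof.
have := enorm_triangle u v; have := enorm_ge0 (u + v).
have := enorm_ge0 u; have := enorm_ge0 v; have := sqr_ge0 (enorm u - enorm v).
nra.
Qed.

Lemma coord_le_enorm u j : `|u 0 j| <= enorm u.
Proof.
rewrite -sqrtr_sqr ler_sqrt ?dotp_ge0// -sqr_enorm sqr_enorm_sum.
by rewrite (bigD1 j)//= lerDl sumr_ge0// => i _; rewrite sqr_ge0.
Qed.

Lemma enorm_le_sum u : enorm u <= \sum_j `|u 0 j|.
Proof.
rewrite -(ler_pXn2r (_ : (0 < 2)%N)) ?nnegrE ?enorm_ge0 ?sumr_ge0//.
rewrite sqr_enorm_sum.
suff [] : 0 <= \sum_j `|u 0 j| /\
    \sum_j u 0 j ^+ 2 <= (\sum_j `|u 0 j|) ^+ 2 by [].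
apply: (big_ind2 (fun x y => 0 <= x /\ y <= x ^+ 2)) => [|x y z t [? ?] [? ?]|j _].
- by rewrite expr0n.
- by split; [exact: addr_ge0|nra].
- by rewrite normr_ge0 real_normK// num_real.
Qed.

Lemma coord_le_norm u j : `|u 0 j| <= `|u|.
Proof.
by rewrite [leRHS]/Num.norm /= mx_normrE; apply/bigmax_geP; right => /=; exists (0, j).
Qed.

Lemma enorm_le_norm u : enorm u <= d%:R * `|u|.
Proof.
apply: le_trans (enorm_le_sum u) _.
rewrite mulr_natl -[X in _ *+ X]card_ord -sumr_const.
by apply: ler_sum => j _; exact: coord_le_norm.
Qed.

Lemma dist_enorm_le u v : `|enorm u - enorm v| <= enorm (u - v).
Proof.
have := enorm_triangle (u - v) v; have := enorm_triangle (v - u) u.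
by rewrite !subrK (enormB v) ler_norml => *; apply/andP; split; lra.
Qed.

Lemma enorm_lipschitz_continuous (g : 'rV[R]_d -> R) c :
  (forall u v, `|g u - g v| <= c * enorm (u - v)) -> continuous g.
Proof.
move=> gl u; apply/(@cvgrPdist_lt _ _ _ (nbhs u)) => e e0.
(* The factor [d] converts the sup norm of the topology to the Euclidean norm; the [+ 1] keeps the
   divisor positive when [c] or [d] is 0. *)
have c1 : 0 < `|c| * d%:R + 1 by rewrite ltr_wpDl// mulr_ge0.
apply/(@nbhs_normP _ 'rV[R]_d); exists (e / (`|c| * d%:R + 1)) => /=; first exact: divr_gt0.
move=> v /=; rewrite ltr_pdivlMr// => uv.
apply: le_lt_trans (gl _ _) _; apply: le_lt_trans uv.
have := enorm_le_norm (u - v); have := ler_norm c; have := normr_ge0 c.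
have := enorm_ge0 (u - v); have := normr_ge0 (u - v); have := ler0n R d.
set x := enorm _; set y := `|u - v|; nra.
Qed.

Lemma continuous_coord j : continuous (fun u : 'rV[R]_d => u 0 j).
Proof.
apply: (@enorm_lipschitz_continuous _ 1) => u v; rewrite mul1r.
by have := coord_le_enorm (u - v) j; rewrite !mxE.
Qed.

Lemma continuous_enorm : continuous (@enorm R d).
Proof.
by apply: (@enorm_lipschitz_continuous _ 1) => u v; rewrite mul1r dist_enorm_le.
Qed.

End euclidean_space.

(** * Measurability of random vectors *)

Section random_vectors.
Context {R : realType} {disp : measure_display} {T : measurableType disp}.

Lemma continuous_borel_rV d (g : 'rV[R]_d -> R) : continuous g ->
  measurable_fun [set: borel_rV R d] g.
Proof.
move=> cg; apply: (measurability _ (RGenOpens.measurableE R)) => _ [_ [a [b ->] <-]].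
rewrite setTI; apply: sub_sigma_algebra; apply: open_comp => // x _; exact: cg.
Qed.

Lemma measurable_coord d (j : 'I_d) :
  measurable_fun [set: borel_rV R d] (fun u : borel_rV R d => u 0 j).
Proof. by apply: continuous_borel_rV; exact: continuous_coord. Qed.

(* Rational boxes form a countable basis, so that the Borel sigma-algebra is
   generated by the coordinates. *)
Lemma measurable_rV d (X : T -> 'rV[R]_d) :
  (forall j, measurable_fun setT (fun w => X w 0 j)) ->
  measurable_fun [set: T] (X : T -> borel_rV R d).
Proof.
move=> mX; apply: (@measurability _ _ _ (borel_rV R d) _ _ open erefl) => _ [U oU <-].
rewrite setTI.
pose box (p : 'rV[rat]_d * nat) : set 'rV[R]_d :=
  [set u | forall j, `|ratr (p.1 0 j) - u 0 j| < p.2.+1%:R^-1].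
have bP p u : box p u <-> ball (map_mx ratr p.1 : 'rV[R]_d) p.2.+1%:R^-1 u.
  split=> [bu|[_ bu] j]; last by have := bu 0 j; rewrite mxE.
  by split=> // i j; rewrite mxE (ord1 i); exact: bu.
have -> : U = \bigcup_(p in [set p | box p `<=` U]) box p.
  apply/seteqP; split=> [u Uu|u [p pU pu]]; last exact: pU.
  have /nbhs_ballP[e /= e0 eU] : nbhs u U by exact: open_nbhs_nbhs.
  have [k ke] : exists k : nat, k.+1%:R^-1 < e / 2.
    have := @near_infty_natSinv_lt R (PosNum (divr_gt0 e0 (ltr0Sn R 1))).
    by case=> N _ /(_ N (leqnn N)) ?; exists N.
  have /choice[q qP] (j : 'I_d) : exists q, `|ratr q - u 0 j| < k.+1%:R^-1.
    have k0 : 0 < (k.+1%:R : R)^-1 by rewrite invr_gt0.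
    have /rat_in_itvoo[q] : u 0 j - k.+1%:R^-1 < u 0 j + k.+1%:R^-1.
      by move: (k.+1%:R^-1) k0 => z z0; rewrite ltrBlDr -addrA ltrDl addr_gt0.
    by rewrite in_itv/= => /andP[q1 q2]; exists q; rewrite ltr_distl q1 q2.
  exists (\row_j q j, k); last by move=> j /=; rewrite mxE.
  move=> v /= vb; apply: eU; split=> // i j; rewrite (ord1 i).
  have := vb j; have := qP j; rewrite mxE => h1 h2.
  rewrite /ball/=.
  have -> : u 0 j - v 0 j = - (ratr (q j) - u 0 j) + (ratr (q j) - v 0 j) by ring.
  apply: le_lt_trans (ler_normD _ _) _; rewrite normrN [ltRHS](splitr e).
  by apply: ltrD; exact: lt_trans ke.
rewrite preimage_bigcup bigcup_mkcond; apply: countable_bigcupT_measurable.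
  exact: countableP.
move=> p; case: ifPn => // _; rewrite (_ : _ @^-1` _ =
    \bigcap_(j in [set: 'I_d]) ((fun w => X w 0 j) @^-1`
      ball (ratr (p.1 0 j) : R^o) p.2.+1%:R^-1)).
  apply: fin_bigcap_measurable => // j _; rewrite -[_ @^-1` _]setTI.
  by apply: mX => //; apply: open_measurable; apply: ball_open; rewrite invr_gt0.
by apply/seteqP; split=> w pw j => [_|]; [exact: pw|exact: (pw j I)].
Qed.

End random_vectors.

(** * Integration and Gaussian vectors *)

Section real_expectation.
Context {disp : measure_display} {T : measurableType disp} {R : realType}.
Variable mu : {measure set T -> \bar R}.

Lemma integrable_measurable_fun (f : T -> R) :
  integrableR mu f -> measurable_fun setT f.
Proof. by move=> /measurable_int/measurable_EFinP. Qed.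

Lemma ae_le_Rintegral (f g : T -> R) :
  integrableR mu f -> integrableR mu g ->
  {ae mu, forall w, f w <= g w} -> \int[mu]_w f w <= \int[mu]_w g w.
Proof.
move=> fi gi fg.
have mf := integrable_measurable_fun fi.
have mg := integrable_measurable_fun gi.
pose h w := Num.max (f w) (g w).
have mh : measurable_fun setT h by exact: measurable_maxr.
have ae_hg : ae_eq mu setT (EFin \o h) (EFin \o g).
  by apply: filterS fg => w /= fgw _; rewrite /h max_r.
have hi : integrableR mu h.
  apply: (@le_integrable _ _ _ mu _ measurableT _
    (fun w => `|(f w)%:E| + `|(g w)%:E|)%E).
  - exact/measurable_EFinP.
  - move=> w _; rewrite -EFinD/= lee_fin [leRHS]ger0_norm ?addr_ge0//.
    rewrite /h /Num.max; case: ifP => _; [by rewrite lerDr|by rewrite lerDl].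
  - by apply: integrableD => //; exact: integrable_abse.
have -> : \int[mu]_w g w = \int[mu]_w h w.
  congr fine; apply: ae_eq_integral => //; [exact/measurable_EFinP|
    exact/measurable_EFinP|exact: ae_eq_sym].
by apply: le_Rintegral => // w _; rewrite /h le_max lexx.
Qed.

Lemma ae_dominated_integrable (f g : T -> R) : measurable_fun setT f ->
  integrableR mu g -> {ae mu, forall w, `|f w| <= g w} ->
  integrableR mu f.
Proof.
move=> mf gi fg; apply/integrableP; split; first exact/measurable_EFinP.
have /integrableP[mg] := gi; apply: le_lt_trans.
apply: ae_ge0_le_integral => //.
- by apply: measurableT_comp => //; exact/measurable_EFinP.
- by apply: measurableT_comp.
- apply: filterS fg => w fgw _ /=; rewrite lee_fin (le_trans fgw)// ?ler_norm//.
Qed.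

Lemma dominated_integrable (f g : T -> R) : measurable_fun setT f ->
  integrableR mu g -> (forall w, `|f w| <= g w) ->
  integrableR mu f.
Proof.
by move=> mf gi fg; apply: ae_dominated_integrable mf gi _; exact: aeW.
Qed.

(** The passage from extended-real to real integrals: for a nonnegative function a finite bound
    yields integrability as well. *)
Lemma ge0_bounded_integrable (f : T -> R) (c : R) : measurable_fun setT f ->
  (forall w, 0 <= f w) -> (\int[mu]_w (f w)%:E <= c%:E)%E ->
  integrableR mu f /\ \int[mu]_w f w <= c.
Proof.
move=> mf f0 fc.
have fi : integrableR mu f.
  apply/integrableP; split; first exact/measurable_EFinP.
  under eq_integral do rewrite /= ger0_norm//.
  exact: le_lt_trans fc (ltry _).
split=> //; rewrite -lee_fin fineK//; apply: integrable_fin_num => //.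
Qed.

Lemma EFin_Rintegral (D : set T) (f : T -> R) : measurable D ->
  mu.-integrable D (EFin \o f) ->
  (\int[mu]_(w in D) f w)%:E = (\int[mu]_(w in D) (f w)%:E)%E.
Proof. by move=> mD fi; rewrite fineK//; exact: integrable_fin_num. Qed.

End real_expectation.

Section integrable_finite_measure.
Context {disp : measure_display} {T : measurableType disp} {R : realType}.
Variable P : probability T R.
Implicit Types f g : T -> R.

Lemma integrable_cstR (c : R) : integrableR P (fun=> c).
Proof. exact: finite_measure_integrable_cst. Qed.

Lemma integrableDR f g : integrableR P f ->
  integrableR P g ->
  integrableR P (fun w => f w + g w).
Proof. by move=> fi gi; exact: (integrableD measurableT fi gi). Qed.

Lemma integrableBR f g : integrableR P f ->
  integrableR P g ->
  integrableR P (fun w => f w - g w).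
Proof. by move=> fi gi; exact: (integrableB measurableT fi gi). Qed.

Lemma integrableZR (c : R) f : integrableR P f ->
  integrableR P (fun w => c * f w).
Proof. by move=> fi; exact: (integrableZl measurableT _ fi). Qed.

Lemma integrable_affineR (c k : R) f : integrableR P f ->
  integrableR P (fun w => c + k * f w).
Proof. by move=> fi; apply: integrableDR; [exact: integrable_cstR|exact: integrableZR]. Qed.

Lemma integrable_sumR (I : Type) (r : seq I) (F : I -> T -> R) :
  (forall i, integrableR P (F i)) ->
  integrableR P (fun w => \sum_(i <- r) F i w).
Proof.
move=> Fi; elim: r => [|i r IH].
  by under eq_fun do rewrite big_nil; exact: integrable_cstR.
by under eq_fun do rewrite big_cons; exact: integrableDR.
Qed.

Lemma integrable_normR f : integrableR P f ->
  integrableR P (fun w => `|f w|).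
Proof. by move=> fi; exact: (integrable_norm fi). Qed.

Lemma Rintegral_cstR (c : R) : \int[P]_w c = c.
Proof.
rewrite Rintegral_cst//; have -> : fine (P setT) = 1 by rewrite probability_setT.
by rewrite mulr1.
Qed.

Lemma Rintegral_affineR (c k : R) f : integrableR P f ->
  \int[P]_w (c + k * f w) = c + k * \int[P]_w f w.
Proof.
move=> fi; rewrite RintegralD//; [|exact: integrable_cstR|exact: integrableZR].
by rewrite Rintegral_cstR RintegralZl.
Qed.

Lemma Rintegral_sumR (I : Type) (r : seq I) (F : I -> T -> R) :
  (forall i, integrableR P (F i)) ->
  \int[P]_w (\sum_(i <- r) F i w) = \sum_(i <- r) \int[P]_w F i w.
Proof.
move=> Fi; elim: r => [|i r IH].
  by under eq_Rintegral do rewrite big_nil; rewrite Rintegral_cstR big_nil.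
under eq_Rintegral do rewrite big_cons.
by rewrite RintegralD// ?IH ?big_cons//; exact: integrable_sumR.
Qed.

Lemma sqr_integrable f : measurable_fun setT f ->
  integrableR P (fun w => f w ^+ 2) ->
  integrableR P f.
Proof.
move=> mf i2; apply: (@dominated_integrable _ _ _ _ _ (fun w => 1 + f w ^+ 2)) => //.
  by apply: integrableDR => //; exact: integrable_cstR.
move=> w; have := sqr_ge0 (`|f w| - 1).
by rewrite -[X in _ <= 1 + X]real_normK ?num_real//; nra.
Qed.

End integrable_finite_measure.

(** * Integration against a density *)

Section density.
Context {disp : measure_display} {T : measurableType disp} {R : realType}.
Variables (mu nu : {measure set T -> \bar R}) (p : T -> R).
Hypotheses (mp : measurable_fun setT p) (p0 : forall x, 0 <= p x).
Hypothesis nuE : forall A, measurable A -> nu A = (\int[mu]_(x in A) (p x)%:E)%E.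

Let integral_density_indic (A : set T) : measurable A ->
  (\int[nu]_x (\1_A x)%:E = \int[mu]_x ((\1_A x)%:E * (p x)%:E))%E.
Proof.
move=> mA; rewrite integral_indic// setIT nuE// integral_mkcond/=.
apply: eq_integral => x _; rewrite patchE indicE.
by case: ifPn => xA; rewrite ?mul1e ?mul0e.
Qed.

Import HBNNSimple.

Let integral_density_nnsfun (g : {nnsfun T >-> R}) :
  (\int[nu]_x (g x)%:E = \int[mu]_x ((g x)%:E * (p x)%:E))%E.
Proof.
under [LHS]eq_integral do rewrite fimfunE -fsumEFin//.
rewrite [LHS]ge0_integral_fsum//; last 2 first.
  - by move=> r; exact/measurable_EFinP/measurableT_comp.
  - by move=> n x _; rewrite EFinM nnfun_muleindic_ge0.
under [RHS]eq_integral.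
  move=> x xD; rewrite fimfunE -fsumEFin// ge0_mule_fsuml; last first.
    by move=> r; rewrite EFinM nnfun_muleindic_ge0.
  over.
rewrite [RHS]ge0_integral_fsum//; last 2 first.
  - move=> r; apply: emeasurable_funM; last exact/measurable_EFinP.
    by apply/measurable_EFinP; do 2 apply/measurableT_comp => //.
  - by move=> n x _; rewrite EFinM mule_ge0 ?lee_fin//; exact: nnfun_muleindic_ge0.
apply: eq_fsbigr => r _; rewrite !integralZl_indic_nnsfun//=.
rewrite integral_density_indic//.
have [r0|r0] := leP 0 r.
  rewrite -ge0_integralZl//.
  - by apply: eq_integral => x _; rewrite EFinM muleA.
  - apply: emeasurable_funM; last exact/measurable_EFinP.
    exact/measurable_EFinP/measurable_indic.
  - by move=> x _; rewrite mule_ge0// lee_fin.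
rewrite (preimage_nnfun0 _ r0) indic0.
rewrite integral0_eq ?mule0 => [|x _]; last by rewrite mul0e.
by rewrite integral0_eq// => x _; rewrite mulr0 mul0e.
Qed.

Lemma ge0_integral_density (f : T -> \bar R) : measurable_fun setT f ->
  (forall x, 0 <= f x)%E ->
  (\int[nu]_x f x = \int[mu]_x (f x * (p x)%:E))%E.
Proof.
move=> mf f0; pose f_ := nnsfun_approx measurableT mf.
transitivity (lim (\int[nu]_x (f_ n x)%:E @[n --> \oo])%E).
  rewrite -monotone_convergence//=.
  - apply: eq_integral => ? /[!inE] xD; apply/esym/cvg_lim => //=.
    exact: cvg_nnsfun_approx.
  - by move=> n; exact/measurable_EFinP/measurable_funTS.
  - by move=> n ? _; rewrite lee_fin.
  - by move=> ? _ ? ? mn; rewrite lee_fin; exact/lefP/nd_nnsfun_approx.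
rewrite [RHS](_ : _ = lim
    (\int[mu]_x ((f_ n x)%:E * (p x)%:E) @[n --> \oo])%E); last first.
  rewrite -monotone_convergence//=.
  - apply: eq_integral => x /[!inE] xD; apply/esym/cvg_lim => //.
    by apply: cvgeMr => //; exact: cvg_nnsfun_approx.
  - by move=> n; apply: emeasurable_funM; exact/measurable_EFinP.
  - by move=> n x _; rewrite mule_ge0// lee_fin.
  - move=> x _ m n mn; rewrite lee_wpmul2r ?lee_fin//.
    exact/lefP/nd_nnsfun_approx.
by apply: congr_lim; apply/funext => n /=; exact: integral_density_nnsfun.
Qed.

End density.

(** * Normal laws on the line *)

Section gaussian_line.
Context {R : realType}.
Local Notation leb := (@lebesgue_measure R).

Lemma normal_pdfEn (s x : R) : s != 0 ->
  normal_pdf 0 s x = normal_peak s * expR (- x ^+ 2 / (s ^+ 2 *+ 2)).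
Proof. by move=> s0; rewrite normal_pdfE// /normal_fun subr0. Qed.

Lemma normal_pdf_scale (s c x : R) : s != 0 -> c != 0 ->
  `|c| * normal_pdf 0 (`|c| * s) (c * x) = normal_pdf 0 s x.
Proof.
move=> s0 c0; have cs0 : `|c| * s != 0 by rewrite mulf_neq0 ?normr_eq0.
rewrite !normal_pdfEn// mulrA; congr (_ * expR _).
  rewrite /normal_peak exprMn -mulrA -mulrnAr sqrtrM ?sqr_ge0//.
  rewrite sqrtr_sqr normr_id invfM mulrA mulfV ?normr_eq0// mul1r.
  by rewrite mulrnAr.
rewrite !exprMn -normrX ger0_norm ?sqr_ge0// -mulrnAr -mulrN invfM mulrACA.
by rewrite mulfV ?mul1r// sqrf_eq0.
Qed.

(** The right-hand side is a measure that agrees with Lebesgue measure on half-open intervals, which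
    determine it. *)
Lemma lebesgue_measure_scale (c : R) : 0 < c -> forall A : set R, measurable A ->
  (leb A = c%:E * leb ((fun x : R => (c * x)%R) @^-1` A))%E.
Proof.
move=> c0 A mA; pose k : {nonneg R} := NngNum (ltW c0).
have mc : measurable_fun [set: R] (fun x : R => c * x : measurableTypeR R).
  exact: measurable_funM.
apply: (@lebesgue_measure_unique _ (mscale k (pushforward leb
  (fun x : R => c * x : measurableTypeR R)))) => // _ [[a b]] _ <-.
change (leb `]a, b] = c%:E * leb ((fun x : R => (c * x)%R) @^-1` `]a, b]))%E.
rewrite (_ : _ @^-1` _ = `]a / c, b / c]%classic); last first.
  apply/seteqP; split => x /=; rewrite !in_itv/= ltr_pdivrMr// ler_pdivlMr//;
  by rewrite (mulrC x).
rewrite !lebesgue_measure_itv/= !lte_fin ltr_pM2r ?invr_gt0//.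
case: ifPn => _; last by rewrite mule0.
by rewrite -!EFinD -EFinM mulrBr !mulrA (mulrC c a) (mulrC c b) !mulfK ?gt_eqF.
Qed.

Lemma ge0_integral_scale (c : R) (f : R -> \bar R) : 0 < c ->
  measurable_fun [set: R] f -> (forall x, 0 <= f x)%E ->
  (\int[leb]_x f x = c%:E * \int[leb]_x f (c * x)%R)%E.
Proof.
move=> c0 mf f0; pose k : {nonneg R} := NngNum (ltW c0).
have mc : measurable_fun [set: R] (fun x : R => c * x : measurableTypeR R).
  exact: measurable_funM.
have mc' : measurable_fun [set: measurableTypeR R]
  (fun x : measurableTypeR R => (c * x : measurableTypeR R)) := mc.
have := ge0_integral_pushforward mc' leb (D := setT) measurableT mf (fun x _ => f0 x).
rewrite preimage_setT => <-.
have := @ge0_integral_mscale _ _ _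
  (measure_function_pushforward__canonical__measure_function_Measure leb mc')
  setT measurableT k f mf (fun x _ => f0 x).
move=> <-; apply: eq_measure_integral => A mA _.
exact: (lebesgue_measure_scale c0).
Qed.

Lemma ge0_integral_opp (f : R -> \bar R) : measurable_fun [set: R] f ->
  (forall x, 0 <= f x)%E -> (\int[leb]_x f x = \int[leb]_x f (- x)%R)%E.
Proof.
move=> mf f0.
have mN : measurable_fun [set: measurableTypeR R]
  (fun x : measurableTypeR R => (- x : measurableTypeR R)) by exact: oppr_measurable.
have := ge0_integral_pushforward mN leb (D := setT) measurableT mf (fun x _ => f0 x).
rewrite preimage_setT => <-.
by apply: eq_measure_integral => A mA _; rewrite -[LHS]lebesgue_measureN.
Qed.

Lemma normal_prob_scale (s c : R) (B : set R) : 0 < s -> 0 < c -> measurable B ->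
  normal_prob 0 (c * s) B = normal_prob 0 s ((fun x => c * x) @^-1` B).
Proof.
move=> s0 c0 mB; have cn0 : `|c| = c by rewrite ger0_norm// ltW.
rewrite /normal_prob [LHS]integral_mkcond [RHS]integral_mkcond.
rewrite (ge0_integral_scale c0); last 2 first.
- apply/(measurable_restrictT _ _).1 => //; apply/measurable_EFinP.
  apply: measurable_funTS; exact: measurable_normal_pdf.
- by move=> x; rewrite erestrict_ge0// => y _; rewrite lee_fin normal_pdf_ge0.
rewrite -ge0_integralZl//.
- apply: eq_integral => x _; rewrite !patchE.
  have -> : (x \in (fun x : R => c * x) @^-1` B) = (c * x \in B).
    by apply/idP/idP; rewrite !inE.
  case: ifPn => _; last by rewrite mule0.
  by rewrite -EFinM -[X in normal_pdf 0 (X * s)]cn0 -{1}cn0 normal_pdf_scale// gt_eqF.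
- apply: (@measurableT_comp _ _ _ _ _ _ ((fun x => (normal_pdf 0 (c * s) x)%:E) \_ B)).
    apply/(measurable_restrictT _ _).1 => //; apply/measurable_EFinP.
    apply: measurable_funTS; exact: measurable_normal_pdf.
  exact: measurable_funM.
- by move=> x _; rewrite erestrict_ge0// => y _; rewrite lee_fin normal_pdf_ge0.
- by rewrite lee_fin ltW.
Qed.

(* [u e^{-u} <= 1] at [u = x^2/(4 s^2)] trades the factor [x^2] for a doubled
   variance. *)
Lemma normal_pdf_sqr_le (s x : R) : 0 < s ->
  x ^+ 2 * normal_pdf 0 s x <= 8 * s ^+ 2 * normal_pdf 0 (Num.sqrt 2 * s) x.
Proof.
move=> s0; have q0 : 0 < Num.sqrt 2 :> R by rewrite sqrtr_gt0.
have qq : Num.sqrt 2 ^+ 2 = 2 :> R by rewrite sqr_sqrtr.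
rewrite !normal_pdfEn ?mulf_neq0 ?gt_eqF//.
have -> : normal_peak (Num.sqrt 2 * s) = (Num.sqrt 2)^-1 * normal_peak s.
  by rewrite /normal_peak exprMn -mulrA -mulrnAr sqrtrM ?sqr_ge0// qq invfM mulrnAr.
pose u := x ^+ 2 / (4 * s ^+ 2).
have sn0 : s != 0 by rewrite gt_eqF.
have -> : - x ^+ 2 / (s ^+ 2 *+ 2) = - u - u by rewrite /u; field.
have -> : - x ^+ 2 / ((Num.sqrt 2 * s) ^+ 2 *+ 2) = - u.
  by rewrite exprMn qq /u; field.
have -> : x ^+ 2 = 4 * s ^+ 2 * u by rewrite /u; field.
rewrite expRD; have := normal_peak_ge0 s; have := expR_gt0 (- u).
have u0 : 0 <= u by rewrite divr_ge0 ?sqr_ge0// mulr_ge0 ?sqr_ge0.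
have ue : u * expR (- u) <= 1.
  rewrite expRN ler_pdivrMr ?expR_gt0// mul1r.
  by apply: le_trans (expR_ge1Dx u); rewrite lerDr.
have -> : 8 = 4 * (Num.sqrt 2 * Num.sqrt 2) :> R by rewrite -expr2 qq; ring.
have q1 : 1 <= Num.sqrt 2 :> R by rewrite -[leLHS]sqrtr1 ler_sqrt// ler1n.
have -> : 4 * (Num.sqrt 2 * Num.sqrt 2) * s ^+ 2 * ((Num.sqrt 2)^-1 * normal_peak s * expR (- u))
  = 4 * s ^+ 2 * normal_peak s * expR (- u) * Num.sqrt 2 by field; rewrite gt_eqF.
move: (expR (- u)) ue => E ue E0 p0.
have -> : 4 * s ^+ 2 * u * (normal_peak s * (E * E)) =
  4 * s ^+ 2 * normal_peak s * E * (u * E) by ring.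
by rewrite ler_wpM2l ?(le_trans ue)// !mulr_ge0 ?sqr_ge0// ltW.
Qed.

(** The exact value is [s ^ 2]. The constant 8 comes from the domination by a density of variance
    [2 * s ^ 2], of total mass 1; only the order in [s] matters below. *)
Lemma normal_second_moment (s : R) : 0 < s ->
  (\int[normal_prob 0 s]_x (x ^+ 2)%:E <= (8 * s ^+ 2)%:E)%E.
Proof.
move=> s0; have s'0 : 0 < Num.sqrt 2 * s by rewrite mulr_gt0// sqrtr_gt0.
rewrite (@ge0_integral_density _ _ _ leb _ (normal_pdf 0 s))//; last first.
- by move=> x; rewrite lee_fin sqr_ge0.
- apply/measurable_EFinP; exact: exprn_measurable.
- exact: normal_pdf_ge0.
- exact: measurable_normal_pdf.
have mp : measurable_fun [set: measurableTypeR R]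
    (fun x => (normal_pdf 0 (Num.sqrt 2 * s) x)%:E).
  by apply/measurable_EFinP; exact: measurable_normal_pdf.
apply: (@le_trans _ _ (\int[leb]_x
    ((8 * s ^+ 2)%:E * (normal_pdf 0 (Num.sqrt 2 * s) x)%:E))%E).
  apply: ge0_le_integral => //.
  - by move=> x _; rewrite mule_ge0// lee_fin ?sqr_ge0 ?normal_pdf_ge0.
  - apply/measurable_EFinP; apply: measurable_funM; last exact: measurable_normal_pdf.
    exact: exprn_measurable.
  - exact: measurable_funeM.
  - by move=> x _; rewrite -!EFinM lee_fin normal_pdf_sqr_le.
rewrite ge0_integralZl//.
- by rewrite integral_normal_pdf mule1.
- by move=> x _; rewrite lee_fin normal_pdf_ge0.
- by rewrite lee_fin mulr_ge0 ?sqr_ge0.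
Qed.

Lemma normal_probN (s : R) (B : set R) : measurable B -> s != 0 ->
  normal_prob 0 s (-%R @^-1` B) = normal_prob 0 s B.
Proof.
move=> mB s0; rewrite /normal_prob [LHS]integral_mkcond [RHS]integral_mkcond.
rewrite [RHS]ge0_integral_opp; last 2 first.
- apply/(measurable_restrictT _ _).1 => //; apply/measurable_EFinP.
  by apply: measurable_funTS; exact: measurable_normal_pdf.
- by move=> x; rewrite erestrict_ge0// => y _; rewrite lee_fin normal_pdf_ge0.
apply: eq_integral => x _; rewrite !patchE.
have -> : (x \in -%R @^-1` B) = (- x \in B) by apply/idP/idP; rewrite !inE.
by rewrite !normal_pdfEn// sqrrN.
Qed.

End gaussian_line.

Section gaussian_vectors.
Context {R : realType} {disp : measure_display} {T : measurableType disp}.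
Variable P : probability T R.

Lemma gaussian_coord_law d (s : R) (Z : T -> 'rV[R]_d) (j : 'I_d) (B : set R) :
  isotropic_gaussian P s Z -> measurable B ->
  P [set w | B (Z w 0 j)] = normal_prob 0 s B.
Proof.
move=> [_ ZP] mB; have := ZP (fun i => if i == j then B else setT).
rewrite (_ : [set w | forall i, _] = [set w | B (Z w 0 j)]); last first.
  apply/seteqP; split => w /=; first by move/(_ j); rewrite eqxx.
  by move=> Bw i; case: eqP => [->|].
rewrite (bigD1 j)//= eqxx big1 ?mule1 => [|i /negbTE ->]; last first.
  exact: probability_setT.
by apply => i; case: ifP.
Qed.

Lemma measurable_random_coord d (X : T -> 'rV[R]_d) (j : 'I_d) :
  random_vector X -> measurable_fun setT (fun w => X w 0 j).
Proof. by move=> mX; exact: (measurableT_comp (measurable_coord j) mX). Qed.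

Lemma measurable_random_coord_measurableTypeR d (X : T -> 'rV[R]_d) (j : 'I_d) :
  random_vector X -> measurable_fun setT (fun w => X w 0 j : measurableTypeR R).
Proof. exact: measurable_random_coord. Qed.

Lemma ge0_gaussian_coord_integral d (s : R) (Z : T -> 'rV[R]_d) (j : 'I_d)
    (f : measurableTypeR R -> \bar R) :
  isotropic_gaussian P s Z -> measurable_fun [set: measurableTypeR R] f ->
  (forall x, (0 <= f x)%E) ->
  (\int[P]_w f (Z w ord0 j) = \int[normal_prob 0%R s]_x f x)%E.
Proof.
move=> ZG mf f0; have mZ := measurable_random_coord_measurableTypeR j ZG.1.
have := ge0_integral_pushforward mZ P (D := setT) measurableT mf (fun x _ => f0 x).
rewrite preimage_setT => <-; apply: eq_measure_integral => A mA _.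
exact: gaussian_coord_law.
Qed.

Lemma gaussian_coord_sqr d (s : R) (Z : T -> 'rV[R]_d) (j : 'I_d) : 0 < s ->
  isotropic_gaussian P s Z ->
  integrableR P (fun w => Z w 0 j ^+ 2) /\
  \int[P]_w (Z w 0 j ^+ 2) <= 8 * s ^+ 2.
Proof.
move=> s0 ZG; apply: ge0_bounded_integrable.
- by apply: measurable_funX; exact: measurable_random_coord ZG.1.
- by move=> w; exact: sqr_ge0.
- rewrite (ge0_gaussian_coord_integral j (f := fun x => (x ^+ 2)%:E) ZG).
  + exact: normal_second_moment.
  + apply/measurable_EFinP; exact: exprn_measurable.
  + by move=> x; rewrite lee_fin sqr_ge0.
Qed.

Lemma gaussian_coordN_integral d (s : R) (Z : T -> 'rV[R]_d) (j : 'I_d)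
    (f : measurableTypeR R -> \bar R) : 0 < s ->
  isotropic_gaussian P s Z -> measurable_fun [set: measurableTypeR R] f ->
  (forall x, (0 <= f x)%E) ->
  (\int[P]_w f (- Z w ord0 j)%R = \int[P]_w f (Z w ord0 j))%E.
Proof.
move=> s0 ZG mf f0; rewrite (ge0_gaussian_coord_integral j ZG mf f0).
have mZ : measurable_fun setT (fun w => (- Z w ord0 j)%R : measurableTypeR R).
  exact: (measurableT_comp (@oppr_measurable R setT)
    (measurable_random_coord_measurableTypeR j ZG.1)).
have := ge0_integral_pushforward mZ P (D := setT) measurableT mf (fun x _ => f0 x).
rewrite preimage_setT => <-; apply: eq_measure_integral => A mA _.
transitivity (normal_prob 0 s (-%R @^-1` A)).
  apply: (gaussian_coord_law j ZG); rewrite -[_ @^-1` _]setTI; exact: oppr_measurable.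
by rewrite normal_probN ?gt_eqF.
Qed.

(** By symmetry of the law the positive and the negative part have the same integral, and it is
    finite because the second moment is. *)
Lemma gaussian_coord_mean d (s : R) (Z : T -> 'rV[R]_d) (j : 'I_d) : 0 < s ->
  isotropic_gaussian P s Z ->
  integrableR P (fun w => Z w 0 j) /\ \int[P]_w Z w 0 j = 0.
Proof.
move=> s0 ZG; have mZ := measurable_random_coord j ZG.1.
have [i2 _] := gaussian_coord_sqr j s0 ZG.
have i1 := sqr_integrable mZ i2.
split=> //; rewrite /Rintegral integralE.
have := integrable_fin_num measurableT i1; rewrite integralE.
rewrite [X in (X - _)%E](_ : _ = \int[P]_w maxe (Z w ord0 j)%:E 0)%E; last first.
  by apply: eq_integral => w _; rewrite funeposE.
rewrite [X in (_ - X)%E](_ : _ = \int[P]_w maxe (- Z w ord0 j)%:E 0)%E; last first.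
  by apply: eq_integral => w _; rewrite funenegE.
rewrite (gaussian_coordN_integral j (f := fun x => maxe x%:E 0) s0 ZG); last 2 first.
- by apply: measurable_maxe => //; exact/measurable_EFinP.
- by move=> x; rewrite le_max lexx orbT.
set b := integral _ _ _ => bfin.
have bf : b \is a fin_num.
  by move: bfin; case: b.
by rewrite subee.
Qed.

(** The pi-system on which [isotropic_gaussian] prescribes a law; it generates the Borel sets, so
    that agreement on it is equality of laws. *)
Definition rV_rectangles d : set_system 'rV[R]_d :=
  [set A | exists2 B : 'I_d -> set R, (forall j, measurable (B j)) &
    A = [set u : 'rV[R]_d | forall j, B j (u 0 j)]].

Lemma measurable_rV_rectangles d :
  @measurable _ (borel_rV R d) = <<s @rV_rectangles d >>.
Proof.
apply/seteqP; split => [A mA|].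
  have mid : measurable_fun [set: g_sigma_algebraType (@rV_rectangles d)]
      (id : g_sigma_algebraType (@rV_rectangles d) -> borel_rV R d).
    apply: (@measurable_rV _ _ (g_sigma_algebraType (@rV_rectangles d)) d id).
    move=> j _ B mB; rewrite setTI; apply: sub_sigma_algebra.
    exists (fun i => if i == j then B else setT) => [i|]; first by case: ifP.
    apply/seteqP; split=> u /=; last by move/(_ j); rewrite eqxx.
    by move=> Bu i; case: eqP => [->|].
  by have := mid measurableT A mA; rewrite setTI.
apply: smallest_sub; first exact: sigma_algebra_measurable.
move=> _ [B mB ->]; rewrite (_ : [set u | _] =
    \bigcap_(j in [set: 'I_d]) ((fun u : borel_rV R d => u 0 j) @^-1` B j)).
  apply: fin_bigcap_measurable => // j _; rewrite -[_ @^-1` _]setTI.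
  exact: measurable_coord.
by apply/seteqP; split=> u Bu j => [_|]; [exact: Bu|exact: (Bu j I)].
Qed.

Lemma same_law_rectangles d (X Y : T -> 'rV[R]_d) :
  random_vector X -> random_vector Y ->
  (forall B : 'I_d -> set R, (forall j, measurable (B j)) ->
    P [set w | forall j, B j (X w 0 j)] = P [set w | forall j, B j (Y w 0 j)]) ->
  same_law P X Y.
Proof.
move=> mX mY XY A mA.
pose mu X (mX : random_vector X) : {measure set borel_rV R d -> \bar R} :=
  measure_function_pushforward__canonical__measure_function_Measure P mX.
suff : mu X mX A = mu Y mY A by [].
apply: (@measure_unique _ R (borel_rV R d) (@rV_rectangles d) (fun=> setT)) => //.
- exact: measurable_rV_rectangles.
- move=> _ _ [B mB ->] [C mC ->]; exists (fun j => B j `&` C j).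
    by move=> j; exact: measurableI.
  apply/seteqP; split => u /=; last by move=> BC; split=> j; have [] := BC j.
  by move=> [Bu Cu] j; split.
- by move=> _; exists (fun=> setT) => //; apply/seteqP; split.
- by rewrite bigcup_const.
- by move=> _ [B mB ->]; exact: XY.
- by move=> _ /=; rewrite /pushforward preimage_setT probability_setT ltry.
Qed.

(** The only link between the noises of the scheme and the Brownian motion: [sqrt h] times a
    standard noise has the law of an increment over time [h]. *)
Lemma gaussian_same_law d (s c : R) (Z Y : T -> 'rV[R]_d) : 0 < s -> 0 < c ->
  isotropic_gaussian P s Z -> isotropic_gaussian P (c * s) Y ->
  same_law P (fun w => c *: Z w) Y.
Proof.
move=> s0 c0 [mZ ZP] [mY YP]; apply: same_law_rectangles => // [|B mB].
  apply: measurable_rV => j; under eq_fun do rewrite mxE.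
  by apply: measurable_funM => //; exact: measurable_random_coord.
rewrite YP//; under eq_bigr do rewrite (normal_prob_scale s0 c0)//.
rewrite -ZP => [|j].
  by congr (P _); apply/seteqP; split => w Bw j; have := Bw j; rewrite /= mxE.
rewrite -[_ @^-1` _]setTI.
exact: (measurable_funM (measurable_cst c) (@measurable_id _ R setT)).
Qed.

End gaussian_vectors.

(** * Taylor expansion *)

Section taylor.
Context {R : realType} {d : nat}.
Implicit Types (u v x : 'rV[R]_d).

(** A crude bound whose purpose is to show that the set in [opnorm] is bounded above, so that its
    supremum is meaningful. *)
Lemma enorm_mulmx_le (A : 'M[R]_d) v :
  enorm (v *m A) <= (\sum_j \sum_i `|A i j|) * enorm v.
Proof.
apply: le_trans (enorm_le_sum _) _; rewrite mulr_suml; apply: ler_sum => j _.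
rewrite mxE; apply: le_trans (ler_norm_sum _ _ _) _.
rewrite mulr_suml; apply: ler_sum => i _.
by rewrite normrM mulrC ler_wpM2l// coord_le_enorm.
Qed.

Lemma enorm_mulmx_opnorm (A : 'M[R]_d) v :
  enorm (v *m A) <= opnorm A * enorm v.
Proof.
have [v0|v0] := eqVneq (enorm v) 0.
  by apply: le_trans (enorm_mulmx_le _ _) _; rewrite v0 !mulr0.
have vp : 0 < enorm v by rewrite lt_neqAle eq_sym v0 enorm_ge0.
rewrite -ler_pdivrMr// mulrC -[X in X * _](ger0_norm (_ : 0 <= (enorm v)^-1)).
  rewrite -enormZ scalemxAl; apply: ub_le_sup.
    exists (\sum_j \sum_i `|A i j|) => _ [w /= w1 <-].
    apply: le_trans (enorm_mulmx_le _ _) _; rewrite ler_piMr//.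
    by do 2 (apply: sumr_ge0 => ? _).
  exists ((enorm v)^-1 *: v) => //=.
  by rewrite enormZ ger0_norm ?invr_ge0 ?enorm_ge0// mulVf.
by rewrite invr_ge0 enorm_ge0.
Qed.

Lemma is_derive_line (V W : normedModType R) (g : V -> W) (x v : V) (t : R) :
  derivable g (x + t *: v) v ->
  is_derive t 1 (fun s : R => g (x + s *: v)) ('D_v g (x + t *: v)).
Proof.
move=> dg.
have E : (fun h : R => h^-1 *: (g (x + (h *: 1 + t) *: v) - g (x + t *: v))) =
         (fun h : R => h^-1 *: (g (h *: v + (x + t *: v)) - g (x + t *: v))).
  apply/funext => h; congr (_ *: (g _ - _)).
  by rewrite scalerDl [_ *: 1]mulr1 addrCA.
apply: DeriveDef; first by rewrite /derivable/= E.
by rewrite /derive/= E.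
Qed.

Lemma derive_dotp_gradient (g : 'rV[R]_d -> R) x v : differentiable g x ->
  'D_v g x = dotp (gradient g x) v.
Proof.
move=> dg; rewrite deriveE// [v in LHS]row_sum_delta linear_sum.
apply: eq_bigr => j _; rewrite linearZ/= mxE deriveE// mulrC.
by congr (_ * _).
Qed.

(** The mean value theorem is used twice along the segment from [x] to [x + v]: for [psi], the
    derivative of [phi], and for [phi] itself. This yields [C] in place of the sharp [C / 2]. *)
Lemma taylor2_le (g : 'rV[R]_d -> R) (C : R) x v :
  (forall y, differentiable g y) -> (forall y, differentiable (gradient g) y) ->
  (forall y, opnorm (hessian g y) <= C) ->
  `|g (x + v) - g x - dotp (gradient g x) v| <= C * enorm v ^+ 2.
Proof.
move=> dg dG hC; pose psi s := dotp (gradient g (x + s *: v)) v.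
pose dpsi s := dotp (v *m hessian g (x + s *: v)) v.
have psiD (s : R) : is_derive s (1 : R) psi (dpsi s).
  have -> : psi = \sum_(j < d) (fun s => v 0 j *: (gradient g (x + s *: v) 0 j : R^o)).
    apply/funext => r; rewrite /psi /dotp fct_sumE; apply: eq_bigr => j _.
    by rewrite mulrC.
  rewrite /dpsi /dotp (eq_bigr (fun j => v 0 j *: ((v *m hessian g (x + s *: v)) 0 j : R^o))); last first.
    by move=> j _; rewrite mulrC.
  apply: is_derive_sum => j; apply: is_deriveZ.
  have dGv : derivable (gradient g) (x + s *: v) v by exact: diff_derivable.
  have dGj := (derivable_mxP _ _ _).1 dGv 0 j.
  have := is_derive_line dGj; congr (is_derive _ _ _ _).
  rewrite /hessian -deriveEjacobian// derive_mx// mxE.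
  by congr ('D__ _ _).
have dpsi_le s : `|dpsi s| <= C * enorm v ^+ 2.
  apply: le_trans (normr_dotp_le _ _) _; rewrite expr2 mulrA ler_wpM2r ?enorm_ge0//.
  apply: le_trans (enorm_mulmx_opnorm _ _) _.
  by rewrite ler_wpM2r ?enorm_ge0.
have C0 : 0 <= C * enorm v ^+ 2 by exact: le_trans (normr_ge0 _) (dpsi_le 0).
have psi_le s : 0 <= s <= 1 -> `|psi s - psi 0| <= C * enorm v ^+ 2.
  move=> /andP[s0 s1].
  have [|c _ ->] := MVT_segment s0 (fun z _ => psiD z).
    by apply: derivable_within_continuous => z _; have [] := psiD z.
  rewrite subr0 normrM (ger0_norm s0).
  by apply: le_trans (ler_wpM2r s0 (dpsi_le c)) _; rewrite ler_piMr.
pose phi s : R := g (x + s *: v).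
have phiD (s : R) : is_derive s (1 : R) phi (psi s).
  rewrite /psi -derive_dotp_gradient//; apply: is_derive_line.
  exact: diff_derivable.
have [|c cI] := MVT_segment ler01 (fun z _ => phiD z).
  by apply: derivable_within_continuous => z _; have [] := phiD z.
rewrite /phi scale1r scale0r addr0 subr0 mulr1 => ->.
have := psi_le c; rewrite /psi scale0r addr0; apply.
by rewrite in_itv/= in cI.
Qed.

End taylor.

(** * Joint measurability of processes, and Fubini in time *)

Section joint_measurability.
Context {R : realType} {disp : measure_display} {T : measurableType disp}.

Lemma cvg_grid (s : R) :
  (Num.floor (s * n.+1%:R))%:~R / n.+1%:R @[n --> \oo] --> s.
Proof.
apply/cvgrPdist_lt => e e0.
near=> n; have n0 : 0 < n.+1%:R :> R by [].
rewrite -{1}[s](mulfK (lt0r_neq0 n0)) -mulrBl normrM ger0_norm; last first.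
  by rewrite subr_ge0 floor_le.
rewrite ger0_norm ?invr_ge0// ltr_pdivrMr//.
apply: (@lt_trans _ _ 1).
  by rewrite ltrBlDl -intrD1 floorD1_gt.
rewrite mulrC -ltr_pdivrMr// mul1r -[ltRHS]invrK ltf_pV2 ?posrE ?invr_gt0//.
by near: n; exact: (near_infty_natSinv_lt (PosNum e0)).
Unshelve. all: by end_near. Qed.

Lemma cvg_grid_comp (y : R -> R) (s : R) : continuous y ->
  y ((Num.floor (s * n.+1%:R))%:~R / n.+1%:R) @[n --> \oo] --> y s.
Proof.
by move=> cy; exact: (cvg_comp _ y (@cvg_grid s) (cy s)).
Qed.

(* A process with continuous paths is the limit of its discretizations, which
   are countable gluings of products. *)
Lemma continuous_process_measurable (Y : R -> T -> R) :
  (forall s, measurable_fun setT (Y s)) -> (forall w, continuous (Y ^~ w)) ->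
  measurable_fun [set: measurableTypeR R * T] (fun p => Y p.1 p.2).
Proof.
move=> mY cY.
pose F n (p : measurableTypeR R * T) : R :=
  Y ((Num.floor ((p.1 : R) * n.+1%:R))%:~R / n.+1%:R) p.2.
apply: (@measurable_fun_cvg _ _ _ _ F).
- move=> n _ B mB; rewrite setTI.
  have -> : F n @^-1` B = \bigcup_(z : int)
      (`[z%:~R / n.+1%:R, (z + 1)%:~R / n.+1%:R[%classic `*` (Y (z%:~R / n.+1%:R) @^-1` B)).
    have n0 : 0 < n.+1%:R :> R by [].
    apply/seteqP; split => [[s w] FB|[s w] [z _ [/= sz wB]]].
      exists (Num.floor (s * n.+1%:R)) => //; split => //=.
      by rewrite in_itv/= ler_pdivrMr// ltr_pdivlMr// floor_le floorD1_gt.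
    rewrite /F/=; suff -> : Num.floor (s * n.+1%:R) = z by [].
    by apply: floor_def; move: sz; rewrite in_itv/= ler_pdivrMr// ltr_pdivlMr.
  apply: countable_bigcupT_measurable; first exact: countableP.
  move=> z; apply: measurableX; first exact: measurable_itv.
  by rewrite -[_ @^-1` _]setTI; exact: mY.
- move=> [s w] _; rewrite /F/=.
  exact: (@cvg_grid_comp (Y ^~ w) s (cY w)).
Qed.

Variable P : probability T R.
Local Notation leb := (@lebesgue_measure R).

(** The uniform bound on first moments makes the process, extended by 0 off [[0, h]], integrable on
    the product space, where Fubini applies. *)
Lemma path_integral_fubini (h c : R) (g : R -> T -> R) : 0 <= h ->
  measurable_fun [set: measurableTypeR R * T] (fun p => g p.1 p.2) ->
  (forall w, leb.-integrable `[0, h] (EFin \o g ^~ w)) ->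
  (forall s, 0 <= s <= h -> integrableR P (g s)) ->
  (forall s, 0 <= s <= h -> \int[P]_w `|g s w| <= c) ->
  let I w := \int[leb]_(s in `[0, h]) g s w in
  [/\ integrableR P I,
      (\int[P]_w I w)%:E = (\int[leb]_(s in `[0%R, h]) (\int[P]_w g s w)%:E)%E &
      \int[P]_w I w <= c * h].
Proof.
move=> h0 mg gi gs gc I.
pose D : set R := `[0, h]%classic.
have mD : measurable (D : set (measurableTypeR R)) by exact: measurable_itv.
pose G (p : T * measurableTypeR R) : \bar R := (\1_D p.2 * g p.2 p.1)%:E.
have mG : measurable_fun setT G.
  apply/measurable_EFinP; apply: measurable_funM; last first.
    exact: (measurableT_comp mg (measurable_fun_pair (@measurable_snd _ _ T (measurableTypeR R)) (@measurable_fst _ _ T (measurableTypeR R)))).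
  exact: (measurableT_comp (measurable_indic (mD : measurable (D : set (measurableTypeR R))))
    measurable_snd).
have GE w : (\int[leb]_s G (w, s) = (I w)%:E)%E.
  rewrite /I EFin_Rintegral; [|exact: measurable_itv|exact: gi].
  rewrite [RHS]integral_mkcond; apply: eq_integral => s _.
  by rewrite /G/= patchE indicE; case: ifPn => _; rewrite ?mul1r ?mul0r.
have Gout s w : s \notin D -> G (w, s) = 0%E.
  by move=> sD; rewrite /G/= indicE (negbTE sD) mul0r.
have Gin s w : s \in D -> G (w, s) = (g s w)%:E.
  by move=> sD; rewrite /G/= indicE sD mul1r.
have inD (s : R) : s \in D -> 0 <= s <= h by rewrite inE /D/= in_itv.
have absG : (\int[leb]_s \int[P]_w `|G (w, s)| <= (c * h)%:E)%E.
  apply: (@le_trans _ _ (\int[leb]_(s in D) c%:E)%E); last first.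
    rewrite integral_cst//= lebesgue_measure_itv/= lte_fin.
    case: ltP => [_|h00]; first by rewrite -EFinB -EFinM subr0.
    by rewrite (@le_anti _ _ h 0) ?mule0 ?mulr0// h00 h0.
  rewrite [leRHS]integral_mkcond; apply: ge0_le_integral => //.
  - by move=> s _; apply: integral_ge0.
  - apply: (measurable_fun_fubini_tonelli_G (abse \o G)) => //=.
    exact: measurableT_comp.
  - apply/(measurable_restrictT _ _).1 => //; exact: measurable_cst.
  - move=> s _; rewrite patchE; case: ifPn => sD.
      under eq_integral do rewrite Gin//.
      have gn := integrable_normR (gs _ (inD _ sD)).
      by rewrite -(EFin_Rintegral measurableT gn) lee_fin; exact: gc _ (inD _ sD).
    by rewrite integral0_eq// => w _; rewrite Gout// abse0.
have iG : (P \x leb)%E.-integrable setT G.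
  by apply/integrable21ltyP => //; exact: le_lt_trans absG (ltry _).
have iI : integrableR P I.
  have := integrable_fubini_F iG; congr (_.-integrable _ _).
  by apply/funext => w; rewrite /fubini_F GE.
split=> //; last first.
  rewrite -lee_fin EFin_Rintegral//; apply: le_trans (le_trans _ absG).
    exact: lee_abs.
  apply: le_trans (le_abse_integral _ measurableT (measurable_int _ iI)) _.
  rewrite -(fubini_tonelli (abse \o G))//=; last exact: measurableT_comp.
  apply: ge0_le_integral => //.
  - apply/measurable_EFinP; apply: measurableT_comp => //.
    exact: integrable_measurable_fun iI.
  - apply: (measurable_fun_fubini_tonelli_F (abse \o G)) => //=.
    exact: measurableT_comp.
  - move=> w _; change (`|(I w)%:E| <= \int[leb]_s `|G (w, s)|)%E; rewrite -GE.
    apply: le_abse_integral => //.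
    exact: (measurable_fun_pair2 w mG).
rewrite EFin_Rintegral//.
transitivity (\int[P]_w \int[leb]_s G (w, s))%E.
  by apply: eq_integral => w _; rewrite GE.
rewrite (Fubini iG) [RHS]integral_mkcond; apply: eq_integral => s _.
rewrite patchE; case: ifPn => sD; last by rewrite integral0_eq// => w _; rewrite Gout.
rewrite EFin_Rintegral; [|exact: measurableT|exact: gs _ (inD _ sD)].
by apply: eq_integral => w _; rewrite Gin.
Qed.

End joint_measurability.

Lemma continuous_compR (R : realType) (U : topologicalType) (q : R -> U)
    (g : U -> R) : continuous g -> continuous q -> continuous (fun s => g (q s)).
Proof. by move=> cg cq s; exact: (continuous_comp (cq s) (cg (q s))). Qed.

(** * One step of the equation *)

Section continuous_paths.
Context {R : realType} {d : nat}.
Local Notation leb := (@lebesgue_measure R).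
Variable h : R.
Hypothesis h0 : 0 < h.
Implicit Types (f g : R -> R) (p v : R -> 'rV[R]_d).

Lemma within_comp (U : topologicalType) (q : R -> U) (g : U -> R) :
  continuous g -> {within `[0, h], continuous q} ->
  {within `[0, h], continuous (fun s => g (q s))}.
Proof. by move=> cg cq x; apply: continuous_comp; [exact: cq|exact: cg]. Qed.

Lemma within_integrable f : {within `[0, h], continuous f} ->
  leb.-integrable `[0, h] (EFin \o f).
Proof. by move=> cf; apply: continuous_compact_integrable => //; exact: segment_compact. Qed.

Lemma within_integrableS f t : {within `[0, h], continuous f} -> t <= h ->
  leb.-integrable `[0, t] (EFin \o f).
Proof.
move=> cf th; apply: integrableS (within_integrable cf) => //.
by apply: subset_itvl; rewrite bnd_simp.
Qed.

Lemma le_within_Rintegral f g :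
  {within `[0, h], continuous f} -> {within `[0, h], continuous g} ->
  (forall s, 0 <= s <= h -> f s <= g s) ->
  \int[leb]_(s in `[0, h]) f s <= \int[leb]_(s in `[0, h]) g s.
Proof.
move=> cf cg fg; apply: le_Rintegral => //.
- exact: within_integrable.
- exact: within_integrable.
Qed.

Lemma within_Rintegral_cst (c : R) : \int[leb]_(s in `[0, h]) c = c * h.
Proof.
rewrite Rintegral_cst//= lebesgue_measure_itv/= lte_fin h0 -EFinB/=.
by rewrite subr0.
Qed.

Lemma within_Rintegral_initial_le f t : {within `[0, h], continuous f} ->
  (forall s, 0 <= f s) -> t <= h ->
  \int[leb]_(s in `[0, t]) f s <= \int[leb]_(s in `[0, h]) f s.
Proof.
move=> cf f0 th; rewrite -lee_fin !EFin_Rintegral//.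
- apply: ge0_subset_integral => //.
  + by have := measurable_int _ (within_integrable cf).
  + by move=> s _; rewrite lee_fin.
  + by apply: subset_itvl; rewrite bnd_simp.
- exact: within_integrable.
- exact: within_integrableS.
Qed.

Lemma within_Rintegral_sum (I : Type) (r : seq I) (F : I -> R -> R) :
  (forall i, {within `[0, h], continuous F i}) ->
  \int[leb]_(s in `[0, h]) (\sum_(i <- r) F i s) =
  \sum_(i <- r) \int[leb]_(s in `[0, h]) F i s.
Proof.
move=> cF; have cS r' : {within `[0, h], continuous (fun s => \sum_(i <- r') F i s)}.
  elim: r' => [|i r' IH].
    rewrite (_ : (fun s => _) = (fun=> 0)); first by move=> z; exact: cvg_cst.
    by apply/funext => s; rewrite big_nil.
  rewrite (_ : (fun s => _) = (fun s => F i s + \sum_(j <- r') F j s)).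
    by move=> z; apply: cvgD; [exact: cF|exact: IH].
  by apply/funext => s; rewrite big_cons.
elim: r => [|i r IH].
  by under eq_Rintegral do rewrite big_nil; rewrite within_Rintegral_cst mul0r big_nil.
under eq_Rintegral do rewrite big_cons.
rewrite RintegralD//; [|exact: within_integrable|exact: within_integrable].
by rewrite IH big_cons.
Qed.

(** Cauchy-Schwarz in time, by integrating the square of the deviation of [f] from its mean value
    [J / h]. *)
Lemma sqr_within_Rintegral_le f : {within `[0, h], continuous f} ->
  (\int[leb]_(s in `[0, h]) f s) ^+ 2 <= h * \int[leb]_(s in `[0, h]) (f s ^+ 2).
Proof.
move=> cf; set J := \int[leb]_(s in _) f s; set S := \int[leb]_(s in _) _.
have cf2 : {within `[0, h], continuous (fun s => f s ^+ 2)}.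
  exact: (within_comp (@exprn_continuous R 2) cf).
have : \int[leb]_(s in `[0, h]) (2 * (J / h) * f s - (J / h) ^+ 2) <= S.
  apply: le_Rintegral => //; last first.
  - by move=> s _; have := sqr_ge0 (f s - J / h); nra.
  - exact: within_integrable.
  - apply: within_integrable; apply: (@within_comp _ f (fun z : R => 2 * (J / h) * z - (J / h) ^+ 2)) => //.
    by move=> z; apply: cvgB; [apply: cvgM; [exact: cvg_cst|exact: cvg_id]|exact: cvg_cst].
rewrite RintegralB//; last 2 first.
- apply: within_integrable; apply: (@within_comp _ f (fun z : R => 2 * (J / h) * z)) => //.
  by move=> z; apply: cvgM; [exact: cvg_cst|exact: cvg_id].
- by apply: within_integrable => z; exact: cvg_cst.
rewrite RintegralZl//; last exact: within_integrable.
rewrite within_Rintegral_cst -/J => JS.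
have -> : J ^+ 2 = h * (2 * (J / h) * J - (J / h) ^+ 2 * h).
  by field; rewrite gt_eqF.
by rewrite ler_pM2l.
Qed.

End continuous_paths.

(** * Pathwise estimates over one time step *)

Section pathwise_estimates.
Context {R : realType} {d : nat}.
Local Notation leb := (@lebesgue_measure R).
Local Notation D := d%:R.
Variables (a : 'rV[R]_d -> 'rV[R]_d) (L h : R).
Hypotheses (h0 : 0 < h) (L0 : 0 <= L).
Hypothesis aL : forall u v, enorm (a u - a v) <= L * enorm (u - v).
Hypothesis Lh : 2 * D * L * h <= 1.
Implicit Types (p v : R -> 'rV[R]_d) (x : 'rV[R]_d).

(** As the noise is additive, the equation can be studied one path at a time, with the noise as a
    given continuous function [v]. *)
Definition driven_path x v p := forall t, 0 <= t <= h ->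
  p t = x + (\row_i \int[leb]_(s in `[0, t]) a (p s) 0 i) + v t.

Lemma continuous_drift_coord i : continuous (fun u => a u 0 i).
Proof.
apply: (@enorm_lipschitz_continuous _ _ _ L) => u v.
by apply: le_trans (aL u v); have := coord_le_enorm (a u - a v) i; rewrite !mxE.
Qed.

Lemma enorm_le_unif (u : 'rV[R]_d) (c : R) : (forall i, `|u 0 i| <= c) ->
  enorm u <= D * c.
Proof.
move=> uc; apply: le_trans (enorm_le_sum u) _.
by rewrite mulr_natl -[X in _ *+ X]card_ord -sumr_const; exact: ler_sum.
Qed.

Lemma continuous_enormB x : continuous (fun u : 'rV[R]_d => enorm (u - x)).
Proof.
apply: (@enorm_lipschitz_continuous _ _ _ 1) => u v; rewrite mul1r.
by apply: le_trans (dist_enorm_le _ _) _; rewrite opprB addrA subrK.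
Qed.

Section one_path.
Variables (x : 'rV[R]_d) (v p : R -> 'rV[R]_d).
Hypotheses (cp : {within `[0, h], continuous p}).
Hypotheses (cv : {within `[0, h], continuous v}).
Hypothesis pE : driven_path x v p.
Let I := \int[leb]_(s in `[0, h]) enorm (p s - x).
Let J := \int[leb]_(s in `[0, h]) enorm (v s).
Let A := enorm (a x).

Let cI : {within `[0, h], continuous (fun s => enorm (p s - x))}.
Proof. exact: (within_comp (continuous_enormB (x := x)) cp). Qed.

Let I0 : 0 <= I. Proof. by apply: Rintegral_ge0 => *; exact: enorm_ge0. Qed.

Let drift_integral_le t i : 0 <= t <= h ->
  `|\int[leb]_(s in `[0, t]) a (p s) 0 i| <= h * A + L * I.
Proof.
move=> /andP[t0 th]; have ca := within_comp (@continuous_drift_coord i) cp.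
apply: le_trans (le_normr_Rintegral _ (within_integrableS ca th)) _ => //.
have cn : {within `[0, h], continuous (fun s => `|a (p s) 0 i|)}.
  exact: (within_comp (@norm_continuous R R) ca).
apply: le_trans (within_Rintegral_initial_le cn (fun s => normr_ge0 _) th) _.
have cLI : {within `[0, h], continuous (fun s => L * enorm (p s - x))}.
  apply: (@within_comp _ _ _ _ (fun z : R => L * z)) cI => z.
  by apply: cvgM; [exact: cvg_cst|exact: cvg_id].
apply: (@le_trans _ _ (\int[leb]_(s in `[0, h]) (A + L * enorm (p s - x)))).
  apply: le_within_Rintegral => //.
    by move=> z; apply: cvgD; [exact: cvg_cst|exact: cLI].
  move=> s _; have := coord_le_enorm (a (p s)) i.
  have := enorm_triangle (a (p s) - a x) (a x); rewrite subrK.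
  by have := aL (p s) x; rewrite -/A; lra.
rewrite RintegralD//; last 2 first.
- by apply: within_integrable => z; exact: cvg_cst.
- exact: within_integrable.
rewrite within_Rintegral_cst// RintegralZl//; last exact: (within_integrable cI).
by rewrite (mulrC h).
Qed.

Lemma driven_path_drift_le t : 0 <= t <= h ->
  enorm (p t - x - v t) <= D * (h * A + L * I).
Proof.
move=> th; apply: enorm_le_unif => i.
have -> : p t - x - v t = \row_i \int[leb]_(s in `[0, t]) a (p s) 0 i.
  by rewrite pE// addrAC [x + _]addrC addrK addrK.
by rewrite mxE; exact: drift_integral_le.
Qed.

(** Integrating [driven_path_drift_le] in time bounds [I] by a term containing [D * L * h * I]. The
    condition [2 * D * L * h <= 1] makes this at most [I / 2], which is absorbed on the left; this
    takes the place of Gronwall's inequality. *)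
Lemma driven_path_displacement_le : I <= 2 * (D * h ^+ 2 * A + J).
Proof.
have cJ : {within `[0, h], continuous (fun s => enorm (v s))}.
  exact: (within_comp (@continuous_enorm R d) cv).
have IJ : I <= h * (D * (h * A + L * I)) + J.
  set c := D * (h * A + L * I).
  have -> : h * c = \int[leb]_(s in `[0, h]) c by rewrite within_Rintegral_cst// mulrC.
  rewrite /J -RintegralD//; last 2 first.
  - by apply: within_integrable => z; exact: cvg_cst.
  - exact: within_integrable.
  apply: le_within_Rintegral => //.
    by move=> z; apply: cvgD; [exact: cvg_cst|exact: cJ].
  move=> s sh; have := driven_path_drift_le sh; rewrite -/c.
  by have := enorm_triangle (p s - x - v s) (v s); rewrite subrK; lra.
have := ler_wpM2r I0 Lh; rewrite mul1r => LI.
nra.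
Qed.

(** The local error: the end point of the path minus one Euler step from [x] with the same noise. *)
Let r := p h - x - h *: a x - v h.

Let rE i : r 0 i = \int[leb]_(s in `[0, h]) (a (p s) 0 i - a x 0 i).
Proof.
have ca := within_comp (@continuous_drift_coord i) cp.
rewrite RintegralB//; last 2 first.
- exact: within_integrable.
- by apply: within_integrable => z; exact: cvg_cst.
rewrite within_Rintegral_cst// /r pE ?(ltW h0) ?lexx// !mxE.
by rewrite (mulrC h); lra.
Qed.

(** Controls the size of the local error: by the displacement bound, [L * I] is of order [h^(3/2)]
    in mean square. *)
Lemma driven_path_remainder_le i : `|r 0 i| <= L * I.
Proof.
have ca := within_comp (@continuous_drift_coord i) cp.
have cB : {within `[0, h], continuous (fun s => a (p s) 0 i - a x 0 i)}.
  by move=> z; apply: cvgB; [exact: ca|exact: cvg_cst].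
rewrite rE; apply: le_trans (le_normr_Rintegral _ (within_integrable cB)) _ => //.
rewrite -RintegralZl//; last exact: (within_integrable cI).
apply: le_within_Rintegral.
- exact: (within_comp (@norm_continuous R R) cB).
- apply: (@within_comp _ _ _ _ (fun z : R => L * z)) cI => z.
  by apply: cvgM; [exact: cvg_cst|exact: cvg_id].
- move=> s _; apply: le_trans (aL _ _).
  by have := coord_le_enorm (a (p s) - a x) i; rewrite !mxE.
Qed.

(* The drift increment is compared with its linearization along the noise; the
   linear term has mean zero, so the remaining error is of order [h^2]. *)
Lemma driven_path_remainder_linear_le i (g : 'rV[R]_d) (C : R) :
  (forall u, `|a (x + u) 0 i - a x 0 i - dotp g u| <= C * enorm u ^+ 2) ->
  `|r 0 i - dotp g (\row_j \int[leb]_(s in `[0, h]) v s 0 j)| <=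
    h * (L * (D * (h * A + L * I))) + C * \int[leb]_(s in `[0, h]) enorm (v s) ^+ 2.
Proof.
move=> taylor; have ca := within_comp (@continuous_drift_coord i) cp.
have cvj j : {within `[0, h], continuous (fun s => v s 0 j)}.
  exact: (within_comp (@continuous_coord R d j) cv).
have cg : {within `[0, h], continuous (fun s => dotp g (v s))}.
  apply: (@within_comp _ _ _ _ (fun u => dotp g u)) cv.
  apply: (@enorm_lipschitz_continuous _ _ _ (enorm g)) => u w.
  by rewrite -dotpNr -dotpDr normr_dotp_le.
have cB : {within `[0, h], continuous (fun s => a (p s) 0 i - a x 0 i)}.
  by move=> z; apply: cvgB; [exact: ca|exact: cvg_cst].
have cBg : {within `[0, h], continuous (fun s => a (p s) 0 i - a x 0 i - dotp g (v s))}.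
  by move=> z; apply: cvgB; [exact: cB|exact: cg].
have c2 : {within `[0, h], continuous (fun s => enorm (v s) ^+ 2)}.
  have cn := within_comp (@continuous_enorm R d) cv.
  exact: (within_comp (@exprn_continuous R 2) cn).
have -> : dotp g (\row_j \int[leb]_(s in `[0, h]) v s 0 j) =
    \int[leb]_(s in `[0, h]) dotp g (v s).
  have cgv j : {within `[0, h], continuous (fun s => g 0 j * v s 0 j)}.
    apply: (@within_comp _ _ _ _ (fun z : R => g 0 j * z)) (cvj j) => z.
    by apply: cvgM; [exact: cvg_cst|exact: cvg_id].
  rewrite /dotp within_Rintegral_sum//; apply: eq_bigr => j _.
  by rewrite mxE RintegralZl//; exact: (within_integrable (cvj j)).
rewrite rE -RintegralB//; [|exact: (within_integrable cB)|exact: (within_integrable cg)].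
apply: le_trans (le_normr_Rintegral _ (within_integrable cBg)) _ => //.
set c := L * (D * (h * A + L * I)).
have -> : h * c = \int[leb]_(s in `[0, h]) c by rewrite within_Rintegral_cst// mulrC.
have cC2 : {within `[0, h], continuous (fun s => C * enorm (v s) ^+ 2)}.
  apply: (@within_comp _ _ _ _ (fun z : R => C * z)) c2 => z.
  by apply: cvgM; [exact: cvg_cst|exact: cvg_id].
rewrite -RintegralZl//; last exact: (within_integrable c2).
rewrite -RintegralD//; last 2 first.
- by apply: within_integrable => z; exact: cvg_cst.
- exact: within_integrable.
apply: le_within_Rintegral.
- exact: (within_comp (@norm_continuous R R) cBg).
- by move=> z; apply: cvgD; [exact: cvg_cst|exact: cC2].
move=> s sh; have := taylor (v s).
have h1 : `|a (p s) 0 i - a (x + v s) 0 i| <= c.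
  apply: (@le_trans _ _ (L * enorm (p s - (x + v s)))).
    apply: le_trans (aL _ _).
    by have := coord_le_enorm (a (p s) - a (x + v s)) i; rewrite !mxE.
  by rewrite /c ler_wpM2l// opprD addrA driven_path_drift_le.
have -> : a (p s) 0 i - a x 0 i - dotp g (v s) = (a (p s) 0 i - a (x + v s) 0 i) +
  (a (x + v s) 0 i - a x 0 i - dotp g (v s)) by lra.
by move=> h2; apply: le_trans (ler_normD _ _) _; exact: lerD.
Qed.

End one_path.

(** The noise cancels and the integral of the distance is absorbed as in
    [driven_path_displacement_le]. The factor 2 gives no contraction; it serves to keep the
    transition operator of the equation within Lipschitz functions. *)
Lemma driven_path_lipschitz x y v p q :
  {within `[0, h], continuous p} -> {within `[0, h], continuous q} ->
  driven_path x v p -> driven_path y v q ->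
  enorm (p h - q h) <= 2 * enorm (x - y).
Proof.
move=> cp cq pE qE; set I := \int[leb]_(s in `[0, h]) enorm (p s - q s).
have cpq : {within `[0, h], continuous (fun s => enorm (p s - q s))}.
  have cB : {within `[0, h], continuous (fun s => p s - q s)}.
    by move=> z; apply: cvgB; [exact: cp|exact: cq].
  exact: (within_comp (@continuous_enorm R d) cB).
have cai i : {within `[0, h], continuous (fun s => a (p s) 0 i - a (q s) 0 i)}.
  move=> z; apply: cvgB; first exact: (within_comp (@continuous_drift_coord i) cp).
  exact: (within_comp (@continuous_drift_coord i) cq).
have cLI : {within `[0, h], continuous (fun s => L * enorm (p s - q s))}.
  apply: (@within_comp _ _ _ _ (fun z : R => L * z)) cpq => z.
  by apply: cvgM; [exact: cvg_cst|exact: cvg_id].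
have I0 : 0 <= I by apply: Rintegral_ge0 => *; exact: enorm_ge0.
have bound t : 0 <= t <= h -> enorm (p t - q t) <= enorm (x - y) + D * (L * I).
  move=> /andP[t0 th].
  have -> : p t - q t = (x - y) +
      \row_i \int[leb]_(s in `[0, t]) (a (p s) 0 i - a (q s) 0 i).
    rewrite pE ?t0// qE ?t0//; apply/rowP => i; rewrite !mxE RintegralB//.
    - by lra.
    - exact: (within_integrableS (within_comp (@continuous_drift_coord i) cp)).
    - exact: (within_integrableS (within_comp (@continuous_drift_coord i) cq)).
  apply: le_trans (enorm_triangle _ _) _; rewrite lerD2l; apply: enorm_le_unif => i.
  rewrite mxE; apply: le_trans (le_normr_Rintegral _ (within_integrableS (cai i) th)) _ => //.
  have cn := within_comp (@norm_continuous R R) (cai i).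
  apply: le_trans (within_Rintegral_initial_le cn (fun s => normr_ge0 _) th) _.
  rewrite -RintegralZl//; last exact: (within_integrable cpq).
  apply: le_within_Rintegral => // s _; apply: le_trans (aL _ _).
  by have := coord_le_enorm (a (p s) - a (q s)) i; rewrite !mxE.
have xy0 := enorm_ge0 (x - y).
have II : I <= h * (enorm (x - y) + D * (L * I)).
  set c := enorm (x - y) + D * (L * I).
  have -> : h * c = \int[leb]_(s in `[0, h]) c by rewrite within_Rintegral_cst// mulrC.
  by apply: le_within_Rintegral => // z; exact: cvg_cst.
have LI := ler_wpM2r I0 Lh; rewrite mul1r in LI.
have Ih : I <= 2 * h * enorm (x - y) by nra.
have := bound h; rewrite lexx ltW// => /(_ isT).
have DL : 0 <= D * L by rewrite mulr_ge0.
have := ler_wpM2l DL Ih; have := ler_wpM2r xy0 Lh; nra.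
Qed.

End pathwise_estimates.

(** * Time integrals of Brownian motion and moments of the local error *)

Section brownian_functionals.
Context {R : realType} {disp : measure_display} {T : measurableType disp}.
Context {d : nat}.
Variables (P : probability T R) (F : R -> set_system T) (W : R -> T -> 'rV[R]_d).
Hypotheses (filtF : filtration F) (WB : brownian_motion P F W).
Local Notation leb := (@lebesgue_measure R).
Local Notation D := d%:R.

Lemma adapted_random_vector (X : R -> T -> 'rV[R]_d) t : adapted F X -> 0 <= t ->
  random_vector (X t).
Proof.
move=> aX t0 _ B mB; case: filtF => _ Fm _; apply: (Fm t t0); apply: aX => //.
by exists B.
Qed.

(** Extends a path given for nonnegative times to the whole line by its value at 0. *)
Lemma within_max0_continuous (U : topologicalType) (f : R -> U) :
  {within `[0, +oo[, continuous f} -> continuous (fun s : R => f (Num.max s 0)).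
Proof.
move=> cf s; have /subspace_continuousP := cf => /(_ (Num.max s 0)).
rewrite /= in_itv/= andbT le_max lexx orbT => /(_ isT) cfs.
apply: (@cvg_comp _ _ _ (fun r : R => Num.max r 0) f _ _ _ _ cfs) => A /= wA.
have cm : continuous (fun s : R => Num.max s 0).
  by move=> z; apply: continuous_max; [exact: cvg_id|exact: cvg_cst].
apply: (@filterS _ (nbhs s) _ _ _ _ (cm s _ wA)) => z /=; apply.
by rewrite in_itv/= andbT le_max lexx orbT.
Qed.

Lemma gaussian_increment s : 0 < s ->
  isotropic_gaussian P (Num.sqrt s) (fun w => W s w - W 0 w).
Proof. by case: WB => _ _ _ /(_ 0 s (lexx _)) + s0 => /(_ s0)[]; rewrite subr0. Qed.

(** Joint measurability is obtained from continuity of every path, whereas [W] has continuous paths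
    only almost surely. The paths are therefore set to 0 on a measurable null set [N], and frozen at
    negative times. *)
Lemma brownian_path_modification : exists Wt : R -> T -> 'rV[R]_d,
  [/\ forall s j, measurable_fun setT (fun w => Wt s w 0 j),
      forall w, continuous (Wt ^~ w),
      {ae P, forall w, W 0 w = 0 /\ forall s, 0 <= s -> Wt s w = W s w} &
      forall w, Wt 0 w = 0].
Proof.
case: WB => aW W0 cW _.
have : {ae P, forall w, W 0 w = 0 /\ {within `[0, +oo[, continuous (W ^~ w)}}.
  by apply: filterS2 W0 cW => w ? ?; split.
move=> [N [mN N0 NW]].
exists (fun s w => if w \in N then 0 else W (Num.max s 0) w); split.
- move=> s j.
  have mW : measurable_fun setT (fun w => W (Num.max s 0) w 0 j).
    by apply: measurable_random_coord; apply: adapted_random_vector => //; rewrite le_max lexx orbT.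
  rewrite (_ : (fun w => _) = fun w => \1_(~` N) w * W (Num.max s 0) w 0 j).
    apply: measurable_funM => //; exact: measurable_indic (measurableC mN).
  apply/funext => w; rewrite indicE in_setC.
  by case: ifP; rewrite ?mxE ?mul0r ?mul1r.
- move=> w; case wN : (w \in N); first by move=> s; exact: cvg_cst.
  apply: (@within_max0_continuous _ (W ^~ w)); apply: contrapT => nc.
  move/negbT: wN; rewrite notin_setE; apply; apply: NW => -[_ ?]; exact: nc.
- exists N; split => // w /= nw; apply: contrapT => wN; apply: nw.
  have [W0w cWw] : W 0 w = 0 /\ {within `[0, +oo[, continuous (W ^~ w)}.
    by apply: contrapT => H; apply: wN; apply: NW.
  split=> // s s0; rewrite ifN ?notin_setE//; congr (W _ w).
  by rewrite max_l.
- move=> w; case: ifPn => // wN; rewrite maxxx; apply: contrapT => nc.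
  by move: wN; rewrite notin_setE; apply; apply: NW => -[? _]; exact: nc.
Qed.

Section modification.
Variable Wt : R -> T -> 'rV[R]_d.
Hypothesis mWt : forall s j, measurable_fun setT (fun w => Wt s w 0 j).
Hypothesis cWt : forall w, continuous (Wt ^~ w).
Hypothesis WtE : {ae P, forall w, W 0 w = 0 /\ forall s, 0 <= s -> Wt s w = W s w}.
Hypothesis Wt0 : forall w, Wt 0 w = 0.

Lemma brownian_coord_moments s j : 0 <= s ->
  [/\ integrableR P (fun w => Wt s w 0 j),
      \int[P]_w Wt s w 0 j = 0,
      integrableR P (fun w => Wt s w 0 j ^+ 2) &
      \int[P]_w (Wt s w 0 j ^+ 2) <= 8 * s].
Proof.
(* At time 0 the increment is degenerate and no Gaussian law is prescribed for it; [Wt0] settles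
   this case. *)
rewrite le_eqVlt => /predU1P[<-|s0].
  have -> : (fun w => Wt 0 w 0 j) = fun=> 0 by apply/funext => w; rewrite Wt0 mxE.
  have -> : (fun w => Wt 0 w 0 j ^+ 2) = fun=> 0.
    by apply/funext => w; rewrite Wt0 mxE expr0n.
  by rewrite Rintegral_cstR mulr0; split => //; exact: integrable_cstR.
have WG := gaussian_increment s0; have q0 : 0 < Num.sqrt s by rewrite sqrtr_gt0.
have [i1 e1] := gaussian_coord_mean j q0 WG.
have [i2 e2] := gaussian_coord_sqr j q0 WG.
rewrite sqr_sqrtr ?(ltW s0)// in e2.
have WE : {ae P, forall w, Wt s w 0 j = (W s w - W 0 w) 0 j}.
  apply: filterS WtE => w [W0 Ws]; rewrite Ws ?(ltW s0)// W0 subr0//.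
have mW := integrable_measurable_fun i1; have mW2 := integrable_measurable_fun i2.
have m2 : measurable_fun setT (fun w => Wt s w 0 j ^+ 2) by exact: measurable_funX.
have j1 : integrableR P (fun w => Wt s w 0 j).
  apply: ae_dominated_integrable (integrable_normR i1) _ => //.
  by apply: filterS WE => w ->.
have j2 : integrableR P (fun w => Wt s w 0 j ^+ 2).
  apply: ae_dominated_integrable i2 _ => //.
  by apply: filterS WE => w ->; rewrite ger0_norm ?sqr_ge0.
split=> //.
- apply/eqP; rewrite eq_le -{1}e1 -{2}e1; apply/andP; split.
    by apply: ae_le_Rintegral => //; apply: filterS WE => w ->.
  by apply: ae_le_Rintegral => //; apply: filterS WE => w ->.
- apply: le_trans e2; apply: ae_le_Rintegral => //.
  by apply: filterS WE => w ->.
Qed.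

Variable h : R.
Hypothesis h0 : 0 < h.

Definition noise_energy w := \int[leb]_(s in `[0, h]) enorm (Wt s w) ^+ 2.
(** The time integral of the noise, not divided by [h]: it is what the linear term of the Taylor
    expansion leaves after integration in time. *)
Definition noise_mean w : 'rV[R]_d := \row_j \int[leb]_(s in `[0, h]) Wt s w 0 j.

Let cW w : {within `[0, h], continuous (Wt ^~ w)}.
Proof. exact: continuous_subspaceT (@cWt w). Qed.

Lemma noise_mean_integral j :
  integrableR P (fun w => noise_mean w 0 j) /\
  \int[P]_w noise_mean w 0 j = 0.
Proof.
have -> : (fun w => noise_mean w 0 j) = (fun w => \int[leb]_(s in `[0, h]) Wt s w 0 j).
  by apply/funext => w; rewrite mxE.
have cWj w : continuous (fun s => Wt s w 0 j).
  exact: (continuous_compR (@continuous_coord R d j) (@cWt w)).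
have [||s /andP[s0 sh]|s /andP[s0 sh]|iI eI _] :=
  (* The bound [1 + 8 * h] on the first moments comes from [|x| <= 1 + x ^ 2]; it only has to be
     finite. *)
  @path_integral_fubini _ _ _ P h (1 + 8 * h) (fun s w => Wt s w 0 j) (ltW h0).
- exact: (continuous_process_measurable (fun s => mWt s j) cWj).
- by move=> w; apply: within_integrable; exact: continuous_subspaceT (cWj w).
- by have [] := brownian_coord_moments j s0.
- have [i1 _ i2 e2] := brownian_coord_moments j s0.
  apply: (@le_trans _ _ (\int[P]_w (1 + Wt s w 0 j ^+ 2))).
    apply: le_Rintegral => //; [exact: integrable_normR|exact: integrableDR (integrable_cstR _ _) i2|].
    move=> w _; have := sqr_ge0 (`|Wt s w 0 j| - 1).
    by rewrite -[X in _ <= 1 + X]real_normK ?num_real//; nra.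
  rewrite RintegralD// ?Rintegral_cstR//; last exact: integrable_cstR.
  by rewrite lerD2l (le_trans e2)// ler_wpM2l.
split=> //; apply: EFin_inj; rewrite eI integral0_eq// => s /=.
rewrite in_itv/= => /andP[s0 sh].
by have [_ ->] := brownian_coord_moments j s0.
Qed.

Lemma noise_energy_integral :
  integrableR P noise_energy /\
  \int[P]_w noise_energy w <= 8 * D * h ^+ 2.
Proof.
have cn w : continuous (fun s => enorm (Wt s w) ^+ 2).
  apply: (continuous_compR (@exprn_continuous R 2)).
  exact: (continuous_compR (@continuous_enorm R d) (@cWt w)).
have nE s : (fun w => enorm (Wt s w) ^+ 2) = fun w => \sum_j Wt s w 0 j ^+ 2.
  by apply/funext => w; rewrite sqr_enorm_sum.
have i2 s : 0 <= s -> integrableR P (fun w => enorm (Wt s w) ^+ 2).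
  move=> s0; rewrite nE; apply: integrable_sumR => j.
  by have [] := brownian_coord_moments j s0.
have e2 s : 0 <= s -> \int[P]_w enorm (Wt s w) ^+ 2 <= 8 * D * s.
  move=> s0; rewrite nE Rintegral_sumR => [|j]; last first.
    by have [] := brownian_coord_moments j s0.
  apply: (@le_trans _ _ (\sum_(j < d) (8 * s))).
    by apply: ler_sum => j _; have [] := brownian_coord_moments j s0.
  by rewrite sumr_const card_ord -[_ *+ d]mulr_natr mulrAC.
have e2h s : 0 <= s <= h -> \int[P]_w enorm (Wt s w) ^+ 2 <= 8 * D * h.
  by move=> /andP[s0 sh]; apply: le_trans (e2 s s0) _; rewrite ler_wpM2l// mulr_ge0.
have [||s /andP[s0 sh]|s sh|iI eI leI] :=
  @path_integral_fubini _ _ _ P h (8 * D * h) (fun s w => enorm (Wt s w) ^+ 2) (ltW h0).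
- apply: continuous_process_measurable cn => s; rewrite nE.
  by apply: measurable_sum => j; exact: measurable_funX.
- by move=> w; apply: within_integrable; exact: continuous_subspaceT (cn w).
- exact: i2.
- by under eq_Rintegral do rewrite ger0_norm ?sqr_ge0//; exact: e2h.
split=> //; apply: le_trans leI _.
by rewrite -mulrA -expr2.
Qed.

End modification.

Section one_step.
Variables (a : 'rV[R]_d -> 'rV[R]_d) (L Ct beta h : R).
Hypotheses (h0 : 0 < h) (h1 : h <= 1) (L0 : 0 <= L) (Ct0 : 0 <= Ct).
Hypotheses (beta0 : 0 <= beta) (beta1 : beta <= 1).
Hypothesis aL : forall u v, enorm (a u - a v) <= L * enorm (u - v).
Hypothesis Lh : 2 * D * L * h <= 1.
Hypothesis taylor : forall i x u,
  `|a (x + u) 0 i - a x 0 i - dotp (gradient (component a i) x) u| <= Ct * enorm u ^+ 2.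

Lemma sde_driven_path x X : sde_solution P F W a beta x X ->
  {ae P, forall w, {within `[0, h], continuous (X ^~ w)} /\
    driven_path a h x (fun t => beta *: W t w) (X ^~ w)}.
Proof.
move=> [_ cX eqX]; apply: filterS2 cX eqX => w cXw eqXw; split.
  apply: continuous_subspaceW cXw => s /=; rewrite !in_itv/= andbT.
  by case/andP.
by move=> t /andP[t0 _]; exact: eqXw.
Qed.

Lemma sde_solution_random_vector x X : sde_solution P F W a beta x X ->
  random_vector (X h).
Proof. by case=> aX _ _; apply: adapted_random_vector => //; exact: ltW. Qed.

Lemma sde_solution_lipschitz x y X Y :
  sde_solution P F W a beta x X -> sde_solution P F W a beta y Y ->
  {ae P, forall w, enorm (X h w - Y h w) <= 2 * enorm (x - y)}.
Proof.
move=> /sde_driven_path + /sde_driven_path; apply: filterS2 => w [cX eX] [cY eY].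
exact: (driven_path_lipschitz h0 L0 aL Lh cX cY eX eY).
Qed.

(** Written with the increment [W h w - W 0 w], whose law is prescribed, rather than with [W h w],
    which equals it almost surely. *)
Definition euler_remainder x (X : R -> T -> 'rV[R]_d) w :=
  X h w - x - h *: a x - beta *: (W h w - W 0 w).

Lemma measurable_euler_remainder x X i : sde_solution P F W a beta x X ->
  measurable_fun setT (fun w => euler_remainder x X w 0 i).
Proof.
move=> /sde_solution_random_vector mX; have [aW _ _ _] := WB.
rewrite (_ : (fun w => _) = fun w => (X h w 0 i - (x + h *: a x) 0 i)
    - beta * (W h w 0 i - W 0 w 0 i)).
  apply: measurable_funB; first apply: measurable_funB => //.
    exact: measurable_random_coord.
  apply: measurable_funM => //; apply: measurable_funB;
    apply: measurable_random_coord; apply: adapted_random_vector => //; exact: ltW.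
by apply/funext => w; rewrite /euler_remainder !mxE; lra.
Qed.

(** The mean is of order [h ^ 2], half an order better than the mean square suggests, because the
    linear part [beta * dotp g (M w)] has expectation zero and is subtracted before absolute values
    are taken. *)
Lemma euler_remainder_moments x X i : sde_solution P F W a beta x X ->
  let A := enorm (a x) in
  [/\ integrableR P (fun w => euler_remainder x X w 0 i ^+ 2),
      \int[P]_w (euler_remainder x X w 0 i ^+ 2) <=
        8 * L ^+ 2 * (D ^+ 2 * h ^+ 4 * A ^+ 2 + 8 * D * h ^+ 3) &
      `|\int[P]_w euler_remainder x X w 0 i| <=
        h ^+ 2 * (2 * L * D * A + 2 * L ^+ 2 * D * (1 + 8 * D) + 8 * Ct * D)].
Proof.
move=> solX A; have mr := measurable_euler_remainder i solX.
have [Wt [mWt cWt WtE Wt0]] := brownian_path_modification.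
pose S := noise_energy Wt h; pose M := noise_mean Wt h.
have [Si Se] := noise_energy_integral mWt cWt WtE Wt0 h0.
have Mi j : integrableR P (fun w => M w 0 j) /\ \int[P]_w M w 0 j = 0.
  exact: noise_mean_integral mWt cWt WtE Wt0 _ h0 j.
have S0 w : 0 <= S w by apply: Rintegral_ge0 => s _; exact: sqr_ge0.
pose g := gradient (component a i) x.
(* Apart from the mean-zero term, both bounds involve the noise through [S w] only, so that its
   expectation is the single one needed. *)
have bounds : {ae P, forall w,
    euler_remainder x X w 0 i ^+ 2 <= 8 * L ^+ 2 * (D ^+ 2 * h ^+ 4 * A ^+ 2 + h * S w) /\
    `|euler_remainder x X w 0 i - beta * dotp g (M w)| <=
       h * L * D * (2 * h * A + 2 * L * (h + S w)) + Ct * S w}.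
  apply: filterS2 WtE (sde_driven_path solX) => w [W0 WE] [cX eX].
  pose v s := beta *: Wt s w.
  have cv : {within `[0, h], continuous v}.
    apply: continuous_subspaceT => s; apply: cvgZr; exact: cWt.
  have eX' : driven_path a h x v (X ^~ w).
    by move=> t /andP[t0 th]; rewrite eX ?t0// /v WE.
  have rE : euler_remainder x X w = X h w - x - h *: a x - v h.
    by rewrite /euler_remainder W0 subr0 /v WE// ltW.
  have := driven_path_displacement_le h0 aL Lh cX cv eX'.
  have := driven_path_remainder_le h0 aL cX eX' i.
  have := driven_path_remainder_linear_le h0 L0 aL cX cv eX' (taylor i x).
  rewrite -rE -/A -/g.
  set I := \int[leb]_(s in _) enorm (X s w - x).
  set J := \int[leb]_(s in _) enorm (v s).
  set V := \int[leb]_(s in _) (enorm (v s) ^+ 2).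
  have cn : {within `[0, h], continuous (fun s => enorm (v s))}.
    exact: (within_comp (@continuous_enorm R d) cv).
  have JV : J ^+ 2 <= h * V by exact: sqr_within_Rintegral_le.
  have cWn : {within `[0, h], continuous (fun s => enorm (Wt s w) ^+ 2)}.
    apply: continuous_subspaceT; apply: (continuous_compR (@exprn_continuous R 2)).
    exact: (continuous_compR (@continuous_enorm R d) (@cWt w)).
  have VS : V <= S w.
    apply: le_within_Rintegral => //.
      exact: (within_comp (@exprn_continuous R 2) cn).
    move=> s _; rewrite /v enormZ exprMn ler_piMl ?sqr_ge0//.
    by rewrite ger0_norm// expr_le1.
  have J0 : 0 <= J by apply: Rintegral_ge0 => *; exact: enorm_ge0.
  have I0 : 0 <= I by apply: Rintegral_ge0 => *; exact: enorm_ge0.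
  have V0 : 0 <= V by apply: Rintegral_ge0 => *; exact: sqr_ge0.
  have A0 : 0 <= A by exact: enorm_ge0.
  have -> : dotp g (\row_j \int[leb]_(s in `[0, h]) v s 0 j) = beta * dotp g (M w).
    rewrite -dotpZr; congr (dotp g _); apply/rowP => j; rewrite !mxE.
    rewrite -RintegralZl//; last first.
      apply: within_integrable; apply: continuous_subspaceT.
      exact: (continuous_compR (@continuous_coord R d j) (@cWt w)).
    by apply: eq_Rintegral => s _; rewrite /v mxE.
  set r := euler_remainder _ _ _ _ _; set b := beta * _.
  have Sw0 := S0 w; move: (S w) VS Sw0 => s VS s0 hlin hr hI.
  have D0 : 0 <= D :> R by [].
  have hA0 : 0 <= h * A by rewrite mulr_ge0// ltW.
  have LI : L * I <= L * (2 * (D * h ^+ 2 * A + J)) by rewrite ler_wpM2l.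
  have Jhs : J ^+ 2 <= h * s by apply: le_trans JV _; rewrite ler_pM2l.
  (* The second bound contains [J] and not its square; [J ^ 2 <= h * s <= (h + s) ^ 2] keeps it
     linear in [s], which stands for [S w]. *)
  have Jle : J <= h + s.
    rewrite -(ler_pXn2r (_ : (0 < 2)%N)) ?nnegrE ?addr_ge0 ?(ltW h0)//.
    apply: le_trans Jhs _; have hs0 : 0 <= h * s by rewrite mulr_ge0// ltW.
    by have := sqr_ge0 h; have := sqr_ge0 s; nra.
  split.
    set q := D * h ^+ 2 * A in LI.
    have q0 : 0 <= q by rewrite mulr_ge0// mulr_ge0// sqr_ge0.
    have -> : D ^+ 2 * h ^+ 4 * A ^+ 2 = q ^+ 2 by rewrite /q; ring.
    rewrite -real_normK ?num_real//.
    apply: (@le_trans _ _ ((L * (2 * (q + J))) ^+ 2)).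
      by rewrite ler_pXn2r ?nnegrE ?mulr_ge0 ?addr_ge0 ?(le_trans hr).
    have -> : (L * (2 * (q + J))) ^+ 2 = 4 * L ^+ 2 * (q + J) ^+ 2 by ring.
    have -> : 8 * L ^+ 2 * (q ^+ 2 + h * s) = 4 * L ^+ 2 * (2 * (q ^+ 2 + h * s)) by ring.
    rewrite ler_wpM2l ?mulr_ge0 ?sqr_ge0//.
    by have := sqr_ge0 (q - J); nra.
  apply: le_trans hlin _; apply: lerD; last by rewrite ler_wpM2l.
  have -> : h * (L * (D * (h * A + L * I))) = h * L * D * (h * A + L * I) by ring.
  rewrite ler_wpM2l ?mulr_ge0 ?(ltW h0)//.
  have LhA := ler_wpM2r hA0 Lh; rewrite mul1r in LhA.
  have -> : 2 * h * A + 2 * L * (h + s) = h * A + (h * A + 2 * (L * (h + s))) by ring.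
  rewrite lerD2l; apply: le_trans LI _.
  have -> : L * (2 * (D * h ^+ 2 * A + J)) = 2 * D * L * h * (h * A) + 2 * (L * J) by ring.
  by apply: lerD => //; rewrite ler_pM2l// ler_wpM2l.
have i2 : integrableR P (fun w => euler_remainder x X w 0 i ^+ 2).
  apply: ae_dominated_integrable (integrableZR (8 * L ^+ 2) (integrableDR
    (integrable_cstR P (D ^+ 2 * h ^+ 4 * A ^+ 2)) (integrableZR h Si))) _.
  - exact: measurable_funX.
  - by apply: filterS bounds => w [b1 _]; rewrite ger0_norm ?sqr_ge0.
have i1 := sqr_integrable mr i2.
split=> //.
- have iS := integrableDR (integrable_cstR P (D ^+ 2 * h ^+ 4 * A ^+ 2)) (integrableZR h Si).
  apply: le_trans (ae_le_Rintegral i2 (integrableZR (8 * L ^+ 2) iS) _) _.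
    by apply: filterS bounds => w [].
  rewrite RintegralZl// ler_wpM2l ?mulr_ge0 ?sqr_ge0//.
  rewrite Rintegral_affineR// lerD2l.
  have -> : 8 * D * h ^+ 3 = h * (8 * D * h ^+ 2) by ring.
  by rewrite ler_pM2l.
- have iM : integrableR P (fun w => dotp g (M w)).
    by apply: integrable_sumR => j; apply: integrableZR; have [] := Mi j.
  have eM : \int[P]_w dotp g (M w) = 0.
    rewrite Rintegral_sumR => [|j]; last by apply: integrableZR; have [] := Mi j.
    by apply: big1 => j _; have [? e] := Mi j; rewrite RintegralZl// e mulr0.
  have irM : integrableR P (fun w => euler_remainder x X w 0 i - beta * dotp g (M w)).
    by apply: integrableBR => //; exact: integrableZR.
  have -> : \int[P]_w euler_remainder x X w 0 i =
      \int[P]_w (euler_remainder x X w 0 i - beta * dotp g (M w)).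
    by rewrite RintegralB//; [rewrite RintegralZl// eM mulr0 subr0|exact: integrableZR].
  apply: le_trans (le_normr_Rintegral measurableT irM) _.
  have iB : integrableR P (fun w =>
      h * L * D * (2 * h * A + 2 * L * h) + (h * L * D * (2 * L) + Ct) * S w).
    exact: integrable_affineR.
  apply: le_trans (ae_le_Rintegral (integrable_normR irM) iB _) _.
    by apply: filterS bounds => w [_ b2]; apply: le_trans b2 _; apply: eqW; ring.
  rewrite Rintegral_affineR//.
  have D0 : 0 <= D :> R by [].
  have k0 : 0 <= h * L * D * (2 * L) + Ct by rewrite addr_ge0 ?mulr_ge0 ?(ltW h0).
  apply: le_trans (lerD (lexx _) (ler_wpM2l k0 Se)) _.
  have -> : h ^+ 2 * (2 * L * D * A + 2 * L ^+ 2 * D * (1 + 8 * D) + 8 * Ct * D) =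
    h * L * D * (2 * h * A + 2 * L * h) + (1 * L * D * (2 * L) + Ct) * (8 * D * h ^+ 2) by ring.
  have z0 : 0 <= 8 * D * h ^+ 2 by rewrite mulr_ge0 ?sqr_ge0// mulr_ge0.
  rewrite lerD2l; apply: (ler_wpM2r z0); rewrite lerD2r.
  by rewrite !ler_wpM2r ?mulr_ge0.
Qed.

End one_step.

End brownian_functionals.

(** * One step of the scheme against one step of the equation *)

Lemma young_sqr (R : realFieldType) (e x y : R) : 0 < e ->
  2 * x * y <= e * x ^+ 2 + y ^+ 2 / e.
Proof.
move=> e0; rewrite -subr_ge0.
have -> : e * x ^+ 2 + y ^+ 2 / e - 2 * x * y = (e * x - y) ^+ 2 / e.
  by field; rewrite gt_eqF.
by rewrite divr_ge0 ?sqr_ge0// ltW.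
Qed.

Section mean_square_expansion.
Context {R : realType} {disp : measure_display} {T : measurableType disp}.
Context {d : nat}.
Variable P : probability T R.

(** Keeps the mean of [r] apart from its second moment: the cross term sees the mean alone, which
    for the local error is of smaller order. *)
Lemma sqr_enorm_shift_integral (z : 'rV[R]_d) (r : T -> 'rV[R]_d) :
  (forall i, measurable_fun setT (fun w => r w 0 i)) ->
  (forall i, integrableR P (fun w => r w 0 i ^+ 2)) ->
  integrableR P (fun w => enorm (z + r w) ^+ 2) /\
  \int[P]_w enorm (z + r w) ^+ 2 =
    enorm z ^+ 2 + 2 * dotp z (\row_i \int[P]_w r w 0 i) +
    \sum_i \int[P]_w (r w 0 i ^+ 2).
Proof.
move=> mr r2; have r1 i := sqr_integrable (mr i) (r2 i).
have E : (fun w => enorm (z + r w) ^+ 2) = (fun w =>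
    \sum_i (z 0 i ^+ 2 + (2 * z 0 i) * r w 0 i + r w 0 i ^+ 2)).
  by apply/funext => w; rewrite sqr_enorm_sum; apply: eq_bigr => i _; rewrite mxE; ring.
have i12 i : integrableR P (fun w => z 0 i ^+ 2 + (2 * z 0 i) * r w 0 i).
  exact: integrable_affineR.
have i123 i : integrableR P (fun w => z 0 i ^+ 2 + (2 * z 0 i) * r w 0 i + r w 0 i ^+ 2).
  exact: integrableDR.
rewrite E; split; first exact: integrable_sumR.
rewrite Rintegral_sumR// sqr_enorm_sum /dotp mulr_sumr -!big_split/=.
apply: eq_bigr => i _; rewrite RintegralD// RintegralD//; last first.
- exact: integrableZR.
- exact: integrable_cstR.
by rewrite Rintegral_cstR RintegralZl// mxE mulrA.
Qed.

End mean_square_expansion.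

Section dissipative_drift.
Context {R : realType} {d : nat}.
Variables (a : 'rV[R]_d -> 'rV[R]_d) (L K h : R).
Hypotheses (h0 : 0 < h) (K0 : 0 < K).
Hypothesis aL : forall u v, enorm (a u - a v) <= L * enorm (u - v).
Hypothesis aK : forall u v, dotp (u - v) (a u - a v) <= - K * enorm (u - v) ^+ 2.
Hypothesis L2h : L ^+ 2 * h <= K / 2.

(** Expanding the square gives the factor [1 - 2 * K * h + L ^ 2 * h ^ 2], and [L2h] bounds its last
    term by [K * h / 2]. *)
Lemma euler_drift_contraction x y :
  enorm (x - y + h *: (a x - a y)) ^+ 2 <= (1 - 3 / 2 * (K * h)) * enorm (x - y) ^+ 2.
Proof.
rewrite sqr_enormD dotpZr enormZ exprMn ger0_norm ?(ltW h0)//.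
have : enorm (a x - a y) ^+ 2 <= L ^+ 2 * enorm (x - y) ^+ 2.
  by rewrite -exprMn ler_pXn2r ?nnegrE ?enorm_ge0 ?(le_trans (enorm_ge0 _) (aL x y)).
have := aK x y; have := sqr_ge0 (enorm (x - y)).
move: (dotp _ _) (enorm (a x - a y) ^+ 2) (enorm (x - y) ^+ 2) => p q n n0 pn qn.
have h2 : h ^+ 2 * q <= h * (K / 2 * n).
  rewrite expr2 -mulrA ler_pM2l//; apply: le_trans (ler_wpM2l (ltW h0) qn) _.
  by rewrite mulrA (mulrC h) ler_wpM2r.
have := ler_wpM2l (ltW h0) pn; lra.
Qed.

Lemma euler_drift_lipschitz x y : K * h <= 1 ->
  enorm (x - y + h *: (a x - a y)) <= (1 - K * h / 2) * enorm (x - y).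
Proof.
move=> Kh; have k0 : 0 <= 1 - K * h / 2 by lra.
rewrite -(ler_pXn2r (_ : (0 < 2)%N)) ?nnegrE ?enorm_ge0 ?mulr_ge0 ?enorm_ge0//.
apply: le_trans (euler_drift_contraction x y) _; rewrite exprMn ler_wpM2r ?sqr_ge0//.
have := sqr_ge0 (K * h); have : 0 <= K * h by rewrite mulr_ge0// ltW.
by move: (K * h) => k; nra.
Qed.

End dissipative_drift.

Section coupled_step.
Context {R : realType} {disp : measure_display} {T : measurableType disp}.
Context {d : nat}.
Variable P : probability T R.
Variables (a : 'rV[R]_d -> 'rV[R]_d) (L K A0 beta h c1 c2 : R).
Local Notation D := d%:R.
Hypotheses (h0 : 0 < h) (h1 : h <= 1) (K0 : 0 < K) (A00 : 0 <= A0).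
Hypotheses (c10 : 0 <= c1) (c20 : 0 <= c2) (beta0 : 0 <= beta) (beta1 : beta <= 1).
Hypothesis aL : forall u v, enorm (a u - a v) <= L * enorm (u - v).
Hypothesis aK : forall u v, dotp (u - v) (a u - a v) <= - K * enorm (u - v) ^+ 2.
Hypothesis aA0 : enorm (a 0) <= A0.
Hypothesis L2h : L ^+ 2 * h <= K / 2.
Hypothesis Kh : K * h <= 1.
Variables (B : T -> 'rV[R]_d) (X : 'rV[R]_d -> T -> 'rV[R]_d).
Hypotheses (mB : random_vector B) (mX : forall x, random_vector (X x)).
Hypothesis B1 : forall i, \int[P]_w B w 0 i = 0.
Hypothesis iB2 : forall i, integrableR P (fun w => B w 0 i ^+ 2).
Hypothesis B2 : forall i, \int[P]_w (B w 0 i ^+ 2) <= 8 * h.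
Let r x w := X x w - x - h *: a x - beta *: B w.
Hypothesis ir2 : forall x i, integrableR P (fun w => r x w 0 i ^+ 2).
Hypothesis r2 : forall x i,
  \int[P]_w (r x w 0 i ^+ 2) <= c2 * h ^+ 3 * (1 + enorm x ^+ 2).
Hypothesis r1 : forall x i, `|\int[P]_w r x w 0 i| <= c1 * h ^+ 2 * (1 + enorm x).

(** A step of the scheme that uses the noise [B] of the equation, so that the noise cancels in the
    difference of the two steps. *)
Definition em_step y w := y + h *: a y + beta *: B w.

Let mr x i : measurable_fun setT (fun w => r x w 0 i).
Proof.
rewrite (_ : (fun w => _) = (fun w => (X x w 0 i - (x + h *: a x) 0 i) - beta * B w 0 i)).
  apply: measurable_funB; first by apply: measurable_funB => //; exact: measurable_random_coord.
  by apply: measurable_funM => //; exact: measurable_random_coord.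
by apply/funext => w; rewrite /r !mxE; lra.
Qed.

Let mean_remainder_le x : enorm (\row_i \int[P]_w r x w 0 i) <= D * (c1 * h ^+ 2 * (1 + enorm x)).
Proof. by apply: enorm_le_unif => i; rewrite mxE. Qed.

(** The difference of the steps is [z + r x w] with [z] deterministic. Young's inequality with
    weight [K * h / 2] splits the product of [enorm z] with the mean of [r]: the mean, of order
    [h ^ 2], then costs [h ^ 4 / h], and the contraction drops from [3 / 2 * (K * h)] to [K * h]. *)
Lemma coupled_step_distance x y :
  integrableR P (fun w => enorm (X x w - em_step y w) ^+ 2) /\
  \int[P]_w enorm (X x w - em_step y w) ^+ 2 <=
    (1 - K * h) * enorm (x - y) ^+ 2 +
    (4 * D ^+ 2 * c1 ^+ 2 / K + D * c2) * h ^+ 3 * (1 + enorm x ^+ 2).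
Proof.
pose z := x - y + h *: (a x - a y).
have -> : (fun w => enorm (X x w - em_step y w) ^+ 2) = (fun w => enorm (z + r x w) ^+ 2).
  apply/funext => w; congr (enorm _ ^+ 2); apply/rowP => i.
  by rewrite /r /em_step /z !mxE; lra.
have [iz ->] := sqr_enorm_shift_integral z (mr x) (ir2 x); split=> //.
have hz := euler_drift_contraction h0 aL aK L2h x y; rewrite -/z in hz.
have hG := mean_remainder_le x.
have hd := le_trans (dotp_le z _) (ler_wpM2l (enorm_ge0 z) hG).
have hs : \sum_i \int[P]_w (r x w 0 i ^+ 2) <= D * (c2 * h ^+ 3 * (1 + enorm x ^+ 2)).
  rewrite mulr_natl -[X in _ *+ X]card_ord -sumr_const.
  by apply: ler_sum => i _; exact: r2.
move: hz hd hs; set S := \sum_i _; set dz := dotp _ _.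
move: (enorm z) (enorm_ge0 z) (enorm x) (enorm_ge0 x) (enorm (x - y)) (enorm_ge0 (x - y)).
move=> zn z0 n n0 m m0 hz hd hs.
have k0 : 0 < K * h / 2 by rewrite divr_gt0// mulr_gt0.
have yG := young_sqr zn (D * (c1 * h ^+ 2 * (1 + n))) k0.
have G2 : (D * (c1 * h ^+ 2 * (1 + n))) ^+ 2 / (K * h / 2) <=
    4 * D ^+ 2 * c1 ^+ 2 / K * h ^+ 3 * (1 + n ^+ 2).
  have -> : (D * (c1 * h ^+ 2 * (1 + n))) ^+ 2 / (K * h / 2) =
      2 * D ^+ 2 * c1 ^+ 2 / K * h ^+ 3 * (1 + n) ^+ 2.
    by field; rewrite !gt_eqF.
  have -> : 4 * D ^+ 2 * c1 ^+ 2 / K * h ^+ 3 * (1 + n ^+ 2) =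
      2 * D ^+ 2 * c1 ^+ 2 / K * h ^+ 3 * (2 * (1 + n ^+ 2)) by ring.
  rewrite ler_wpM2l//; last by have := sqr_ge0 (1 - n); nra.
  by rewrite mulr_ge0 ?exprn_ge0 ?(ltW h0)// divr_ge0 ?(ltW K0)// mulr_ge0 ?sqr_ge0// mulr_ge0 ?sqr_ge0.
have hz2 : (1 + K * h / 2) * zn ^+ 2 <= (1 - K * h) * m ^+ 2.
  apply: le_trans (ler_wpM2l (addr_ge0 ler01 (ltW k0)) hz) _.
  rewrite mulrA ler_wpM2r ?sqr_ge0//.
  by have := sqr_ge0 (K * h); move: (K * h) => k; nra.
apply: (@le_trans _ _ (zn ^+ 2 + 2 * (zn * (D * (c1 * h ^+ 2 * (1 + n)))) +
    D * (c2 * h ^+ 3 * (1 + n ^+ 2)))).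
  by rewrite lerD// lerD2l ler_pM2l.
lra.
Qed.

(** Here the noise does not cancel and contributes [16 * D * h]. Young's inequality with weight
    [K * h / 4] is used twice, once for the drift at 0 and once for the mean of the local error,
    which leaves the factor [1 - K * h]; the growth in [x] of the local error takes another
    [K * h / 2], whence the smallness condition on [h ^ 2]. *)
Lemma coupled_step_moment x : 
  (8 * D ^+ 2 * c1 ^+ 2 / K + 2 * D * c2) * h ^+ 2 <= K / 2 ->
  integrableR P (fun w => enorm (X x w) ^+ 2) /\
  \int[P]_w enorm (X x w) ^+ 2 <=
    (1 - K * h / 2) * enorm x ^+ 2 + (10 * A0 ^+ 2 / K + 16 * D + K / 2) * h.
Proof.
move=> c3h; pose u := x + h *: a x; pose r' w := beta *: B w + r x w.
have -> : (fun w => enorm (X x w) ^+ 2) = (fun w => enorm (u + r' w) ^+ 2).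
  apply/funext => w; congr (enorm _ ^+ 2); apply/rowP => i.
  by rewrite /r' /r /u !mxE; lra.
have mBi i := measurable_random_coord i mB.
have iB i := sqr_integrable (mBi i) (iB2 i).
have ir i := sqr_integrable (mr x i) (ir2 x i).
have r'E i : (fun w => r' w 0 i) = (fun w => beta * B w 0 i + r x w 0 i).
  by apply/funext => w; rewrite /r' !mxE.
have mr' i : measurable_fun setT (fun w => r' w 0 i).
  by rewrite r'E; apply: measurable_funD => //; exact: measurable_funM.
have bnd w i : `|r' w 0 i ^+ 2| <= 2 * B w 0 i ^+ 2 + 2 * r x w 0 i ^+ 2.
  have -> : r' w 0 i = beta * B w 0 i + r x w 0 i by rewrite /r' !mxE.
  rewrite ger0_norm ?sqr_ge0//; have := sqr_ge0 (beta * B w 0 i - r x w 0 i).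
  have : (beta * B w 0 i) ^+ 2 <= B w 0 i ^+ 2.
    by rewrite exprMn ler_piMl ?sqr_ge0// expr_le1.
  by nra.
have ibnd i : integrableR P (fun w => 2 * B w 0 i ^+ 2 + 2 * r x w 0 i ^+ 2).
  by apply: integrableDR; exact: integrableZR.
have ir'2 i : integrableR P (fun w => r' w 0 i ^+ 2).
  by apply: dominated_integrable (ibnd i) _ => //; exact: measurable_funX.
have [iu ->] := sqr_enorm_shift_integral u mr' ir'2; split=> //.
have -> : \row_i \int[P]_w r' w 0 i = \row_i \int[P]_w r x w 0 i.
  apply/rowP => i; rewrite !mxE r'E RintegralD//; last exact: integrableZR.
  by rewrite RintegralZl// B1 mulr0 add0r.
have hG := mean_remainder_le x.
have hd := le_trans (dotp_le u _) (ler_wpM2l (enorm_ge0 u) hG).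
have hs : \sum_i \int[P]_w (r' w 0 i ^+ 2) <=
    D * (16 * h + 2 * (c2 * h ^+ 3 * (1 + enorm x ^+ 2))).
  rewrite mulr_natl -[X in _ *+ X]card_ord -sumr_const.
  apply: ler_sum => i _.
  apply: le_trans (le_Rintegral measurableT (ir'2 i) (ibnd i) _) _.
    by move=> w _; apply: le_trans (ler_norm _) (bnd w i).
  rewrite RintegralD//; [|exact: integrableZR|exact: integrableZR].
  rewrite !RintegralZl//; have := B2 i; have := r2 x i; lra.
have hp := euler_drift_contraction h0 aL aK L2h x 0; rewrite subr0 in hp.
have hu : enorm u <= enorm (x + h *: (a x - a 0)) + h * A0.
  have -> : u = x + h *: (a x - a 0) + h *: a 0 by rewrite /u scalerBr addrA subrK.
  apply: le_trans (enorm_triangle _ _) _; rewrite lerD2l enormZ ger0_norm ?(ltW h0)//.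
  by rewrite ler_pM2l.
move: hp hu hd hs; set S := \sum_i _; set dz := dotp _ _.
move: (enorm (x + _)) (enorm_ge0 (x + h *: (a x - a 0))).
move: (enorm u) (enorm_ge0 u) (enorm x) (enorm_ge0 x).
move=> un u0 n n0 p p0 hp hu hd hs.
have k0 : 0 < K * h / 4 by rewrite divr_gt0// mulr_gt0.
have y1 := young_sqr un (D * (c1 * h ^+ 2 * (1 + n))) k0.
have y2 := young_sqr p (h * A0) k0.
have G2 : (D * (c1 * h ^+ 2 * (1 + n))) ^+ 2 / (K * h / 4) <=
    8 * D ^+ 2 * c1 ^+ 2 / K * h ^+ 3 * (1 + n ^+ 2).
  have -> : (D * (c1 * h ^+ 2 * (1 + n))) ^+ 2 / (K * h / 4) =
      4 * D ^+ 2 * c1 ^+ 2 / K * h ^+ 3 * (1 + n) ^+ 2.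
    by field; rewrite !gt_eqF.
  have -> : 8 * D ^+ 2 * c1 ^+ 2 / K * h ^+ 3 * (1 + n ^+ 2) =
      4 * D ^+ 2 * c1 ^+ 2 / K * h ^+ 3 * (2 * (1 + n ^+ 2)) by ring.
  rewrite ler_wpM2l//; last by have := sqr_ge0 (1 - n); nra.
  by rewrite mulr_ge0 ?exprn_ge0 ?(ltW h0)// divr_ge0 ?(ltW K0)// mulr_ge0 ?sqr_ge0// mulr_ge0 ?sqr_ge0.
have hA : (h * A0) ^+ 2 + (h * A0) ^+ 2 / (K * h / 4) <= 5 * A0 ^+ 2 / K * h.
  have -> : (h * A0) ^+ 2 / (K * h / 4) = 4 * A0 ^+ 2 / K * h by field; rewrite !gt_eqF.
  have -> : (h * A0) ^+ 2 = K * h * (A0 ^+ 2 / K * h) by field; rewrite gt_eqF.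
  have : K * h * (A0 ^+ 2 / K * h) <= A0 ^+ 2 / K * h.
    by rewrite ler_piMl// mulr_ge0 ?(ltW h0)// divr_ge0 ?sqr_ge0// ltW.
  by lra.
have c3 : (8 * D ^+ 2 * c1 ^+ 2 / K + 2 * D * c2) * h ^+ 3 * (1 + n ^+ 2) <=
    K * h / 2 * (1 + n ^+ 2).
  rewrite ler_wpM2r ?addr_ge0 ?sqr_ge0//.
  have -> : (8 * D ^+ 2 * c1 ^+ 2 / K + 2 * D * c2) * h ^+ 3 =
    (8 * D ^+ 2 * c1 ^+ 2 / K + 2 * D * c2) * h ^+ 2 * h by ring.
  by rewrite [leRHS]mulrAC ler_pM2r.
have un2 : un ^+ 2 <= (1 + K * h / 4) * p ^+ 2 + 5 * A0 ^+ 2 / K * h.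
  apply: (@le_trans _ _ ((p + h * A0) ^+ 2)).
    by rewrite ler_pXn2r ?nnegrE ?addr_ge0// mulr_ge0// ltW.
  by rewrite sqrrD; lra.
set E5 := 5 * A0 ^+ 2 / K * h in hA un2.
have e50 : 0 <= E5 by rewrite mulr_ge0 ?(ltW h0)// divr_ge0 ?(ltW K0)// mulr_ge0 ?sqr_ge0.
have main : (1 + K * h / 4) * un ^+ 2 <= (1 - K * h) * n ^+ 2 + 2 * E5.
  have k1 : 0 <= 1 + K * h / 4 by rewrite addr_ge0// ltW.
  have a1 := ler_wpM2l k1 un2.
  have a2 : (1 + K * h / 4) * ((1 + K * h / 4) * p ^+ 2) <= (1 - K * h) * n ^+ 2.
    rewrite mulrA; apply: le_trans (ler_wpM2l (mulr_ge0 k1 k1) hp) _.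
    rewrite mulrA ler_wpM2r ?sqr_ge0//.
    have := sqr_ge0 (K * h); have := mulr_gt0 K0 h0.
    by move: (K * h) Kh => k k1' k0' k2'; nra.
  have a3 : (1 + K * h / 4) * E5 <= 2 * E5 by rewrite ler_wpM2r//; have := Kh; lra.
  by rewrite mulrDr in a1; lra.
have -> : 10 * A0 ^+ 2 / K = 2 * (5 * A0 ^+ 2 / K) by ring.
apply: (@le_trans _ _ (un ^+ 2 + 2 * (un * (D * (c1 * h ^+ 2 * (1 + n)))) +
    D * (16 * h + 2 * (c2 * h ^+ 3 * (1 + n ^+ 2))))).
  by rewrite lerD// lerD2l ler_pM2l.
have -> : (2 * (5 * A0 ^+ 2 / K) + 16 * D + K / 2) * h = 2 * E5 + 16 * D * h + K * h / 2.
  by rewrite /E5; ring.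
lra.
Qed.

End coupled_step.

(** * Transition operators and the invariant measure *)

Section dominated_real.
Context {disp : measure_display} {T : measurableType disp} {R : realType}.
Variable P : probability T R.

Lemma Rintegral_dominated_cvg (f_ : nat -> T -> R) (f g : T -> R) :
  (forall n, measurable_fun setT (f_ n)) -> measurable_fun setT f ->
  (forall w, f_ n w @[n --> \oo] --> f w) ->
  integrableR P g -> (forall n w, `|f_ n w| <= g w) ->
  \int[P]_w f_ n w @[n --> \oo] --> \int[P]_w f w.
Proof.
move=> mf_ mf cf ig fg.
have fi n : integrableR P (f_ n).
  exact: dominated_integrable (mf_ n) ig (fg n).
have [|||||fint _ c] := @dominated_convergence _ _ _ P setT measurableT
    (fun n => EFin \o f_ n) (EFin \o f) (EFin \o g).
- by move=> n; exact/measurable_EFinP.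
- exact/measurable_EFinP.
- by apply: aeW => w _; apply/fine_cvgP; split; [exact: nearW|exact: cf].
- exact: ig.
- by apply: aeW => w n _ /=; rewrite lee_fin.
by move: c; rewrite -EFin_Rintegral// => /fine_cvg.
Qed.

End dominated_real.

Section lipschitz.
Context {R : realType} {d : nat}.
Implicit Types (g : 'rV[R]_d -> R) (l : R).

Definition lip l g := 0 <= l /\ forall u v, `|g u - g v| <= l * enorm (u - v).

Lemma lip_continuous l g : lip l g -> continuous g.
Proof. by case=> _; exact: enorm_lipschitz_continuous. Qed.

Context {disp : measure_display} {T : measurableType disp}.
Variable P : probability T R.

Lemma lip_measurable l g (Z : T -> 'rV[R]_d) : lip l g -> random_vector Z ->
  measurable_fun setT (fun w => g (Z w)).
Proof.
move=> /lip_continuous cg mZ.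
exact: (measurableT_comp (continuous_borel_rV cg) mZ).
Qed.

(** The growth is stated as quadratic to match second moments, the only ones that are controlled. *)
Lemma lip_growth l g u : lip l g -> `|g u| <= (`|g 0| + l) + l * enorm u ^+ 2.
Proof.
move=> [l0 gl]; have := gl u 0; rewrite subr0 => gu.
have := ler_normD (g u - g 0) (g 0); rewrite subrK.
have : l * enorm u <= l * (1 + enorm u ^+ 2).
  by rewrite ler_wpM2l//; have := sqr_ge0 (enorm u - 1); have := enorm_ge0 u; nra.
by lra.
Qed.

Lemma lip_integrable l g (Z : T -> 'rV[R]_d) : lip l g -> random_vector Z ->
  integrableR P (fun w => enorm (Z w) ^+ 2) ->
  integrableR P (fun w => g (Z w)).
Proof.
move=> gl mZ Z2; apply: dominated_integrable (fun w => lip_growth (Z w) gl).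
  exact: (lip_measurable gl mZ).
exact: integrable_affineR.
Qed.

(** The Markov operator of the kernel that sends [x] to the law of [X x]. *)
Definition step_op (X : 'rV[R]_d -> T -> 'rV[R]_d) g x := \int[P]_w g (X x w).

(** The exceptional null set may depend on [x] and [y], as both are fixed before integrating. *)
Lemma lip_step_op (X : 'rV[R]_d -> T -> 'rV[R]_d) c l g : 0 <= c ->
  (forall x, random_vector (X x)) ->
  (forall x, integrableR P (fun w => enorm (X x w) ^+ 2)) ->
  (forall x y, {ae P, forall w, enorm (X x w - X y w) <= c * enorm (x - y)}) ->
  lip l g -> lip (c * l) (step_op X g).
Proof.
move=> c0 mX X2 Xc gl; have ig x := lip_integrable gl (mX x) (X2 x).
split; first by apply: mulr_ge0 => //; have [] := gl.
move=> x y; rewrite /step_op -RintegralB//.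
apply: le_trans (le_normr_Rintegral measurableT (integrableBR (ig x) (ig y))) _.
rewrite -[leRHS](Rintegral_cstR P); apply: ae_le_Rintegral.
- exact: integrable_normR (integrableBR (ig x) (ig y)).
- exact: integrable_cstR.
- apply: filterS (Xc x y) => w Xw; have [l0 gl'] := gl.
  by apply: le_trans (gl' _ _) _; rewrite (mulrC c) -mulrA ler_wpM2l.
Qed.

Lemma lip_iter_step_op X c l g k : 0 <= c ->
  (forall x, random_vector (X x)) ->
  (forall x, integrableR P (fun w => enorm (X x w) ^+ 2)) ->
  (forall x y, {ae P, forall w, enorm (X x w - X y w) <= c * enorm (x - y)}) ->
  lip l g -> lip (c ^+ k * l) (iter k (step_op X) g).
Proof.
move=> c0 mX X2 Xc gl; elim: k => [|k IH]; first by rewrite expr0 mul1r.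
by rewrite iterS exprS -mulrA; exact: lip_step_op.
Qed.

End lipschitz.


(** * Lipschitz approximations of indicators, and truncations *)

Section thresholds.
Context {R : realType}.

(* Lipschitz approximations of the indicator function of ]t, +oo[. *)
Definition ramp (t : R) (n : nat) (r : R) := Num.min (Num.max (n%:R * (r - t)) 0) 1.

Lemma ramp_ge0 t n r : 0 <= ramp t n r.
Proof. by rewrite /ramp le_min le_max lexx orbT/=. Qed.

Lemma ramp_le1 t n r : ramp t n r <= 1.
Proof. by rewrite /ramp ge_min lexx orbT. Qed.

Lemma dist_max_le (x y z : R) : `|Num.max x z - Num.max y z| <= `|x - y|.
Proof.
rewrite !maxEle ler_norml.
by case: (leP x z); case: (leP y z) => ? ?; case: (ler0P (x - y)) => ?;
  apply/andP; split; lra.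
Qed.

Lemma dist_min_le (x y z : R) : `|Num.min x z - Num.min y z| <= `|x - y|.
Proof.
rewrite !minEle ler_norml.
by case: (leP x z); case: (leP y z) => ? ?; case: (ler0P (x - y)) => ?;
  apply/andP; split; lra.
Qed.

Lemma ramp_lipschitz t n r s : `|ramp t n r - ramp t n s| <= n%:R * `|r - s|.
Proof.
have -> : n%:R * `|r - s| = `|n%:R * (r - t) - n%:R * (s - t)|.
  by rewrite -mulrBr normrM (ger0_norm (ler0n _ n)); congr (_ * `|_|); ring.
exact: le_trans (dist_min_le _ _ _) (dist_max_le _ _ _).
Qed.

Lemma cvg_ramp t r : ramp t n r @[n --> \oo] --> ((t < r)%R%:R : R).
Proof.
have [tr|rt] := ltP t r; last first.
  apply: cvg_near_cst; apply: nearW => n; rewrite /ramp max_r ?min_l//.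
  by rewrite mulr_ge0_le0// subr_le0.
apply: cvg_near_cst; near=> n.
have k : 1 <= n%:R * (r - t).
  by rewrite -ler_pdivrMr ?subr_gt0//; near: n; exact: nbhs_infty_ger.
by rewrite /ramp max_l ?min_r// (le_trans ler01).
Unshelve. all: by end_near. Qed.

(** A discrete layer-cake formula: the sum counts the integers [1, ..., n] strictly below [r]. At
    most [n] of them are, even for [r = n + 1], so the range of [r] may extend to [n + 1]. *)
Lemma count_thresholds (n : nat) (r : R) : 0 <= r <= n.+1%:R ->
  r - 1 <= \sum_(j < n) ((j.+1%:R < r)%R%:R : R) <= r.
Proof.
elim: n => [|n IH] /andP[r0 rn]; first by rewrite big_ord0 r0 andbT; lra.
rewrite big_ord_recr/=; have [rn1|rn1] := leP r n.+1%:R.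
  by rewrite addr0; apply: IH; rewrite r0.
rewrite (eq_bigr (fun=> 1)) => [|j _]; last first.
  suff -> : (j.+1%:R < r)%R by [].
  by apply: le_lt_trans rn1; rewrite ler_nat ltnS ltnW.
rewrite sumr_const card_ord -[1 *+ n]/(n%:R) natr1 (ltW rn1) andbT.
by rewrite lerBlDr natr1.
Qed.

End thresholds.

Section lipschitz_closure.
Context {R : realType} {d : nat}.
Implicit Types (g : 'rV[R]_d -> R) (l : R).

Lemma lip_comp l g c (u : R -> R) : 0 <= c ->
  (forall r s, `|u r - u s| <= c * `|r - s|) -> lip l g -> lip (c * l) (u \o g).
Proof.
move=> c0 uc [l0 gl]; split; first exact: mulr_ge0.
by move=> x y; apply: le_trans (uc _ _) _; rewrite -mulrA ler_wpM2l.
Qed.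

Lemma lip_affine l g k b : lip l g -> lip (`|k| * l) (fun y => k * g y + b).
Proof.
move=> gl; apply: (lip_comp (u := fun r => k * r + b)) gl => // r s.
have -> : k * r + b - (k * s + b) = k * (r - s) by ring.
by rewrite normrM.
Qed.

Lemma lip_enorm : lip 1 (@enorm R d).
Proof. by split=> // u v; rewrite mul1r dist_enorm_le. Qed.

Definition clamp (M r : R) := Num.min (Num.max r (- M)) M.

Lemma clamp_lipschitz M r s : `|clamp M r - clamp M s| <= 1 * `|r - s|.
Proof. by rewrite mul1r; exact: le_trans (dist_min_le _ _ _) (dist_max_le _ _ _). Qed.

Lemma clamp_norm_le M r : 0 <= M -> `|clamp M r| <= M /\ `|clamp M r| <= `|r|.
Proof.
move=> M0; rewrite /clamp; have := ler_norm r; have := ler_norm (- r); rewrite normrN !ler_norml.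
move: `|r| => nr r1 r2.
by case: (leP r (- M)) => r3; [case: (leP (- M) M)|case: (leP r M)] => r4;
  split; apply/andP; split; lra.
Qed.

Lemma clamp_id M r : `|r| <= M -> clamp M r = r.
Proof. by rewrite ler_norml /clamp => /andP[? ?]; rewrite max_l// min_l. Qed.

Lemma cvg_clamp r : clamp n%:R r @[n --> \oo] --> r.
Proof.
apply: cvg_near_cst; near=> n; apply: clamp_id; near: n.
exact: nbhs_infty_ger.
Unshelve. all: by end_near. Qed.

End lipschitz_closure.

(** * Invariance tested on Lipschitz functions, and moments of [pi] *)

Section invariance.
Context {R : realType} {d : nat} {disp : measure_display} {T : measurableType disp}.
Variables (P : probability T R) (pi : probability (borel_rV R d) R).
Variables (X : 'rV[R]_d -> T -> 'rV[R]_d) (c : R).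
Hypothesis c0 : 0 <= c.
Hypothesis mX : forall x, random_vector (X x).
Hypothesis X2 : forall x, integrableR P (fun w => enorm (X x w) ^+ 2).
Hypothesis Xc : forall x y, {ae P, forall w, enorm (X x w - X y w) <= c * enorm (x - y)}.
Hypothesis inv : forall B : set (borel_rV R d), measurable B ->
  (\int[pi]_x P (X x @^-1` B))%E = pi B.
Implicit Types (g : 'rV[R]_d -> R).

Local Notation S := (step_op P X).

Lemma lip_borel l g : lip l g -> measurable_fun setT (g : borel_rV R d -> R).
Proof. by move=> /lip_continuous; exact: continuous_borel_rV. Qed.

Let exceed_set l g t : lip l g ->
  measurable ([set x | (t < g x)%R] : set (borel_rV R d)).
Proof.
move=> /lip_borel mg; have := mg measurableT _ (measurable_itv `]t, +oo[).
rewrite setTI (_ : _ @^-1` _ = [set x | (t < g x)%R])//.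
by apply/seteqP; split => x /=; rewrite in_itv/= ?andbT.
Qed.

Let exceed_indic l g t (Z : T -> 'rV[R]_d) : lip l g -> random_vector Z ->
  measurable_fun setT (fun w => (t < g (Z w))%R%:R : R) /\
  (\int[P]_w (t < g (Z w))%R%:R)%:E = P (Z @^-1` [set x | (t < g x)%R]).
Proof.
move=> gl mZ; have mB := exceed_set t gl.
have mA : measurable (Z @^-1` [set x | (t < g x)%R]).
  by rewrite -[X in measurable X]setTI; exact: mZ.
have E : (fun w => (t < g (Z w))%R%:R : R) = \1_(Z @^-1` [set x | (t < g x)%R]).
  by apply/funext => w; rewrite indicE mem_setE.
rewrite E; split; first exact: measurable_indic.
rewrite EFin_Rintegral//; last exact: integrable_indic.
by rewrite integral_indic// setIT.
Qed.

(** Measurability in [x] is not among the hypotheses on [X]; the function is the pointwise limit of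
    the Lipschitz functions [S (ramp t n \o g)]. *)
Lemma measurable_exceed l g t : lip l g ->
  measurable_fun setT (fun x : borel_rV R d => \int[P]_w (t < g (X x w))%R%:R).
Proof.
move=> gl; apply: (measurable_fun_cvg (h := fun n (x : borel_rV R d) => S (ramp t n \o g) x)).
- move=> n; apply: lip_borel.
  apply: (lip_step_op c0 mX X2 Xc (lip_comp (ler0n R n) (ramp_lipschitz t n) gl)).
- move=> x _; apply: Rintegral_dominated_cvg (integrable_cstR P 1) _.
  + move=> n; apply: (lip_measurable (lip_comp (ler0n R n) (ramp_lipschitz t n) gl)).
    exact: mX.
  + by have [] := exceed_indic t gl (mX x).
  + by move=> w; exact: cvg_ramp.
  + by move=> n w; rewrite ger0_norm ?ramp_ge0 ?ramp_le1.
Qed.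

Let exceed_01 l g t x : lip l g -> 0 <= \int[P]_w ((t < g (X x w))%R%:R : R) <= 1.
Proof.
move=> gl; have [_ E] := exceed_indic t gl (mX x).
by rewrite -!lee_fin E measure_ge0/= probability_le1// -[X in measurable X]setTI;
  exact: mX measurableT _ (exceed_set t gl).
Qed.

Lemma invariance_exceed l g t : lip l g ->
  integrableR pi (fun x => \int[P]_w (t < g (X x w))%R%:R) /\
  \int[pi]_x \int[P]_w ((t < g (X x w))%R%:R : R) = \int[pi]_x (t < g x)%R%:R.
Proof.
move=> gl; have mE := measurable_exceed t gl.
have iE : integrableR pi (fun x => \int[P]_w (t < g (X x w))%R%:R).
  apply: dominated_integrable (integrable_cstR pi 1) _ => // x.
  by have /andP[? ?] := exceed_01 t x gl; rewrite ger0_norm.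
have mB := exceed_set t gl.
split=> //; apply: EFin_inj; rewrite !EFin_Rintegral//; last first.
  rewrite (_ : (fun=> _) = \1_[set x : borel_rV R d | (t < g x)%R]).
    exact: integrable_indic.
  by apply/funext => x; rewrite indicE mem_setE.
transitivity (pi [set x : borel_rV R d | (t < g x)%R]).
  rewrite -inv//; apply: eq_integral => x _.
  by have [_] := exceed_indic t gl (mX x).
transitivity (\int[pi]_x (\1_[set x : borel_rV R d | (t < g x)%R] x)%:E)%E.
  by rewrite integral_indic// setIT.
by apply: eq_integral => x _; rewrite indicE mem_setE.
Qed.


Let lipS l g : lip l g -> lip (c * l) (S g).
Proof. exact: lip_step_op. Qed.

Lemma step_op_affine l g k b x : lip l g ->
  S (fun y => k * g y + b) x = k * S g x + b.
Proof.
move=> gl; have ig := lip_integrable gl (mX x) (X2 x).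
rewrite /step_op RintegralD//; [|exact: integrableZR|exact: integrable_cstR].
by rewrite RintegralZl// Rintegral_cstR.
Qed.

Lemma step_op_norm_le l g x M : lip l g -> (forall y, `|g y| <= M) -> `|S g x| <= M.
Proof.
move=> gl gM; have ig := lip_integrable gl (mX x) (X2 x).
apply: le_trans (le_normr_Rintegral measurableT ig) _.
rewrite -[leRHS](Rintegral_cstR P); apply: le_Rintegral => //.
- exact: integrable_normR.
- exact: integrable_cstR.
Qed.

Let bounded_integrable l g M : lip l g -> (forall x, `|g x| <= M) ->
  integrableR pi (g : borel_rV R d -> R).
Proof.
move=> gl gM; apply: dominated_integrable (integrable_cstR pi M) _ => //.
exact: lip_borel gl.
Qed.

(* [g] is the uniform limit of the step functions n^-1 sum_j 1_{g > j / n}, and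
   [invariant_measure] applies to the sets {g > j / n}. *)
Lemma invariance_unit l g : lip l g -> (forall x, 0 <= g x <= 1) ->
  \int[pi]_x S g x = \int[pi]_x (g x).
Proof.
move=> gl g01.
have ng x : `|g x| <= 1 by have /andP[? ?] := g01 x; rewrite ger0_norm.
have ig := bounded_integrable gl ng.
have iS := bounded_integrable (lipS gl) (fun x => step_op_norm_le x gl ng).
suff H n : `|\int[pi]_x S g x - \int[pi]_x (g x)| * n.+1%:R <= 1.
  apply/eqP; rewrite -subr_eq0 -normr_eq0 eq_le normr_ge0 andbT leNgt; apply/negP.
  set D := `|_| => D0; have Di : 0 <= D^-1 by rewrite invr_ge0 ltW.
  have := H (Num.bound D^-1); rewrite -/D; apply/negP; rewrite -ltNge.
  rewrite -ltr_pdivrMl// mulr1; apply: lt_trans (archi_boundP Di) _.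
  by rewrite ltr_nat.
pose g' y := n.+1%:R * g y + 0.
have gl' := lip_affine n.+1%:R 0 gl; rewrite -/g' in gl'.
have g'E x : g' x = n.+1%:R * g x by rewrite /g' addr0.
have ig' : integrableR pi (g' : borel_rV R d -> R).
  by apply: integrableDR; [exact: integrableZR|exact: integrable_cstR].
have Sg'E x : S g' x = n.+1%:R * S g x by rewrite (step_op_affine _ _ _ gl) addr0.
pose F j x : R := \int[P]_w (j.+1%:R < g' (X x w))%R%:R.
pose G j x : R := (j.+1%:R < g' x)%R%:R.
have iF (j : 'I_n) : integrableR pi (F j : borel_rV R d -> R).
  by have [] := invariance_exceed j.+1%:R gl'.
have iG (j : 'I_n) : integrableR pi (G j : borel_rV R d -> R).
  rewrite (_ : G j = \1_[set x : borel_rV R d | (j.+1%:R < g' x)%R]).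
    exact: integrable_indic (exceed_set _ gl').
  by apply/funext => x; rewrite indicE mem_setE.
have FG : \int[pi]_x (\sum_(j < n) F j x) = \int[pi]_x (\sum_(j < n) G j x).
  rewrite !Rintegral_sumR//; apply: eq_bigr => j _.
  by have [] := invariance_exceed j.+1%:R gl'.
have g'b x : 0 <= g' x <= n.+1%:R.
  have /andP[? ?] := g01 x; rewrite g'E mulr_ge0//=.
  by rewrite ler_piMr.
have cF x : S g' x - 1 <= \sum_(j < n) F j x <= S g' x.
  have mind (j : 'I_n) : integrableR P (fun w => (j.+1%:R < g' (X x w))%R%:R : R).
    apply: dominated_integrable (integrable_cstR P 1) _ => //.
      by have [] := exceed_indic j.+1%:R gl' (mX x).
    by move=> w; rewrite ger0_norm//; case: (_ < _)%R.
  have ig'X := lip_integrable gl' (mX x) (X2 x).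
  have -> : \sum_(j < n) F j x = \int[P]_w (\sum_(j < n) ((j.+1%:R < g' (X x w))%R%:R : R)).
    by rewrite Rintegral_sumR.
  have isum := integrable_sumR (index_enum _) mind.
  rewrite -{1}(Rintegral_cstR P 1) /step_op -RintegralB//; last exact: integrable_cstR.
  apply/andP; split; apply: le_Rintegral => //.
  - by apply: integrableBR => //; exact: integrable_cstR.
  - by move=> w _; have /andP[] := count_thresholds (g'b (X x w)).
  - by move=> w _; have /andP[] := count_thresholds (g'b (X x w)).
have cG x : g' x - 1 <= \sum_(j < n) G j x <= g' x by exact: count_thresholds.
have key (u s : borel_rV R d -> R) : integrableR pi u ->
    integrableR pi s -> (forall x, n.+1%:R * u x - 1 <= s x <= n.+1%:R * u x) ->
    n.+1%:R * \int[pi]_x u x - 1 <= \int[pi]_x s x <= n.+1%:R * \int[pi]_x u x.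
  move=> iu ii us.
  have -> : n.+1%:R * \int[pi]_x u x - 1 = \int[pi]_x (n.+1%:R * u x - 1).
    rewrite RintegralB//; [|exact: integrableZR|exact: integrable_cstR].
    by rewrite RintegralZl// Rintegral_cstR.
  rewrite -RintegralZl//.
  apply/andP; split; apply: le_Rintegral => //.
  - by apply: integrableBR; [exact: integrableZR|exact: integrable_cstR].
  - by move=> x _; have /andP[] := us x.
  - exact: integrableZR.
  - by move=> x _; have /andP[] := us x.
have isF := integrable_sumR (index_enum _) iF.
have isG := integrable_sumR (index_enum _) iG.
have /andP[k1 k2] : n.+1%:R * \int[pi]_x S g x - 1 <= \int[pi]_x (\sum_(j < n) F j x) <=
    n.+1%:R * \int[pi]_x S g x by apply: key => // x; rewrite -Sg'E.
have /andP[k3 k4] : n.+1%:R * \int[pi]_x g x - 1 <= \int[pi]_x (\sum_(j < n) G j x) <=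
    n.+1%:R * \int[pi]_x g x by apply: key => // x; rewrite -g'E.
rewrite FG in k1 k2.
rewrite -(ger0_norm (ler0n R n.+1)) -normrM mulrC mulrBr ler_norml.
by apply/andP; split; lra.
Qed.

Lemma invariance_bounded l g M : lip l g -> (forall x, `|g x| <= M) ->
  \int[pi]_x S g x = \int[pi]_x (g x).
Proof.
move=> gl gM; have M0 : 0 <= M := le_trans (normr_ge0 _) (gM 0).
(* An affine map that sends [[-M, M]] into [[0, 1]]; with [M + 1] the scaling makes sense also for
   [M = 0]. *)
pose k := (2 * (M + 1))^-1; pose g' y := k * g y + 2^-1.
have k0 : 0 < k by rewrite invr_gt0; lra.
have ig := bounded_integrable gl gM.
have iS := bounded_integrable (lipS gl) (fun x => step_op_norm_le x gl gM).
have := @invariance_unit _ g' (lip_affine k 2^-1 gl) _.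
have -> : S g' = fun x => k * S g x + 2^-1 by apply/funext => x; exact: step_op_affine gl.
rewrite !RintegralD//; try exact: integrable_cstR; try exact: integrableZR.
rewrite !RintegralZl// => H; apply: (mulfI (lt0r_neq0 k0)).
apply: (addIr (\int[pi]_(x in setT) 2^-1)); apply: H => x.
have := gM x; rewrite ler_norml => /andP[g1 g2].
have e : k * (2 * (M + 1)) = 1 by rewrite mulVf// gt_eqF//; lra.
by rewrite /g'; apply/andP; split; nra.
Qed.

Lemma invariance_bounded_iter l g M k : lip l g -> (forall x, `|g x| <= M) ->
  \int[pi]_x iter k S g x = \int[pi]_x (g x).
Proof.
move=> gl gM.
suff [l' [lk bk ek]] : exists l', [/\ lip l' (iter k S g), forall x, `|iter k S g x| <= M &
    \int[pi]_x iter k S g x = \int[pi]_x (g x)] by [].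
elim: k => [|k [l' [lk bk ek]]]; first by exists l.
exists (c * l'); split; first exact: lipS.
  by move=> x; exact: step_op_norm_le lk bk.
by rewrite iterS (invariance_bounded lk bk).
Qed.


Variables (q m : R).
Hypotheses (q0 : 0 <= q) (q1 : q < 1) (m0 : 0 <= m).
Hypothesis Xq : forall x, \int[P]_w enorm (X x w) ^+ 2 <= q * enorm x ^+ 2 + m.

(** The fixed point of the recursion [r -> q * r + m] for second moments. *)
Let C := m / (1 - q).

Let C0 : 0 <= C.
Proof. by rewrite divr_ge0// subr_ge0 ltW. Qed.

(** The squared norm is not Lipschitz, so the recursion is run on Lipschitz functions below it, for
    which iterates of [S] are under control. *)
Lemma iter_step_op_sqr_le l g k x : lip l g -> (forall y, g y <= enorm y ^+ 2) ->
  iter k S g x <= q ^+ k * enorm x ^+ 2 + C.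
Proof.
move=> gl g2; suff H : iter k S g x <= q ^+ k * enorm x ^+ 2 + C * (1 - q ^+ k).
  apply: le_trans H _; rewrite lerD2l ler_piMr//.
  by rewrite gerBl exprn_ge0.
elim: k x => [|k IH] x; first by rewrite /= expr0 mul1r subrr mulr0 addr0.
have lk := lip_iter_step_op k c0 mX X2 Xc gl.
have i2 := integrableZR (q ^+ k) (X2 x).
have ic := integrable_cstR P (C * (1 - q ^+ k)).
rewrite iterS /step_op.
apply: le_trans (le_Rintegral measurableT (lip_integrable lk (mX x) (X2 x))
  (integrableDR i2 ic) _) _; first by move=> w _; exact: IH.
rewrite RintegralD// RintegralZl// Rintegral_cstR.
apply: le_trans (lerD (ler_wpM2l (exprn_ge0 k q0) (Xq x)) (lexx _)) _.
have -> : m = C * (1 - q) by rewrite /C divfK// subr_eq0 gt_eqF.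
by apply: eqW; rewrite (exprS q k); ring.
Qed.

Let u (n : nat) (x : 'rV[R]_d) := clamp n%:R (enorm x) ^+ 2.

Let u_le n x : u n x <= enorm x ^+ 2.
Proof.
have [_ h] := @clamp_norm_le R n%:R (enorm x) (ler0n R n).
rewrite /u -(real_normK (num_real (clamp _ _))) ler_pXn2r ?nnegrE ?enorm_ge0//.
by rewrite (le_trans h)// ger0_norm// enorm_ge0.
Qed.

Let u_bnd n x : `|u n x| <= n%:R ^+ 2.
Proof.
have [h _] := @clamp_norm_le R n%:R (enorm x) (ler0n R n).
by rewrite /u normrX ler_pXn2r ?nnegrE.
Qed.

Let u_lip n : lip (2 * n%:R * (1 * 1)) (u n).
Proof.
have cn := lip_comp ler01 (clamp_lipschitz n%:R) (@lip_enorm R d).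
split; first by rewrite !mulr1 mulr_ge0.
move=> x y; rewrite /u subr_sqr normrM mulrC -mulrA.
have [h1 _] := @clamp_norm_le R n%:R (enorm x) (ler0n R n).
have [h2 _] := @clamp_norm_le R n%:R (enorm y) (ler0n R n).
have := proj2 cn x y; rewrite /= => cn2; apply: ler_pM => //.
by apply: le_trans (ler_normD _ _) _; lra.
Qed.

(* pi(u) = pi(P^k u) for the truncation [u] of |x|^2; let [k] go to infinity. *)
Let u_moment n : \int[pi]_x u n x <= C.
Proof.
pose v k (x : borel_rV R d) : R := Num.min (n%:R ^+ 2) (q ^+ k * enorm x ^+ 2 + C).
have mv k : measurable_fun setT (v k).
  apply: measurable_minr => //; apply: measurable_funD => //.
  apply: measurable_funM => //; apply: measurable_funX.
  exact: lip_borel (@lip_enorm R d).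
have v_bnd k x : `|v k x| <= n%:R ^+ 2.
  rewrite ger0_norm ?ge_min ?lexx// le_min sqr_ge0/=.
  by rewrite addr_ge0// mulr_ge0 ?exprn_ge0 ?enorm_ge0.
have H k : \int[pi]_x u n x <= \int[pi]_x v k x.
  rewrite -(invariance_bounded_iter k (u_lip n) (u_bnd n)).
  have lk := lip_iter_step_op k c0 mX X2 Xc (u_lip n).
  have bk x : `|iter k S (u n) x| <= n%:R ^+ 2.
    elim: k {lk} x => [|k IH] x; first exact: u_bnd.
    by rewrite iterS (step_op_norm_le x (lip_iter_step_op k c0 mX X2 Xc (u_lip n)) IH).
  apply: le_Rintegral => //.
  - exact: bounded_integrable lk bk.
  - exact: dominated_integrable (mv k) (integrable_cstR pi (n%:R ^+ 2)) (v_bnd k).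
  - move=> x _; rewrite le_min (le_trans (ler_norm _) (bk x))/=.
    exact: iter_step_op_sqr_le (u_lip n) (u_le n).
have L : \int[pi]_x v k x @[k --> \oo] --> \int[pi]_x (Num.min (n%:R ^+ 2) C : R).
  apply: Rintegral_dominated_cvg (integrable_cstR pi (n%:R ^+ 2)) _ => //.
  move=> x; have qk : q ^+ k @[k --> \oo] --> (0 : R) by apply: cvg_expr; rewrite ger0_norm.
  have L : q ^+ k * enorm x ^+ 2 + C @[k --> \oo] --> 0 * enorm x ^+ 2 + C.
    by apply: cvgD; [apply: cvgMr_tmp|exact: cvg_cst].
  rewrite mul0r add0r in L.
  have cm : {for C, continuous (fun r : R^o => Num.min (n%:R ^+ 2) r)}.
    by apply: continuous_min; [exact: cvg_cst|exact: cvg_id].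
  exact: (@continuous_cvg _ _ _ _ _ _ _ _ cm L).
rewrite Rintegral_cstR in L; apply: le_trans (cvgr_to_ge L (nearW _ H)) _.
by rewrite ge_min lexx orbT.
Qed.

(** The bound [u_moment] is uniform in the truncation level and passes to the limit by monotone
    convergence. *)
Lemma invariant_second_moment :
  integrableR pi (fun x : borel_rV R d => enorm x ^+ 2) /\
  \int[pi]_x (enorm x ^+ 2) <= C.
Proof.
have me : measurable_fun setT (fun x : borel_rV R d => enorm x ^+ 2).
  by apply: measurable_funX; exact: lip_borel (@lip_enorm R d).
suff H : (\int[pi]_x (enorm x ^+ 2)%:E <= C%:E)%E.
  exact: ge0_bounded_integrable me (fun x => sqr_ge0 (enorm x)) H.
have := @cvg_monotone_convergence _ _ _ pi setT measurableT (fun n x => (u n x)%:E).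
have -> : (fun x => limn (fun n => (u n x)%:E)) = (fun x => (enorm x ^+ 2)%:E).
  apply/funext => x; apply/cvg_lim => //; apply: cvg_near_cst; near=> n.
  rewrite /u clamp_id// ger0_norm ?enorm_ge0//; near: n; exact: nbhs_infty_ger.
move=> L; apply: cvge_to_le (L _ _ _) _.
- by move=> n; apply/measurable_EFinP; exact: lip_borel (u_lip n).
- by move=> n x _; rewrite lee_fin sqr_ge0.
- move=> x _ a b ab; rewrite lee_fin /u.
  have E k : clamp k%:R (enorm x) = Num.min (enorm x) k%:R.
    by rewrite /clamp max_l// (le_trans _ (enorm_ge0 x))// oppr_le0.
  have E0 k : 0 <= Num.min (enorm x) k%:R by rewrite le_min enorm_ge0 ler0n.
  rewrite !E ler_pXn2r ?nnegrE// le_min ge_min lexx/= ge_min.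
  by rewrite ler_nat ab orbT.
- apply: nearW => n; rewrite -EFin_Rintegral//; last exact: bounded_integrable (u_lip n) (u_bnd n).
  by rewrite lee_fin; exact: u_moment.
Unshelve. all: by end_near. Qed.

Lemma lip_integrable_invariant l g : lip l g ->
  integrableR pi (g : borel_rV R d -> R).
Proof.
have [i2 _] := invariant_second_moment => gl.
apply: dominated_integrable (fun x : borel_rV R d => lip_growth x gl); first exact: lip_borel gl.
exact: integrable_affineR.
Qed.

(** Truncation by [clamp] and dominated convergence on both sides; the second moment of [pi] makes
    the dominating functions integrable. *)
Lemma invariance_lip l g : lip l g -> \int[pi]_x S g x = \int[pi]_x (g x).
Proof.
move=> gl; pose gn (n : nat) := clamp n%:R \o g.
have [i2 _] := invariant_second_moment.
have gnl n : lip (1 * l) (gn n) by exact: lip_comp ler01 (clamp_lipschitz n%:R) gl.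
have gnb n x : `|gn n x| <= n%:R /\ `|gn n x| <= `|g x|.
  exact: (@clamp_norm_le R n%:R (g x) (ler0n R n)).
have ig := lip_integrable_invariant gl.
have mX2 x := lip_integrable gl (mX x) (X2 x).
have L1 : \int[pi]_x gn n x @[n --> \oo] --> \int[pi]_x (g x).
  apply: Rintegral_dominated_cvg (integrable_normR ig) _.
  - by move=> n; exact: lip_borel (gnl n).
  - exact: lip_borel gl.
  - by move=> x; exact: cvg_clamp.
  - by move=> n x; have [] := gnb n x.
have L2 : \int[pi]_x S (gn n) x @[n --> \oo] --> \int[pi]_x S g x.
  have ib : integrableR pi (fun x : borel_rV R d =>
      (`|g 0| + l) + l * (q * enorm x ^+ 2 + m)).
    apply: integrableDR; first exact: integrable_cstR.
    by apply: integrableZR; apply: integrableDR; [exact: integrableZR|exact: integrable_cstR].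
  apply: Rintegral_dominated_cvg ib _.
  - by move=> n; exact: lip_borel (lipS (gnl n)).
  - exact: lip_borel (lipS gl).
  - move=> x; apply: Rintegral_dominated_cvg (integrable_normR (mX2 x)) _.
    + by move=> n; exact: lip_measurable (gnl n) (mX x).
    + exact: lip_measurable gl (mX x).
    + by move=> w; exact: cvg_clamp.
    + by move=> n w; have [] := gnb n (X x w).
  - move=> n x; have ign := lip_integrable (gnl n) (mX x) (X2 x).
    have [l0 _] := gl.
    have i3 : integrableR P (fun w => (`|g 0| + l) + l * enorm (X x w) ^+ 2).
      exact: integrable_affineR.
    apply: le_trans (le_normr_Rintegral measurableT ign) _.
    apply: (@le_trans _ _ (\int[P]_w ((`|g 0| + l) + l * enorm (X x w) ^+ 2))).
      apply: le_Rintegral => //; first exact: integrable_normR.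
      move=> w _; have [_ h] := gnb n (X x w); apply: le_trans h _.
      exact: lip_growth.
    by rewrite Rintegral_affineR// lerD2l ler_wpM2l.
have E : (fun n => \int[pi]_x S (gn n) x) = (fun n => \int[pi]_x gn n x).
  by apply/funext => n; apply: (@invariance_bounded _ _ n%:R (gnl n)) => x; have [] := gnb n x.
rewrite E in L2; exact: cvg_unique L2 L1.
Qed.

Lemma invariance_lip_iter l g k : lip l g ->
  \int[pi]_x iter k S g x = \int[pi]_x (g x).
Proof.
move=> gl; elim: k => // k IH; rewrite iterS -IH.
exact: invariance_lip (lip_iter_step_op k c0 mX X2 Xc gl).
Qed.

End invariance.

(** * The bias of the scheme, by duality *)

Section stationary_bias.
Context {R : realType} {d : nat} {disp : measure_display} {T : measurableType disp}.
Variables (P : probability T R) (pi : probability (borel_rV R d) R).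
Variables (X Y : 'rV[R]_d -> T -> 'rV[R]_d) (cX cY q e kappa q2 m : R).
Hypotheses (cX0 : 0 <= cX) (cY0 : 0 <= cY) (q0 : 0 <= q) (q1 : q < 1) (e0 : 0 <= e)
  (kappa0 : 0 <= kappa) (q20 : 0 <= q2) (q21 : q2 < 1) (m0 : 0 <= m).
Hypotheses (mX : forall x, random_vector (X x)) (mY : forall y, random_vector (Y y)).
Hypothesis X2 : forall x, integrableR P (fun w => enorm (X x w) ^+ 2).
Hypothesis Y2 : forall y, integrableR P (fun w => enorm (Y y w) ^+ 2).
Hypothesis Xlip :
  forall x y, {ae P, forall w, enorm (X x w - X y w) <= cX * enorm (x - y)}.
Hypothesis Ylip :
  forall x y, {ae P, forall w, enorm (Y x w - Y y w) <= cY * enorm (x - y)}.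
Let V (x y : 'rV[R]_d) := enorm (x - y) ^+ 2 + kappa * enorm x ^+ 2.
Hypothesis V1 : forall x y,
  integrableR P (fun w => V (X x w) (Y y w)).
Hypothesis VE : forall x y, \int[P]_w V (X x w) (Y y w) <= q * V x y + e.
Hypothesis Xq : forall x, \int[P]_w enorm (X x w) ^+ 2 <= q2 * enorm x ^+ 2 + m.
Hypothesis inv : forall B : set (borel_rV R d), measurable B ->
  (\int[pi]_x P (X x @^-1` B))%E = pi B.

(* Kantorovich duality in place of a coupling of the two chains: the inequality
   [phi x - psi y <= alpha V x y + b] is propagated by the two transition
   operators applied with the same noise. *)
Lemma duality_step (phi psi : 'rV[R]_d -> R) lX lY alpha b : 0 <= alpha ->
  lip lX phi -> lip lY psi ->
  (forall x y, phi x - psi y <= alpha * V x y + b) ->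
  forall x y, step_op P X phi x - step_op P Y psi y <= alpha * (q * V x y + e) + b.
Proof.
move=> al0 lphi lpsi H x y; rewrite /step_op.
have i1 := lip_integrable lphi (mX x) (X2 x).
have i2 := lip_integrable lpsi (mY y) (Y2 y).
rewrite -RintegralB//.
have i3 : integrableR P (fun w => alpha * V (X x w) (Y y w) + b).
  by apply: integrableDR; [exact: integrableZR|exact: integrable_cstR].
apply: le_trans (le_Rintegral measurableT (integrableBR i1 i2) i3 _) _.
  by move=> w _; exact: H.
rewrite RintegralD//; [|exact: integrableZR|exact: integrable_cstR].
by rewrite RintegralZl// Rintegral_cstR lerD2r ler_wpM2l.
Qed.

Lemma duality_iter (f : 'rV[R]_d -> R) l delta k x y : 0 < delta -> lip l f ->
  iter k (step_op P X) f x - iter k (step_op P Y) f y <=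
  l ^+ 2 / delta * (q ^+ k * V x y + e / (1 - q)) + delta.
Proof.
move=> dl0 lf; have l0 : 0 <= l by case: lf.
set alpha := l ^+ 2 / delta.
have al0 : 0 <= alpha by rewrite divr_ge0 ?sqr_ge0// ltW.
have q10 : 0 < 1 - q by rewrite subr_gt0.
(* The induction needs the exact geometric sum [(1 - q ^+ k) / (1 - q)]; it is bounded by
   [(1 - q)^-1] only at the end. *)
suff : forall x y, iter k (step_op P X) f x - iter k (step_op P Y) f y <=
    (alpha * q ^+ k) * V x y + (alpha * (e * (1 - q ^+ k) / (1 - q)) + delta).
  move=> /(_ x y) H; apply: le_trans H _; have -> : alpha * (q ^+ k * V x y + e / (1 - q)) =
    alpha * q ^+ k * V x y + alpha * (e / (1 - q)) by ring.
  rewrite addrA lerD2r lerD2l ler_wpM2l// ler_wpM2r ?invr_ge0 ?(ltW q10)// ler_piMr//.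
  by rewrite gerBl exprn_ge0.
elim: k => [x' y'|k IH x' y'].
  rewrite /= expr0 mulr1 subrr mulr0 mul0r mulr0 add0r.
  have [_ fl] := lf; have := le_trans (ler_norm _) (fl x' y').
  have yg := @young_sqr _ delta 1 (l * enorm (x' - y')) dl0.
  have -> : alpha * V x' y' = (l * enorm (x' - y')) ^+ 2 / delta + alpha * kappa * enorm x' ^+ 2.
    by rewrite /alpha /V; field; rewrite gt_eqF.
  have : 0 <= alpha * kappa * enorm x' ^+ 2 by rewrite mulr_ge0 ?sqr_ge0// mulr_ge0.
  have : 0 <= (l * enorm (x' - y')) ^+ 2 / delta by rewrite divr_ge0 ?sqr_ge0// ltW.
  move: yg; rewrite expr1n mulr1; set z := l * enorm _; set zz := z ^+ 2 / delta => yg z0 k0 fz.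
  lra.
rewrite !iterS.
apply: le_trans (duality_step _ _ _ IH x' y') _.
- by rewrite mulr_ge0 ?exprn_ge0.
- exact: (lip_iter_step_op k cX0 mX X2 Xlip lf).
- exact: (lip_iter_step_op k cY0 mY Y2 Ylip lf).
rewrite exprS; apply: eqW; field.
by rewrite gt_eqF.
Qed.

Lemma lip_opp (l : R) (g : 'rV[R]_d -> R) : lip l g -> lip l (fun y => - g y).
Proof. by move=> [l0 gl]; split=> // u v; rewrite -opprD normrN. Qed.

(** The duality inequality is one-sided; applied to [- f] it gives the other side. *)
Lemma iter_step_op_opp (l : R) (g : 'rV[R]_d -> R) k y : lip l g ->
  iter k (step_op P Y) (fun y => - g y) y = - iter k (step_op P Y) g y.
Proof.
move=> gl; elim: k y => // k IH y; rewrite !iterS {1}/step_op.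
under eq_Rintegral do rewrite IH -mulN1r.
have lk := lip_iter_step_op k cY0 mY Y2 Ylip gl.
rewrite RintegralZl//; last exact: lip_integrable lk (mY y) (Y2 y).
by rewrite mulN1r.
Qed.

Let bound (l delta : R) (k : nat) (y : 'rV[R]_d) : R :=
  l ^+ 2 / delta * (q ^+ k * ((2 + kappa) * (m / (1 - q2)) + 2 * enorm y ^+ 2)
    + e / (1 - q)) + delta.

(** By invariance [pi(f)] is the integral of the [k]-th iterate of [f], so the duality inequality
    can be integrated in [x] against [pi] with [y] fixed. The distance is split by [enorm (x - y) ^+
    2 <= 2 * enorm x ^+ 2 + 2 * enorm y ^+ 2]. *)
Let upper_bias (f : 'rV[R]_d -> R) l delta k y : 0 < delta -> lip l f ->
  \int[pi]_x f x - iter k (step_op P Y) f y <= bound l delta k y.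
Proof.
move=> dl0 fl; set al := l ^+ 2 / delta.
have al0 : 0 <= al by rewrite divr_ge0 ?sqr_ge0// ltW.
have lk := lip_iter_step_op k cX0 mX X2 Xlip fl.
rewrite -(invariance_lip_iter cX0 mX X2 Xlip inv q20 q21 m0 Xq k fl).
have ik := lip_integrable_invariant cX0 mX X2 Xlip inv q20 q21 m0 Xq lk.
have [ix2 x2] := invariant_second_moment cX0 mX X2 Xlip inv q20 q21 m0 Xq.
set b := iter k (step_op P Y) f y.
pose c1 := al * (q ^+ k * (2 * enorm y ^+ 2) + e / (1 - q)) + delta + b.
pose c2 := al * (q ^+ k * (2 + kappa)).
have c20 : 0 <= c2 by rewrite mulr_ge0// mulr_ge0 ?exprn_ge0 ?addr_ge0.
have ib : integrableR pi (fun x : borel_rV R d => c1 + c2 * enorm x ^+ 2).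
  exact: integrable_affineR.
have H : \int[pi]_x iter k (step_op P X) f x <= \int[pi]_x (c1 + c2 * enorm x ^+ 2).
  apply: le_Rintegral => // x _.
  have D := duality_iter k x y dl0 fl.
  have Vxy : al * (q ^+ k * (enorm (x - y) ^+ 2 + kappa * enorm x ^+ 2)) <=
      al * (q ^+ k * (2 * enorm x ^+ 2 + 2 * enorm y ^+ 2 + kappa * enorm x ^+ 2)).
    rewrite ler_wpM2l// ler_wpM2l ?exprn_ge0// lerD2r.
    by have := sqr_enormD_le x (- y); rewrite enormN.
  by move: D Vxy; rewrite /V -/al -/b /c1 /c2; lra.
rewrite Rintegral_affineR// in H.
have := ler_wpM2l c20 x2; rewrite /bound -/al.
by move: H; rewrite /c1 /c2; lra.
Qed.

Lemma stationary_bias (f : 'rV[R]_d -> R) l delta k (Z : T -> 'rV[R]_d) M :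
  0 < delta -> lip l f -> random_vector Z ->
  integrableR P (fun w => enorm (Z w) ^+ 2) ->
  \int[P]_w enorm (Z w) ^+ 2 <= M ->
  `|\int[pi]_x f x - \int[P]_w iter k (step_op P Y) f (Z w)| <=
  l ^+ 2 / delta * (q ^+ k * ((2 + kappa) * (m / (1 - q2)) + 2 * M)
    + e / (1 - q)) + delta.
Proof.
move=> dl0 fl mZ Z2 ZM; set al := l ^+ 2 / delta.
have al0 : 0 <= al by rewrite divr_ge0 ?sqr_ge0// ltW.
have lk := lip_iter_step_op k cY0 mY Y2 Ylip fl.
have iZ := lip_integrable lk mZ Z2.
have pw y : `|\int[pi]_x f x - iter k (step_op P Y) f y| <= bound l delta k y.
  rewrite ler_norml lerNl; apply/andP; split; last exact: upper_bias.
  have := upper_bias k y dl0 (lip_opp fl).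
  rewrite (iter_step_op_opp _ _ fl).
  have -> : \int[pi]_x - f x = - \int[pi]_x f x.
    under eq_Rintegral do rewrite -mulN1r.
    have ig := lip_integrable_invariant cX0 mX X2 Xlip inv q20 q21 m0 Xq fl.
    by rewrite RintegralZl// mulN1r.
  by rewrite opprB opprK addrC.
pose c1 := al * (q ^+ k * ((2 + kappa) * (m / (1 - q2))) + e / (1 - q)) + delta.
pose c2 := al * (q ^+ k * 2).
have c20 : 0 <= c2 by rewrite mulr_ge0// mulr_ge0 ?exprn_ge0.
have -> : \int[pi]_x f x - \int[P]_w iter k (step_op P Y) f (Z w) =
    \int[P]_w (\int[pi]_x f x - iter k (step_op P Y) f (Z w)).
  by rewrite RintegralB// ?Rintegral_cstR//; exact: integrable_cstR.
have iD : integrableR P (fun w => \int[pi]_x f x - iter k (step_op P Y) f (Z w)).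
  by apply: integrableBR => //; exact: integrable_cstR.
apply: le_trans (le_normr_Rintegral measurableT iD) _.
have ib : integrableR P (fun w => c1 + c2 * enorm (Z w) ^+ 2).
  exact: integrable_affineR.
apply: le_trans (le_Rintegral measurableT (integrable_normR iD) ib _) _.
  move=> w _; apply: le_trans (pw (Z w)) _.
  by apply: eqW; rewrite /bound -/al /c1 /c2; ring.
rewrite Rintegral_affineR//; apply: le_trans (lerD (lexx _) (ler_wpM2l c20 ZM)) _.
by apply: eqW; rewrite /c1 /c2; ring.
Qed.

End stationary_bias.

(** * Independence of the noises and of the particles *)

Section independence.
Context {R : realType} {disp : measure_display} {T : measurableType disp}.
Variable P : probability T R.

(** For fixed [A], both sides are finite measures in [E] that agree on the pi-system [C] and on the
    whole space. *)
Lemma independent_generated_event (C : set_system T) (A : set T) :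
  C `<=` measurable -> setI_closed C -> C setT -> measurable A ->
  (forall E, C E -> P (A `&` E) = (P A * P E)%E) ->
  forall E, <<s C >> E -> P (A `&` E) = (P A * P E)%E.
Proof.
move=> Cm CI CT mA AC E CE.
have PA0 : 0 <= fine (P A) by exact/fine_ge0/measure_ge0.
have PAE : (fine (P A))%:E = P A by rewrite fineK// fin_num_measure.
pose m1 : {measure set T -> \bar R} := mrestr P mA.
pose m2 : {measure set T -> \bar R} := mscale (NngNum PA0) P.
have m1E X : m1 X = P (A `&` X) by rewrite /m1/= /mrestr setIC.
have m2E X : m2 X = (P A * P X)%E by rewrite /m2/= /mscale/= PAE.
rewrite -m1E -m2E.
apply: (@g_sigma_algebra_measure_unique _ R T C Cm (fun=> setT)) => //.
- by rewrite bigcup_const.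
- by move=> X CX /=; rewrite m1E m2E AC.
- by move=> _ /=; rewrite m1E setIT (le_lt_trans (probability_le1 _ mA))// ltry.
Qed.

Lemma independent_generated (C D : set_system T) :
  C `<=` measurable -> D `<=` measurable -> setI_closed C -> setI_closed D ->
  C setT -> D setT -> independent_systems P C D ->
  independent_systems P <<s C >> <<s D >>.
Proof.
move=> Cm Dm CI DI CT DT CD A B sA sB.
have mB : measurable B by exact: (smallest_sub (@sigma_algebra_measurable _ T) Dm).
rewrite setIC muleC; apply: (independent_generated_event Cm CI CT mB) => // E CE.
have mE := Cm _ CE.
rewrite setIC muleC; apply: (independent_generated_event Dm DI DT mE) => // F DF.
exact: CD.
Qed.

Section mutual.
Context {I : eqType}.
Variable G : I -> set_system T.
Hypothesis Gm : forall i, G i `<=` measurable.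
Hypothesis GT : forall i, G i setT.
Hypothesis GI : forall i, setI_closed (G i).

(** A pi-system generating the join of the [G i] for [i] in [S], a set of indices that may be
    infinite. *)
Definition cylinders (S : pred I) : set_system T :=
  [set E | exists s (A : I -> set T), [/\ uniq s, all S s, forall i, G i (A i) &
    E = \bigcap_(i in [set` s]) A i]].

Lemma cylinders_measurable S : cylinders S `<=` measurable.
Proof.
move=> _ [s [A [_ _ GA ->]]]; elim: s => [|i s IH].
  by rewrite (_ : \bigcap_(i in _) _ = setT)//; apply/seteqP; split.
rewrite (_ : \bigcap_(i in _) _ = A i `&` \bigcap_(i in [set` s]) A i).
  by apply: measurableI => //; exact: Gm.
apply/seteqP; split => [w H|w [wi H] j /=].
  by split=> [|j js]; apply: H; rewrite /= inE ?eqxx// [_ \in _]js orbT.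
by rewrite inE => /predU1P[->//|]; exact: H.
Qed.

Lemma cylindersT S : cylinders S setT.
Proof.
exists [::], (fun=> setT); split=> //.
by apply/seteqP; split.
Qed.

Lemma cylindersI S : setI_closed (cylinders S).
Proof.
move=> _ _ [s [A [us Ss GA ->]]] [t [B [ut St GB ->]]].
(* The two lists of indices may overlap, so their union is deduplicated; an index absent from one
   list contributes [setT] there. *)
exists (undup (s ++ t)), (fun i => (if i \in s then A i else setT) `&`
  (if i \in t then B i else setT)); split; first exact: undup_uniq.
- by rewrite all_undup all_cat Ss.
- by move=> i; apply: GI; case: ifP.
apply/seteqP; split => [w [wA wB] i /= _|w H].
  by split; case: ifP => // im; [exact: wA|exact: wB].
split=> i /= im.
  by have := H i; rewrite /= mem_undup mem_cat im => /(_ isT) [].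
by have := H i; rewrite /= mem_undup mem_cat im orbT => /(_ isT) [].
Qed.

Lemma independent_cylinders (S1 S2 : pred I) : (forall i, ~~ (S1 i && S2 i)) ->
  mutually_independent P G ->
  independent_systems P <<s cylinders S1 >> <<s cylinders S2 >>.
Proof.
move=> S12 mi; apply: independent_generated; try exact: cylinders_measurable;
  try exact: cylindersI; try exact: cylindersT.
move=> _ _ [s [A [us Ss GA ->]]] [t [B [ut St GB ->]]].
have st i : i \in s -> i \in t -> False.
  move=> /(allP Ss) i1 /(allP St) i2.
  by have := S12 i; rewrite i1 i2.
pose C i := if i \in s then A i else B i.
have CA : \bigcap_(i in [set` s]) A i = \bigcap_(i in [set` s]) C i.
  by apply: eq_bigcapr => i /= im; rewrite /C im.
have CB : \bigcap_(i in [set` t]) B i = \bigcap_(i in [set` t]) C i.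
  by apply: eq_bigcapr => i /= im; rewrite /C; case: ifP => // /st; case.
have GC i : G i (C i) by rewrite /C; case: ifP.
have ust : uniq (s ++ t).
  rewrite cat_uniq us ut andbT; apply/hasPn => i it; apply/negP => im.
  exact: st im it.
rewrite CA CB (mi s C us)// (mi t C ut)// -big_cat -(mi (s ++ t) C ust)//.
congr (P _); apply/seteqP; split => [w [wA wB] i /=|w H].
  by rewrite mem_cat => /orP[]; [exact: wA|exact: wB].
by split=> i /= im; apply: H; rewrite /= mem_cat im ?orbT.
Qed.

End mutual.

End independence.

(** * Integration of functions of two independent variables *)

Section independent_pair.
Context {R : realType} {disp d1 d2 : measure_display}.
Context {T : measurableType disp} {T1 : measurableType d1} {T2 : measurableType d2}.
Variable P : probability T R.
Variables (U : T -> T1) (Z : T -> T2).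
Hypotheses (mU : measurable_fun setT U) (mZ : measurable_fun setT Z).
Hypothesis UZ : forall A B, measurable A -> measurable B ->
  P (U @^-1` A `&` Z @^-1` B) = (P (U @^-1` A) * P (Z @^-1` B))%E.

(** Independence identifies the law of the pair with the product of the laws, as rectangles
    determine it; Tonelli does the rest. *)
Lemma ge0_independent_pair (G : T1 * T2 -> \bar R) : measurable_fun setT G ->
  (forall p, 0 <= G p)%E ->
  (\int[P]_w G (U w, Z w) = \int[P]_w \int[P]_w' G (U w, Z w'))%E.
Proof.
move=> mG G0.
pose U' : {mfun T >-> T1} := HB.pack U (isMeasurableFun.Build _ _ _ _ U mU).
pose Z' : {mfun T >-> T2} := HB.pack Z (isMeasurableFun.Build _ _ _ _ Z mZ).
pose mu : probability T1 R := distribution P U'.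
pose nu : probability T2 R := distribution P Z'.
have mUZ : measurable_fun setT (fun w => (U w, Z w)) by exact: measurable_fun_pair.
pose rho := measure_function_pushforward__canonical__measure_function_Measure P mUZ.
have rhoE := @product_measure_unique _ _ _ _ R mu nu rho (fun A B mA mB => UZ mA mB).
have F := @fubini_tonelli1 _ _ _ _ _ mu nu G mG G0.
transitivity (\int[rho]_p G p)%E.
  by rewrite (ge0_integral_pushforward mUZ).
rewrite -(eq_measure_integral _ (fun A mA _ => rhoE A mA)) F.
rewrite /mu (ge0_integral_distribution (P := P) U')//.
- apply: eq_integral => w _; rewrite /= /fubini_F /nu (ge0_integral_distribution (P := P) Z')//.
  exact: measurable_fun_pair2.
- exact: measurable_fun_fubini_tonelli_F.
- by move=> x; apply: integral_ge0.
Qed.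

Lemma measurable_section_Rintegral (G : T1 * T2 -> R) : measurable_fun setT G ->
  (forall p, 0 <= G p) ->
  measurable_fun setT (fun w => \int[P]_w' G (U w, Z w')).
Proof.
move=> mG G0; have mG' : measurable_fun setT (EFin \o G) by exact/measurable_EFinP.
pose Z' : {mfun T >-> T2} := HB.pack Z (isMeasurableFun.Build _ _ _ _ Z mZ).
have := @measurable_fun_fubini_tonelli_F _ _ _ _ _ (distribution P Z') (EFin \o G) mG'
  (fun p => G0 p).
move=> mF; have := measurableT_comp (@fine_measurable R setT measurableT) (measurableT_comp mF mU).
apply: eq_measurable_fun => w _ /=; rewrite /fubini_F.
rewrite (ge0_integral_distribution (P := P) Z')//.
- exact: measurable_fun_pair2.
- by move=> y; rewrite lee_fin.
Qed.

Lemma independent_pair_Rintegral (G : T1 * T2 -> R) : measurable_fun setT G ->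
  (forall p, 0 <= G p) ->
  (forall w, integrableR P (fun w' => G (U w, Z w'))) ->
  integrableR P (fun w => \int[P]_w' G (U w, Z w')) ->
  integrableR P (fun w => G (U w, Z w)) /\
  \int[P]_w G (U w, Z w) = \int[P]_w \int[P]_w' G (U w, Z w').
Proof.
move=> mG G0 i1 i2.
have mGUZ : measurable_fun setT (fun w => G (U w, Z w)).
  exact: (measurableT_comp mG (measurable_fun_pair mU mZ)).
have E : (\int[P]_w (G (U w, Z w))%:E = \int[P]_w (\int[P]_w' G (U w, Z w'))%:E)%E.
  rewrite (ge0_independent_pair (G := EFin \o G)); [|exact/measurable_EFinP|by move=> p; rewrite lee_fin].
  by apply: eq_integral => w _ /=; rewrite EFin_Rintegral.
have le : (\int[P]_w (G (U w, Z w))%:E <= (\int[P]_w \int[P]_w' G (U w, Z w'))%:E)%E.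
  by rewrite E EFin_Rintegral.
have [i3 _] := ge0_bounded_integrable mGUZ (fun w => G0 (U w, Z w)) le.
by split=> //; apply: EFin_inj; rewrite !EFin_Rintegral.
Qed.

(* Tonelli for the nonnegative function (f + g)^2, instead of Fubini for f g. *)
Lemma independent_pair_mul (f : T1 -> R) (g : T2 -> R) :
  measurable_fun setT f -> measurable_fun setT g ->
  integrableR P (fun w => f (U w) ^+ 2) ->
  integrableR P (fun w => g (Z w) ^+ 2) ->
  integrableR P (fun w => f (U w) * g (Z w)) /\
  \int[P]_w (f (U w) * g (Z w)) = (\int[P]_w f (U w)) * \int[P]_w g (Z w).
Proof.
move=> mf mg f2 g2.
have f1 := sqr_integrable (measurableT_comp mf mU) f2.
have g1 := sqr_integrable (measurableT_comp mg mZ) g2.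
pose G (p : T1 * T2) := (f p.1 + g p.2) ^+ 2.
have mG : measurable_fun setT G.
  apply: measurable_funX; apply: measurable_funD.
    exact: (measurableT_comp mf measurable_fst).
  exact: (measurableT_comp mg measurable_snd).
have GE w w' : G (U w, Z w') = f (U w) ^+ 2 + 2 * f (U w) * g (Z w') + g (Z w') ^+ 2.
  by rewrite /G/=; ring.
have iG w : integrableR P (fun w' => f (U w) ^+ 2 + 2 * f (U w) * g (Z w')).
  exact: integrable_affineR.
have IG w : \int[P]_w' G (U w, Z w') = f (U w) ^+ 2 + 2 * f (U w) * \int[P]_w' g (Z w')
    + \int[P]_w' (g (Z w') ^+ 2).
  under eq_Rintegral do rewrite GE.
  by rewrite RintegralD// ?Rintegral_affineR//; exact: integrable_affineR.
have iG' w : integrableR P (fun w' => G (U w, Z w')).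
  rewrite (_ : (fun w' => _) = (fun w' => f (U w) ^+ 2 + 2 * f (U w) * g (Z w') + g (Z w') ^+ 2)).
    exact: integrableDR.
  by apply/funext => w'.
pose c1 := \int[P]_w' g (Z w'); pose c2 := \int[P]_w' (g (Z w') ^+ 2).
have J1 : integrableR P (fun w => f (U w) ^+ 2 + (2 * c1) * f (U w)).
  by apply: integrableDR => //; exact: integrableZR.
have JE : (fun w => \int[P]_w' G (U w, Z w')) =
    (fun w => f (U w) ^+ 2 + (2 * c1) * f (U w) + c2).
  by apply/funext => w; rewrite IG -/c1 -/c2; ring.
have J : integrableR P (fun w => \int[P]_w' G (U w, Z w')).
  by rewrite JE; apply: integrableDR => //; exact: integrable_cstR.
have [i E] := independent_pair_Rintegral mG (fun p => sqr_ge0 _) iG' J.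
have ME : (fun w => f (U w) * g (Z w)) =
    (fun w => 2^-1 * (G (U w, Z w) - f (U w) ^+ 2 - g (Z w) ^+ 2)).
  by apply/funext => w; rewrite GE; field.
have i' : integrableR P (fun w => G (U w, Z w) - f (U w) ^+ 2).
  exact: integrableBR.
rewrite ME; split; first by apply: integrableZR; exact: integrableBR.
rewrite RintegralZl//; last exact: integrableBR.
rewrite RintegralB// RintegralB// E JE RintegralD//; last exact: integrable_cstR.
rewrite RintegralD//; last exact: integrableZR.
by rewrite RintegralZl// Rintegral_cstR -/c1 -/c2; field.
Qed.

End independent_pair.

Lemma same_law_Rintegral (R : realType) (disp : measure_display) (T : measurableType disp)
  (P : probability T R) (d : nat) (X Y : T -> 'rV[R]_d) (F : borel_rV R d -> R) :
  random_vector X -> random_vector Y -> same_law P X Y ->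
  measurable_fun setT F -> (forall u, 0 <= F u) ->
  (\int[P]_w (F (X w))%:E = \int[P]_w (F (Y w))%:E)%E.
Proof.
move=> mX mY XY mF F0; have mF' : measurable_fun setT (EFin \o F) by exact/measurable_EFinP.
pose X' : {mfun T >-> borel_rV R d} := HB.pack (X : T -> borel_rV R d)
  (isMeasurableFun.Build _ _ _ _ (X : T -> borel_rV R d) mX).
pose Y' : {mfun T >-> borel_rV R d} := HB.pack (Y : T -> borel_rV R d)
  (isMeasurableFun.Build _ _ _ _ (Y : T -> borel_rV R d) mY).
have EX := ge0_integral_distribution (P := P) X' mF' F0.
have EY := ge0_integral_distribution (P := P) Y' mF' F0.
rewrite -[LHS]EX -[RHS]EY; apply: eq_measure_integral => A mA _.
exact: XY.
Qed.

Lemma Rintegral_sqrB (R : realType) (disp : measure_display) (T : measurableType disp)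
  (P : probability T R) (X : T -> R) (b : R) :
  integrableR P X -> integrableR P (fun w => X w ^+ 2) ->
  \int[P]_w ((X w - b) ^+ 2) = \int[P]_w (X w ^+ 2) - 2 * b * \int[P]_w X w + b ^+ 2.
Proof.
move=> iX iX2; have iZ := integrableZR (2 * b) iX.
transitivity (\int[P]_w (X w ^+ 2 - (2 * b) * X w + b ^+ 2)).
  by apply: eq_Rintegral => w _; ring.
rewrite RintegralD//; [|exact: integrableBR|exact: integrable_cstR].
by rewrite RintegralB// RintegralZl// Rintegral_cstR.
Qed.

(** * Mean and variance of the scheme *)

Section lipschitz_squares.
Context {R : realType} {d : nat}.
Implicit Types (g : 'rV[R]_d -> R) (l : R).

Lemma lip_sqr_growth l g u : lip l g ->
  g u ^+ 2 <= 2 * g 0 ^+ 2 + 2 * l ^+ 2 * enorm u ^+ 2.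
Proof.
move=> [l0 gl]; have := gl u 0; rewrite subr0 => gu.
have : (g u - g 0) ^+ 2 <= (l * enorm u) ^+ 2.
  by rewrite -(real_normK (num_real (_ - _))) ler_pXn2r ?nnegrE// mulr_ge0// enorm_ge0.
by have := sqr_ge0 (g u - 2 * g 0); rewrite exprMn; nra.
Qed.

Lemma lip_shift l g c : lip l g -> lip l (fun u => g u + c).
Proof.
move=> [l0 gl]; split=> // u v.
by rewrite (_ : g u + c - (g v + c) = g u - g v)//; ring.
Qed.

Context {disp : measure_display} {T : measurableType disp}.
Variable P : probability T R.

Lemma lip_sqr_integrable l g (Z : T -> 'rV[R]_d) : lip l g -> random_vector Z ->
  integrableR P (fun w => enorm (Z w) ^+ 2) ->
  integrableR P (fun w => g (Z w) ^+ 2).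
Proof.
move=> gl mZ Z2; apply: dominated_integrable (_ : forall w, _ <=
    2 * g 0 ^+ 2 + 2 * l ^+ 2 * enorm (Z w) ^+ 2).
- by apply: measurable_funX; exact: lip_measurable gl mZ.
- exact: integrable_affineR.
- by move=> w; rewrite ger0_norm ?sqr_ge0//; exact: lip_sqr_growth.
Qed.

End lipschitz_squares.

Section chain.
Context {R : realType} {disp : measure_display} {T : measurableType disp} {d : nat}.
Variable P : probability T R.
Variables (a : 'rV[R]_d -> 'rV[R]_d) (L beta h c s : R).
Hypotheses (h0 : 0 < h) (L0 : 0 <= L) (c0 : 0 <= c) (c1 : c < 1).
Hypothesis aL : forall u v, enorm (a u - a v) <= L * enorm (u - v).
Hypothesis ac : forall x y, enorm (x - y + h *: (a x - a y)) <= c * enorm (x - y).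
Variable B : T -> 'rV[R]_d.
Hypothesis mB : random_vector B.
Hypothesis iB2 : integrableR P (fun w => enorm (B w) ^+ 2).
Hypothesis sE : beta ^+ 2 * \int[P]_w enorm (B w) ^+ 2 <= s.
Variables (theta0 : T -> 'rV[R]_d) (Z : nat -> T -> 'rV[R]_d) (M : R).
Hypothesis mtheta0 : random_vector theta0.
Hypothesis i0 : integrableR P (fun w => enorm (theta0 w) ^+ 2).
Hypothesis M0 : \int[P]_w enorm (theta0 w) ^+ 2 <= M.
Hypothesis mZ : forall k, random_vector (Z k).
Hypothesis ZB : forall k, same_law P (fun w => Num.sqrt h *: Z k w) B.
Local Notation theta := (euler_maruyama a beta h theta0 Z).
Hypothesis indep : forall k (A C : set (borel_rV R d)), measurable A -> measurable C ->
  P (theta k @^-1` A `&` Z k @^-1` C) = (P (theta k @^-1` A) * P (Z k @^-1` C))%E.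
Local Notation Y := (em_step a beta h B).
Local Notation Q := (step_op P Y).

Lemma measurable_drift (e : measure_display) (S : measurableType e) (X : S -> 'rV[R]_d) j :
  random_vector X -> measurable_fun setT (fun w => a (X w) 0 j).
Proof.
move=> mX; have ca : continuous (fun u => a u 0 j).
  apply: (@enorm_lipschitz_continuous _ _ _ L) => u v.
  by apply: le_trans (aL u v); have := coord_le_enorm (a u - a v) j; rewrite !mxE.
exact: (measurableT_comp (continuous_borel_rV ca) mX).
Qed.

Lemma measurable_em_update (e : measure_display) (S : measurableType e)
    (X V : S -> 'rV[R]_d) b : random_vector X -> random_vector V ->
  random_vector (fun w => X w + h *: a (X w) + b *: V w).
Proof.
move=> mX mV; apply: measurable_rV => j; under eq_fun do rewrite !mxE.
apply: measurable_funD; first apply: measurable_funD.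
- exact: measurable_random_coord.
- by apply: measurable_funM => //; exact: measurable_drift.
- by apply: measurable_funM => //; exact: measurable_random_coord.
Qed.

Lemma random_vector_cst (e : measure_display) (S : measurableType e) (x : 'rV[R]_d) :
  random_vector (fun _ : S => x).
Proof. exact: measurable_cst. Qed.

Lemma em_step_random_vector y : random_vector (Y y).
Proof. by apply: measurable_em_update => //; exact: random_vector_cst. Qed.

Lemma euler_maruyama_random_vector k : random_vector (theta k).
Proof. by elim: k => //= k IH; exact: measurable_em_update. Qed.

Lemma em_step_lip x y w : enorm (Y x w - Y y w) <= c * enorm (x - y).
Proof.
rewrite (_ : Y x w - Y y w = x - y + h *: (a x - a y))//.
by apply/rowP => j; rewrite /em_step !mxE; lra.
Qed.

Let k1 := 4 * (h * enorm (a 0)) ^+ 2 + 2 * s.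
Let k2 := 4 * (1 + h * L) ^+ 2.

(** The constants are crude: they serve integrability, and no decay is extracted from them. *)
Lemma em_step_second_moment y :
  integrableR P (fun w => enorm (Y y w) ^+ 2) /\
  \int[P]_w enorm (Y y w) ^+ 2 <= k1 + k2 * enorm y ^+ 2.
Proof.
pose u := y + h *: a y.
have iU : integrableR P (fun w => 2 * enorm u ^+ 2 + 2 * beta ^+ 2 * enorm (B w) ^+ 2).
  exact: integrable_affineR.
have le w : enorm (Y y w) ^+ 2 <= 2 * enorm u ^+ 2 + 2 * beta ^+ 2 * enorm (B w) ^+ 2.
  apply: le_trans (sqr_enormD_le _ _) _; rewrite enormZ exprMn real_normK ?num_real//.
  by rewrite (mulrA 2 (beta ^+ 2)).
have iY : integrableR P (fun w => enorm (Y y w) ^+ 2).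
  apply: dominated_integrable iU _; last by move=> w; rewrite ger0_norm ?sqr_ge0.
  by apply: measurable_funX; exact: lip_measurable (@lip_enorm R d) (em_step_random_vector y).
split=> //; apply: le_trans (le_Rintegral measurableT iY iU (fun w _ => le w)) _.
rewrite Rintegral_affineR//.
have hu : enorm u <= (1 + h * L) * enorm y + h * enorm (a 0).
  apply: le_trans (enorm_triangle _ _) _; rewrite enormZ ger0_norm ?(ltW h0)//.
  have : enorm (a y) <= L * enorm y + enorm (a 0).
    rewrite -{1}(subrK (a 0) (a y)); apply: le_trans (enorm_triangle _ _) _.
    by rewrite lerD2r; have := aL y 0; rewrite subr0.
  by move=> /(ler_wpM2l (ltW h0)); lra.
have hu2 : enorm u ^+ 2 <= ((1 + h * L) * enorm y + h * enorm (a 0)) ^+ 2.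
  by rewrite ler_pXn2r ?nnegrE ?enorm_ge0 ?(le_trans (enorm_ge0 u) hu).
have := sqr_ge0 ((1 + h * L) * enorm y - h * enorm (a 0)).
by rewrite /k1 /k2; move: hu2 sE; rewrite !exprMn; nra.
Qed.

Lemma lip_em_operator l g : lip l g -> lip (c * l) (Q g).
Proof.
apply: lip_step_op => // [|y|x y]; first exact: em_step_random_vector.
- by have [] := em_step_second_moment y.
- by apply: aeW => w; exact: em_step_lip.
Qed.

Let s0 : 0 <= s.
Proof.
apply: le_trans sE; rewrite mulr_ge0 ?sqr_ge0//.
by apply: Rintegral_ge0 => w _; exact: sqr_ge0.
Qed.

(** Conditioning on [theta k]: the noise [Z k] is independent of it, and [sqrt h *: Z k] may be
    replaced by [B], which has the same law. Squares are taken because the pair lemma asks for a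
    nonnegative integrand. *)
Let transfer_sqr k l g : lip l g ->
  integrableR P (fun w => enorm (theta k w) ^+ 2) ->
  integrableR P (fun w => Q (fun u => g u ^+ 2) (theta k w)) /\
  integrableR P (fun w => g (theta k.+1 w) ^+ 2) /\
  \int[P]_w (g (theta k.+1 w) ^+ 2) = \int[P]_w Q (fun u => g u ^+ 2) (theta k w).
Proof.
move=> gl i2.
pose G (p : borel_rV R d * borel_rV R d) : R :=
  g (p.1 + h *: a p.1 + (beta * Num.sqrt h) *: p.2) ^+ 2.
have mG : measurable_fun setT G.
  apply: measurable_funX; apply: (lip_measurable gl).
  by apply: measurable_em_update; [exact: measurable_fst|exact: measurable_snd].
have G0 p : 0 <= G p by exact: sqr_ge0.
have mth := euler_maruyama_random_vector k.
have GQE x : (\int[P]_w' (G (x, Z k w'))%:E = \int[P]_w' (g (Y x w') ^+ 2)%:E)%E.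
  pose F (u : borel_rV R d) : R := g (x + h *: a x + beta *: u) ^+ 2.
  have mF : measurable_fun setT F.
    apply: measurable_funX; apply: (lip_measurable gl).
    apply: measurable_em_update; [exact: random_vector_cst|exact: measurable_id].
  have := same_law_Rintegral _ mB (ZB k) mF (fun u => sqr_ge0 _).
  rewrite /F => <-; last first.
    apply: measurable_rV => j; under eq_fun do rewrite mxE.
    by apply: measurable_funM => //; exact: measurable_random_coord.
  by apply: eq_integral => w _; rewrite /G/= scalerA.
have GQ x : \int[P]_w' G (x, Z k w') = Q (fun u => g u ^+ 2) x.
  by rewrite /Rintegral GQE.
have iY x : integrableR P (fun w => g (Y x w) ^+ 2).
  by apply: lip_sqr_integrable gl (em_step_random_vector x) _; have [] := em_step_second_moment x.
have iG x : integrableR P (fun w' => G (x, Z k w')).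
  have mGx : measurable_fun setT (fun w' => G (x, Z k w')).
    exact: (measurableT_comp (measurable_fun_pair2 x mG) (mZ k)).
  have le : (\int[P]_w' (G (x, Z k w'))%:E <= (\int[P]_w (g (Y x w) ^+ 2))%:E)%E.
    by rewrite GQE EFin_Rintegral.
  by have [] := ge0_bounded_integrable mGx (fun w' => G0 (x, Z k w')) le.
have mQ : measurable_fun setT (fun w => Q (fun u => g u ^+ 2) (theta k w)).
  under eq_fun do rewrite -GQ.
  exact: (measurable_section_Rintegral P mth (mZ k) mG G0).
have iQ : integrableR P (fun w => Q (fun u => g u ^+ 2) (theta k w)).
  apply: dominated_integrable (_ : forall w, _ <=
      (2 * g 0 ^+ 2 + 2 * l ^+ 2 * k1) + 2 * l ^+ 2 * k2 * enorm (theta k w) ^+ 2).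
  - exact: mQ.
  - exact: integrable_affineR.
  move=> w; set y := theta k w.
  rewrite ger0_norm; last by apply: Rintegral_ge0 => w' _; exact: sqr_ge0.
  have [j2 e2] := em_step_second_moment y.
  have jb : integrableR P (fun w =>
      2 * g 0 ^+ 2 + 2 * l ^+ 2 * enorm (Y y w) ^+ 2).
    exact: integrable_affineR.
  apply: le_trans (le_Rintegral measurableT (iY y) jb (fun w' _ => lip_sqr_growth _ gl)) _.
  rewrite Rintegral_affineR//.
  have l2 : 0 <= 2 * l ^+ 2 by rewrite mulr_ge0 ?sqr_ge0.
  by have := ler_wpM2l l2 e2; lra.
have [|i E] := independent_pair_Rintegral mth (mZ k) (indep k) mG G0 (fun w => iG (theta k w)).
  by under eq_fun do rewrite GQ.
split; first exact: iQ.
split; first exact: i.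
have GQf : (fun w => \int[P]_w' G (theta k w, Z k w')) =
    (fun w => Q (fun u => g u ^+ 2) (theta k w)) by apply/funext => w; exact: GQ.
rewrite GQf in E; exact: E.
Qed.

Lemma euler_maruyama_second_moment k :
  integrableR P (fun w => enorm (theta k w) ^+ 2).
Proof.
elim: k => // k IH.
by have [_ []] := transfer_sqr (@lip_enorm R d) IH.
Qed.

(* 2 g = (g + 1)^2 - g^2 - 1 reduces to squares. *)
Lemma transfer_lip k l g : lip l g ->
  \int[P]_w g (theta k.+1 w) = \int[P]_w Q g (theta k w).
Proof.
move=> gl; have i2 := euler_maruyama_second_moment k.
have gl1 := lip_shift 1 gl.
have [iq0 [i0' e0]] := transfer_sqr gl i2.
have [iq1 [i1' e1]] := transfer_sqr gl1 i2.
have gE r : r = 2^-1 * ((r + 1) ^+ 2 - r ^+ 2 - 1) :> R by field.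
have QE y : Q g y = 2^-1 * (Q (fun u => (g u + 1) ^+ 2) y - Q (fun u => g u ^+ 2) y - 1).
  have [j2 _] := em_step_second_moment y; have mY := em_step_random_vector y.
  have j0 := lip_sqr_integrable gl mY j2.
  have j1 := lip_sqr_integrable gl1 mY j2.
  rewrite {1}/step_op; under eq_Rintegral do rewrite {1}[g _]gE.
  have jB := integrableBR j1 j0.
  rewrite RintegralZl//; last by apply: integrableBR => //; exact: integrable_cstR.
  rewrite RintegralB//; last exact: integrable_cstR.
  by rewrite RintegralB// Rintegral_cstR.
under eq_Rintegral do rewrite {1}[g _]gE.
under [RHS]eq_Rintegral do rewrite QE.
have iB := integrableBR i1' i0'; have iqB := integrableBR iq1 iq0.
rewrite !RintegralZl//; try by apply: integrableBR => //; exact: integrable_cstR.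
rewrite !RintegralB//; try exact: integrable_cstR.
by rewrite e0 e1.
Qed.

Lemma euler_maruyama_mean k l g : lip l g ->
  \int[P]_w g (theta k w) = \int[P]_w iter k Q g (theta0 w).
Proof.
elim: k l g => // k IH l g gl.
by rewrite (transfer_lip k gl) iterSr (IH _ _ (lip_em_operator gl)).
Qed.

(** A variance is at most the mean square distance to any constant; the constant taken is [g0], the
    value of [g] after the step without noise. *)
Lemma em_local_variance l g y : lip l g ->
  Q (fun u => g u ^+ 2) y <= Q g y ^+ 2 + l ^+ 2 * s.
Proof.
move=> gl; have [j2 _] := em_step_second_moment y; have mY := em_step_random_vector y.
have jg2 := lip_sqr_integrable gl mY j2; have jg := lip_integrable gl mY j2.
pose g0 := g (y + h *: a y).
have E : \int[P]_w ((g (Y y w) + - g0) ^+ 2) =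
    Q (fun u => g u ^+ 2) y - 2 * g0 * Q g y + g0 ^+ 2.
  exact: Rintegral_sqrB.
have le : \int[P]_w ((g (Y y w) + - g0) ^+ 2) <= l ^+ 2 * s.
  apply: (@le_trans _ _ (\int[P]_w (l ^+ 2 * beta ^+ 2 * enorm (B w) ^+ 2))).
    apply: le_Rintegral => //.
    - exact: lip_sqr_integrable (lip_shift (- g0) gl) mY j2.
    - exact: integrableZR.
    move=> w _; have [l0 gl'] := gl.
    have := gl' (Y y w) (y + h *: a y).
    have -> : Y y w - (y + h *: a y) = beta *: B w by rewrite /em_step addrAC subrr add0r.
    rewrite enormZ => H.
    rewrite -(real_normK (num_real (_ - _))).
    have -> : l ^+ 2 * beta ^+ 2 * enorm (B w) ^+ 2 = (l * (`|beta| * enorm (B w))) ^+ 2.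
      by rewrite !exprMn real_normK ?num_real// mulrA.
    by rewrite ler_pXn2r ?nnegrE// mulr_ge0// mulr_ge0// enorm_ge0.
  by rewrite RintegralZl// -mulrA ler_wpM2l ?sqr_ge0.
by have := sqr_ge0 (Q g y - g0); move: le; rewrite E; nra.
Qed.

(* Conditioning on theta_k: the variance of g(theta_(k+1)) is the mean of the local
   variance plus the variance of (Q g)(theta_k), and [Q] contracts the Lipschitz
   constant. *)
Lemma euler_maruyama_variance k l g : lip l g ->
  \int[P]_w (g (theta k w) ^+ 2) <=
  (\int[P]_w g (theta k w)) ^+ 2 + l ^+ 2 * (c ^+ k * M + s / (1 - c)).
Proof.
have c10 : 0 < 1 - c by rewrite subr_gt0.
have S0 : 0 <= s / (1 - c) by rewrite divr_ge0// ltW.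
have M00 : 0 <= M.
  by apply: le_trans M0; apply: Rintegral_ge0 => w _; exact: sqr_ge0.
(* The Lipschitz constant enters squared, so the recursion contracts by [c ^+ 2]; the weaker factor
   [c] is enough and fits the bound [s / (1 - c)]. *)
have c2c : c ^+ 2 <= c by rewrite expr2 ler_piMl// ltW.
elim: k l g => [|k IH] l g gl.
  rewrite expr0 mul1r /=.
  have ig2 := lip_sqr_integrable gl mtheta0 i0; have ig := lip_integrable gl mtheta0 i0.
  have E : \int[P]_w ((g (theta0 w) + - g 0) ^+ 2) =
      \int[P]_w (g (theta0 w) ^+ 2) - 2 * g 0 * \int[P]_w g (theta0 w) + g 0 ^+ 2.
    exact: Rintegral_sqrB.
  have le : \int[P]_w ((g (theta0 w) + - g 0) ^+ 2) <= l ^+ 2 * M.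
    apply: (@le_trans _ _ (\int[P]_w (l ^+ 2 * enorm (theta0 w) ^+ 2))).
      apply: le_Rintegral => //.
      - exact: lip_sqr_integrable (lip_shift (- g 0) gl) mtheta0 i0.
      - exact: integrableZR.
      move=> w _; have [l0 gl'] := gl; have := gl' (theta0 w) 0; rewrite subr0 => H.
      rewrite -(real_normK (num_real (_ - _))) -exprMn.
      by rewrite ler_pXn2r ?nnegrE// mulr_ge0// enorm_ge0.
    by rewrite RintegralZl// ler_wpM2l ?sqr_ge0.
  have lS : 0 <= l ^+ 2 * (s / (1 - c)) by rewrite mulr_ge0 ?sqr_ge0.
  by have := sqr_ge0 (\int[P]_w g (theta0 w) - g 0); move: le lS; rewrite E mulrDr; nra.
have i2 := euler_maruyama_second_moment k.
have mth := euler_maruyama_random_vector k.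
have Ql := lip_em_operator gl.
have [iq [_ ->]] := transfer_sqr gl i2.
rewrite (transfer_lip k gl).
have iQ2 := lip_sqr_integrable Ql mth i2.
apply: (@le_trans _ _ (\int[P]_w (Q g (theta k w) ^+ 2 + l ^+ 2 * s))).
  apply: le_Rintegral => //; first by apply: integrableDR => //; exact: integrable_cstR.
  by move=> w _; exact: em_local_variance.
rewrite RintegralD// ?Rintegral_cstR; last exact: integrable_cstR.
apply: le_trans (lerD (IH _ _ Ql) (lexx _)) _.
rewrite -addrA lerD2l exprMn (mulrC (c ^+ 2)) -mulrA -mulrDr ler_wpM2l ?sqr_ge0//.
have x0 : 0 <= c ^+ k * M + s / (1 - c) by rewrite addr_ge0// mulr_ge0// exprn_ge0.
apply: le_trans (lerD (ler_wpM2r x0 c2c) (lexx _)) _.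
rewrite exprS; apply: eqW; field.
by rewrite gt_eqF.
Qed.

End chain.

(** * Mean square error of an average *)

Section average_mean_square.
Context {R : realType} {disp : measure_display} {T : measurableType disp}.
Variable P : probability T R.

(** Splits the error into variance and squared bias. Each variable is centred at its own mean, so
    that a common bound [b] on the biases replaces equality of the laws; off-diagonal covariances
    vanish. *)
Lemma average_mean_square (N : nat) (F : 'I_N -> T -> R) (c0 b v : R) : (0 < N)%N ->
  (forall i, measurable_fun setT (F i)) ->
  (forall i, integrableR P (fun w => F i w ^+ 2)) ->
  (forall i j, i != j -> integrableR P (fun w => F i w * F j w) /\
    \int[P]_w (F i w * F j w) = (\int[P]_w F i w) * \int[P]_w F j w) ->
  (forall i, `|c0 - \int[P]_w F i w| <= b) ->
  (forall i, \int[P]_w (F i w ^+ 2) <= (\int[P]_w F i w) ^+ 2 + v) ->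
  integrableR P (fun w => `|c0 - N%:R^-1 * \sum_(i < N) F i w| ^+ 2) /\
  \int[P]_w (`|c0 - N%:R^-1 * \sum_(i < N) F i w| ^+ 2) <= v / N%:R + b ^+ 2.
Proof.
move=> N0 mF F2 FF Fb Fv; have F1 i := sqr_integrable (mF i) (F2 i).
have NR : 0 < N%:R :> R by rewrite ltr0n.
have NV : 0 <= N%:R^-1 :> R by rewrite invr_ge0 ltW.
pose mu i := \int[P]_w F i w.
pose D i w := F i w - mu i.
have iFF i j : integrableR P (fun w => F i w * F j w).
  have [->|ij] := eqVneq i j; last by have [] := FF i j ij.
  by under eq_fun do rewrite -expr2; exact: F2.
have DDE i j : (fun w => D i w * D j w) = (fun w => F i w * F j w - mu j * F i w
    - mu i * F j w + mu i * mu j).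
  by apply/funext => w; rewrite /D; ring.
have iD2 i j : integrableR P (fun w => F i w * F j w - mu j * F i w).
  by apply: integrableBR => //; exact: integrableZR.
have iD3 i j : integrableR P (fun w => F i w * F j w - mu j * F i w - mu i * F j w).
  by apply: integrableBR => //; exact: integrableZR.
have iDD i j : integrableR P (fun w => D i w * D j w).
  by rewrite DDE; apply: integrableDR => //; exact: integrable_cstR.
have eDD i j : \int[P]_w (D i w * D j w) = \int[P]_w (F i w * F j w) - mu i * mu j.
  rewrite DDE RintegralD//; last exact: integrable_cstR.
  rewrite RintegralB//; last exact: integrableZR.
  rewrite RintegralB//; last exact: integrableZR.
  by rewrite Rintegral_cstR !RintegralZl// -/(mu i) -/(mu j); ring.
pose X w := N%:R^-1 * \sum_(i < N) D i w.
have iD i : integrableR P (D i).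
  by apply: integrableBR => //; exact: integrable_cstR.
have iSD : integrableR P (fun w => \sum_(i < N) D i w).
  exact: integrable_sumR.
have iX : integrableR P X by exact: integrableZR.
have eX : \int[P]_w X w = 0.
  rewrite /X RintegralZl// Rintegral_sumR// big1 ?mulr0// => i _.
  by rewrite RintegralB// ?Rintegral_cstR ?subrr//; exact: integrable_cstR.
have X2E : (fun w => X w ^+ 2) = (fun w => N%:R^-1 ^+ 2 * \sum_(i < N) \sum_(j < N) (D i w * D j w)).
  by apply/funext => w; rewrite /X exprMn; congr (_ * _); rewrite expr2 big_distrlr.
have iSS (i : 'I_N) : integrableR P (fun w => \sum_(j < N) D i w * D j w).
  exact: integrable_sumR.
have iSS2 : integrableR P (fun w => \sum_(i < N) \sum_(j < N) D i w * D j w).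
  exact: integrable_sumR.
have iX2 : integrableR P (fun w => X w ^+ 2).
  by rewrite X2E; exact: integrableZR.
have eX2 : \int[P]_w (X w ^+ 2) <= v / N%:R.
  rewrite X2E RintegralZl// Rintegral_sumR//.
  have le (i : 'I_N) : \int[P]_w (\sum_(j < N) D i w * D j w) <= v.
    rewrite Rintegral_sumR// (bigD1 i)//= big1 ?addr0 => [|j ji].
      rewrite eDD; under eq_Rintegral do rewrite -expr2.
      by have := Fv i; rewrite -/(mu i); lra.
    by rewrite eDD; have [|_ ->] := FF i j; rewrite ?subrr// eq_sym.
  have -> : v / N%:R = N%:R^-1 ^+ 2 * (N%:R * v) by field; rewrite gt_eqF.
  rewrite ler_wpM2l ?sqr_ge0// mulr_natl -[X in _ *+ X]card_ord -sumr_const.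
  exact: ler_sum.
pose c := c0 - N%:R^-1 * \sum_(i < N) mu i.
have cb : c ^+ 2 <= b ^+ 2.
  have b0 : 0 <= b by apply: le_trans (Fb (Ordinal N0)).
  rewrite -(real_normK (num_real c)) ler_pXn2r ?nnegrE//.
  have -> : c = N%:R^-1 * \sum_(i < N) (c0 - mu i).
    rewrite sumrB sumr_const card_ord mulrBr -[c0 *+ N]mulr_natl mulrA mulVf ?mul1r//.
    by rewrite gt_eqF.
  rewrite normrM ger0_norm//; apply: (@le_trans _ _ (N%:R^-1 * (N%:R * b))); last first.
    by rewrite mulrA mulVf ?mul1r// gt_eqF.
  rewrite ler_wpM2l// mulr_natl -[X in _ *+ X]card_ord -sumr_const.
  by apply: le_trans (ler_norm_sum _ _ _) _; apply: ler_sum => i _; exact: Fb.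
have E : (fun w => `|c0 - N%:R^-1 * \sum_(i < N) F i w| ^+ 2) = (fun w => (X w - c) ^+ 2).
  apply/funext => w; rewrite real_normK ?num_real// -sqrrN; congr (_ ^+ 2).
  by rewrite /X /c /D sumrB mulrBr; ring.
have iE : integrableR P (fun w => (X w - c) ^+ 2).
  rewrite (_ : (fun w => _) = (fun w => X w ^+ 2 - (2 * c) * X w + c ^+ 2)).
    apply: integrableDR; last exact: integrable_cstR.
    by apply: integrableBR => //; exact: integrableZR.
  by apply/funext => w; ring.
by rewrite E; split=> //; rewrite Rintegral_sqrB// eX mulr0 subr0 lerD.
Qed.

End average_mean_square.

(** * Independence of the particles and of the successive noises *)

Section particles.
Context {R : realType} {disp : measure_display} {T : measurableType disp} {d : nat}.
Variable P : probability T R.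
Variables (a : 'rV[R]_d -> 'rV[R]_d) (L beta h : R).
Hypothesis aL : forall u v, enorm (a u - a v) <= L * enorm (u - v).
Variables (X0 : T -> 'rV[R]_d) (N : nat).
Variables (theta0 : 'I_N -> T -> 'rV[R]_d) (Z : 'I_N -> nat -> T -> 'rV[R]_d).
Hypothesis inputs : iid_em_inputs P X0 theta0 Z.
Local Notation theta i := (euler_maruyama a beta h (theta0 i) (Z i)).

Let input (p : 'I_N * option nat) := if p.2 is Some k then Z p.1 k else theta0 p.1.
Let G p := sigma_of (input p).

Let input_rv p : random_vector (input p).
Proof.
by case: p => i [k|]; have [r z _] := inputs; [have [] := z i k|have [] := r i].
Qed.

Let GE p E : G p E <-> exists2 B : set (borel_rV R d), measurable B & E = input p @^-1` B.
Proof.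
split=> [[B mB <-]|[B mB ->]]; exists B => //; rewrite setTI//.
Qed.

Let Gm p : G p `<=` measurable.
Proof.
by move=> E /GE[B mB ->]; rewrite -[X in measurable X]setTI; exact: input_rv.
Qed.

Let GT p : G p setT.
Proof. by apply/GE; exists setT => //; rewrite preimage_setT. Qed.

Let GI p : setI_closed (G p).
Proof.
move=> _ _ /GE[B mB ->] /GE[C mC ->]; apply/GE; exists (B `&` C) => //.
exact: measurableI.
Qed.

(** Measurability for the sigma-algebra generated by the inputs in [S] expresses that a variable
    depends on these inputs only; independence then reduces to disjointness of sets of indices. *)
Let past_input (S : pred ('I_N * option nat)) p : S p ->
  random_vector (input p : g_sigma_algebraType (cylinders G S) -> 'rV[R]_d).
Proof.
move=> Sp _ B mB; rewrite setTI; apply: sub_sigma_algebra.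
exists [:: p], (fun q => if q == p then input p @^-1` B else setT); split=> //=.
- by rewrite Sp.
- by move=> q; case: eqP => [->|_] //; apply/GE; exists B.
- apply/seteqP; split => [w Bw q /=|w H]; first by rewrite inE => /eqP ->; rewrite eqxx.
  by have := H p; rewrite /= inE eqxx; exact.
Qed.

Let past_theta (S : pred ('I_N * option nat)) i k : S (i, None) ->
  (forall l, (l < k)%N -> S (i, Some l)) ->
  random_vector (theta i k : g_sigma_algebraType (cylinders G S) -> 'rV[R]_d).
Proof.
move=> S0; elim: k => [|k IH] Sk; first exact: (past_input S0).
have Zk := past_input (Sk k (ltnSn k)).
have mth := IH (fun l lk => Sk l (ltnW lk)).
exact: (measurable_em_update h aL (beta * Num.sqrt h) mth Zk).
Qed.

Let past_indep (S1 S2 : pred ('I_N * option nat)) U V :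
  (forall p, ~~ (S1 p && S2 p)) ->
  random_vector (U : g_sigma_algebraType (cylinders G S1) -> 'rV[R]_d) ->
  random_vector (V : g_sigma_algebraType (cylinders G S2) -> 'rV[R]_d) ->
  forall A C : set (borel_rV R d), measurable A -> measurable C ->
  P (U @^-1` A `&` V @^-1` C) = (P (U @^-1` A) * P (V @^-1` C))%E.
Proof.
move=> S12 mU mV A C mA mC; have [_ _ mi] := inputs.
apply: (independent_cylinders Gm GT GI S12 mi).
  by have := mU measurableT A mA; rewrite setTI.
by have := mV measurableT C mC; rewrite setTI.
Qed.

Lemma em_noise_independent i k (A C : set (borel_rV R d)) :
  measurable A -> measurable C ->
  P (theta i k @^-1` A `&` Z i k @^-1` C) = (P (theta i k @^-1` A) * P (Z i k @^-1` C))%E.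
Proof.
(* The state [theta i k] is built from the initial value and the noises [0, ..., k - 1]; the noise
   of index [k] drives the next step. *)
pose S1 := [pred p : 'I_N * option nat |
  (p.1 == i) && (if p.2 is Some l then (l < k)%N else true)].
pose S2 := [pred p : 'I_N * option nat | p == (i, Some k)].
apply: (@past_indep S1 S2).
- move=> [j [l|]] /=; apply/negP => /andP[/andP[_ lk] /eqP[_ E]]//.
  by rewrite E ltnn in lk.
- by apply: past_theta => [|l lk] /=; rewrite eqxx.
- exact: (@past_input S2 (i, Some k)) (eqxx _).
Qed.

Lemma em_particles_independent i j k : i != j ->
  forall A C : set (borel_rV R d), measurable A -> measurable C ->
  P (theta i k @^-1` A `&` theta j k @^-1` C) =
    (P (theta i k @^-1` A) * P (theta j k @^-1` C))%E.
Proof.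
move=> ij; pose S i := [pred p : 'I_N * option nat | p.1 == i].
apply: (@past_indep (S i) (S j)).
- by move=> [l q] /=; apply/negP => /andP[/eqP -> /eqP E]; rewrite E eqxx in ij.
- by apply: past_theta => [|l _] /=; rewrite eqxx.
- by apply: past_theta => [|l _] /=; rewrite eqxx.
Qed.

End particles.

Lemma second_moment_le (R : realType) (disp : measure_display) (T : measurableType disp)
  (P : probability T R) (d : nat) (X Y : T -> 'rV[R]_d) (M : R) :
  random_vector X -> random_vector Y -> same_law P Y X ->
  ('E_P[(fun w => enorm (X w) ^+ 2)%R] <= M%:E)%E ->
  integrableR P (fun w => enorm (Y w) ^+ 2) /\
  \int[P]_w enorm (Y w) ^+ 2 <= M.
Proof.
move=> mX mY YX; rewrite unlock => XM.
have mF : measurable_fun setT (fun u : borel_rV R d => enorm u ^+ 2).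
  by apply: measurable_funX; exact: lip_borel (@lip_enorm R d).
apply: ge0_bounded_integrable => [|w|]; last 1 first.
- by rewrite (same_law_Rintegral mY mX YX mF (fun u => sqr_ge0 _)).
- exact: (measurableT_comp mF mY).
- exact: sqr_ge0.
Qed.

(** * Mean square error and choice of the parameters *)

Ltac nneg := repeat first [exact: ler0n | exact: ler01 | assumption | exact: sqr_ge0 |
  apply: ltW; assumption | apply: addr_ge0 | apply: mulr_ge0 | rewrite invr_ge0].

Section mean_square_error.
Context {R : realType} {disp : measure_display} {T : measurableType disp} {d : nat}.
Variables (P : probability T R) (F : R -> set_system T) (W : R -> T -> 'rV[R]_d).
Variables (a : 'rV[R]_d -> 'rV[R]_d) (X : 'rV[R]_d -> R -> T -> 'rV[R]_d).
Variables (pi : probability (borel_rV R d) R).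
Variables (K L A0 Ct beta h : R).
Local Notation D := (d%:R : R).
Hypotheses (filtF : filtration F) (WB : brownian_motion P F W).
Hypothesis solX : forall x, sde_solution P F W a beta x (X x).
Hypothesis invX : invariant_measure P X pi.
Hypotheses (h0 : 0 < h) (h1 : h <= 1) (K0 : 0 < K) (L0 : 0 <= L) (A00 : 0 <= A0)
  (Ct0 : 0 <= Ct) (beta0 : 0 <= beta) (beta1 : beta <= 1).
Hypothesis aL : forall u v, enorm (a u - a v) <= L * enorm (u - v).
Hypothesis aK : forall u v, dotp (u - v) (a u - a v) <= - K * enorm (u - v) ^+ 2.
Hypothesis aA0 : enorm (a 0) <= A0.
Hypothesis taylor : forall i x u,
  `|a (x + u) 0 i - a x 0 i - dotp (gradient (component a i) x) u| <= Ct * enorm u ^+ 2.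

(** The constants of the mean and of the mean square of the local error, once [enorm (a x)] is
    bounded by [A0 + L * enorm x]. They depend neither on [h] nor on [beta], hence not on [m]. *)
Definition weak_const := 2 * L * D * (A0 + L) + 2 * L ^+ 2 * D * (1 + 8 * D) + 8 * Ct * D.
Definition strong_const := 8 * L ^+ 2 * (2 * D ^+ 2 * (A0 ^+ 2 + L ^+ 2) + 8 * D).
Local Notation c1 := weak_const.
Local Notation c2 := strong_const.
Definition distance_const := 4 * D ^+ 2 * c1 ^+ 2 / K + D * c2.
Definition moment_const := 10 * A0 ^+ 2 / K + 16 * D + K / 2.
(* With this weight, the term kappa h^2 |x|^2 absorbs the growth in [x] of the
   one-step error, of order h^3 (1 + |x|^2). *)
Definition lyapunov_weight := 4 * distance_const / K.
Local Notation cd := distance_const.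
Local Notation cm := moment_const.
Local Notation kappa := lyapunov_weight.

Hypothesis Lh : 2 * D * L * h <= 1.
Hypothesis L2h : L ^+ 2 * h <= K / 2.
Hypothesis Kh : K * h <= 1.
Hypothesis ch : (8 * D ^+ 2 * c1 ^+ 2 / K + 2 * D * c2) * h ^+ 2 <= K / 2.

Let B w := W h w - W 0 w.

Let BG : isotropic_gaussian P (Num.sqrt h) B.
Proof. exact: gaussian_increment WB h h0. Qed.

Let mB : random_vector B.
Proof. by case: BG. Qed.

Let sqrth0 : 0 < Num.sqrt h.
Proof. by rewrite sqrtr_gt0. Qed.

Let B1 i : \int[P]_w B w 0 i = 0.
Proof. by have [] := gaussian_coord_mean i sqrth0 BG. Qed.

Let iB2 i : integrableR P (fun w => B w 0 i ^+ 2).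
Proof. by have [] := gaussian_coord_sqr i sqrth0 BG. Qed.

Let B2 i : \int[P]_w (B w 0 i ^+ 2) <= 8 * h.
Proof. by have [_] := gaussian_coord_sqr i sqrth0 BG; rewrite sqr_sqrtr ?(ltW h0). Qed.

Let B_moment : integrableR P (fun w => enorm (B w) ^+ 2) /\
  \int[P]_w enorm (B w) ^+ 2 <= 8 * D * h.
Proof.
have -> : (fun w => enorm (B w) ^+ 2) = (fun w => \sum_i B w 0 i ^+ 2).
  by apply/funext => w; rewrite sqr_enorm_sum.
split; first exact: integrable_sumR.
rewrite Rintegral_sumR//; apply: le_trans (ler_sum _ (fun i _ => B2 i)) _.
by rewrite sumr_const card_ord -[_ *+ d]mulr_natr mulrAC.
Qed.

Let mX x : random_vector (X x h).
Proof. exact: (sde_solution_random_vector filtF h0 (solX x)). Qed.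

Let D0 : 0 <= D. Proof. by []. Qed.

Let drift_growth x : enorm (a x) <= A0 + L * enorm x.
Proof.
rewrite -(subrK (a 0) (a x)); apply: le_trans (enorm_triangle _ _) _.
by have := aL x 0; rewrite subr0; move: aA0; lra.
Qed.

Let ir2 x i : integrableR P (fun w => euler_remainder W a beta h x (X x) w 0 i ^+ 2).
Proof.
by have [] := euler_remainder_moments filtF WB h0 h1 L0 Ct0 beta0 beta1 aL Lh taylor i (solX x).
Qed.

Let c20 : 0 <= c2.
Proof.
rewrite /strong_const; nneg.
Qed.

Let r2 x i : \int[P]_w (euler_remainder W a beta h x (X x) w 0 i ^+ 2) <=
  c2 * h ^+ 3 * (1 + enorm x ^+ 2).
Proof.
have [_ + _] := euler_remainder_moments filtF WB h0 h1 L0 Ct0 beta0 beta1 aL Lh taylor i (solX x).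
move=> /le_trans; apply.
have A2 : enorm (a x) ^+ 2 <= 2 * (A0 ^+ 2 + L ^+ 2) * (1 + enorm x ^+ 2).
  apply: (@le_trans _ _ ((A0 + L * enorm x) ^+ 2)).
    by rewrite ler_pXn2r ?nnegrE ?enorm_ge0// addr_ge0// mulr_ge0// enorm_ge0.
  have := sqr_ge0 (A0 - L * enorm x); have := sqr_ge0 (A0 * enorm x); have := sqr_ge0 L.
  by rewrite !exprMn sqrrB sqrrD exprMn; nra.
have h3 : 0 <= h ^+ 3 by rewrite exprn_ge0// ltW.
have n1 : 1 <= 1 + enorm x ^+ 2 by rewrite lerDl sqr_ge0.
have -> : c2 * h ^+ 3 * (1 + enorm x ^+ 2) =
    8 * L ^+ 2 * (2 * D ^+ 2 * (A0 ^+ 2 + L ^+ 2) * (h ^+ 3 * (1 + enorm x ^+ 2)) +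
                  8 * D * (h ^+ 3 * (1 + enorm x ^+ 2))) by rewrite /strong_const; ring.
apply: ler_wpM2l; first by nneg.
apply: lerD.
  have H4 : h ^+ 4 <= h ^+ 3 by rewrite exprSr ler_piMr.
  apply: (@le_trans _ _ (D ^+ 2 * (h ^+ 3 * (2 * (A0 ^+ 2 + L ^+ 2) * (1 + enorm x ^+ 2))))).
    rewrite -mulrA ler_wpM2l ?sqr_ge0//; apply: ler_pM => //; last exact: sqr_ge0.
    by rewrite exprn_ge0// ltW.
  by apply: eqW; ring.
by rewrite ler_wpM2l ?ler_peMr//; nneg.
Qed.

Let r1 x i : `|\int[P]_w euler_remainder W a beta h x (X x) w 0 i| <=
  c1 * h ^+ 2 * (1 + enorm x).
Proof.
have [_ _] := euler_remainder_moments filtF WB h0 h1 L0 Ct0 beta0 beta1 aL Lh taylor i (solX x).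
move=> /le_trans; apply.
have -> : c1 * h ^+ 2 * (1 + enorm x) = h ^+ 2 * (c1 * (1 + enorm x)) by ring.
apply: ler_wpM2l; first exact: sqr_ge0.
have n0 := enorm_ge0 x; have LD : 0 <= 2 * L * D by rewrite mulr_ge0// mulr_ge0.
have H := ler_wpM2l LD (drift_growth x).
have p1 : 0 <= 2 * L ^+ 2 * D * (1 + 8 * D).
  by rewrite mulr_ge0 ?addr_ge0 ?mulr_ge0 ?sqr_ge0.
have p2 : 0 <= 8 * Ct * D by rewrite mulr_ge0// mulr_ge0.
apply: le_trans (lerD (lerD H (lexx _)) (lexx _)) _; rewrite /weak_const.
have := mulr_ge0 p1 n0; have := mulr_ge0 p2 n0.
have := mulr_ge0 (mulr_ge0 LD A00) n0; have := mulr_ge0 LD L0.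
by rewrite !mulrDr !mulrDl; lra.
Qed.

Let c10 : 0 <= c1.
Proof.
rewrite /weak_const; nneg.
Qed.

Let cd0 : 0 <= cd.
Proof.
rewrite /distance_const; nneg.
Qed.

Let kappa0 : 0 <= kappa.
Proof. rewrite /lyapunov_weight; nneg. Qed.

Let cm0 : 0 <= cm.
Proof.
rewrite /moment_const; nneg.
Qed.

Local Notation Xh := (fun x => X x h).
Local Notation Y := (em_step a beta h B).

Let Kh0 : 0 < K * h. Proof. exact: mulr_gt0. Qed.

Let moment x : integrableR P (fun w => enorm (X x h w) ^+ 2) /\
  \int[P]_w enorm (X x h w) ^+ 2 <= (1 - K * h / 2) * enorm x ^+ 2 + cm * h.
Proof.
exact: (coupled_step_moment h0 K0 A00 beta0 beta1 aL aK aA0 L2h Kh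
  mB mX B1 iB2 B2 ir2 r2 r1 x ch).
Qed.

Let distance x y :
  integrableR P (fun w => enorm (X x h w - Y y w) ^+ 2) /\
  \int[P]_w enorm (X x h w - Y y w) ^+ 2 <=
    (1 - K * h) * enorm (x - y) ^+ 2 + cd * h ^+ 3 * (1 + enorm x ^+ 2).
Proof.
exact: (coupled_step_distance h0 K0 aL aK L2h mB mX ir2 r2 r1 x y).
Qed.

Let lyapunov x y :
  integrableR P (fun w => enorm (X x h w - Y y w) ^+ 2 +
    kappa * h ^+ 2 * enorm (X x h w) ^+ 2) /\
  \int[P]_w (enorm (X x h w - Y y w) ^+ 2 + kappa * h ^+ 2 * enorm (X x h w) ^+ 2) <=
  (1 - K * h / 4) * (enorm (x - y) ^+ 2 + kappa * h ^+ 2 * enorm x ^+ 2) +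
    (cd + kappa * cm) * h ^+ 3.
Proof.
have [i1 e1] := distance x y; have [i2 e2] := moment x.
have iZ := integrableZR (kappa * h ^+ 2) i2.
split; first exact: integrableDR.
rewrite RintegralD// RintegralZl//.
have kh : 0 <= kappa * h ^+ 2 by rewrite mulr_ge0 ?sqr_ge0.
apply: le_trans (lerD e1 (ler_wpM2l kh e2)) _.
(* The weight is chosen for this identity: the second moment decays at rate [K * h / 2], half of
   which pays for the growth of the local error, while the other half remains in the factor
   [1 - K * h / 4]. *)
have E : cd * h ^+ 3 * enorm x ^+ 2 = kappa * h ^+ 2 * (K * h / 4) * enorm x ^+ 2.
  by rewrite /lyapunov_weight; field; rewrite gt_eqF.
have -> : (cd + kappa * cm) * h ^+ 3 = cd * h ^+ 3 + kappa * h ^+ 2 * (cm * h) by ring.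
have := mulr_ge0 (ltW Kh0) (sqr_ge0 (enorm (x - y))).
rewrite (mulrDr (cd * h ^+ 3)) E mulr1.
have := mulr_ge0 kh (sqr_ge0 (enorm x)).
lra.
Qed.

Let c := 1 - K * h / 2.
Let q := 1 - K * h / 4.

Let c0 : 0 <= c. Proof. by rewrite /c; have := Kh; lra. Qed.
Let c1' : c < 1. Proof. by rewrite /c; have := Kh0; lra. Qed.
Let q0 : 0 <= q. Proof. by rewrite /q; have := Kh; lra. Qed.
Let q1 : q < 1. Proof. by rewrite /q; have := Kh0; lra. Qed.

Let ac x y : enorm (x - y + h *: (a x - a y)) <= c * enorm (x - y).
Proof. exact: (euler_drift_lipschitz h0 K0 aL aK L2h). Qed.

(** The noise added in one step. Divided by [1 - c = K * h / 2] it becomes [16 * D / K * beta ^+ 2],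
    free of [h]. *)
Let s := beta ^+ 2 * (8 * D * h).

Let sE : beta ^+ 2 * \int[P]_w enorm (B w) ^+ 2 <= s.
Proof. by have [_ e] := B_moment; rewrite ler_wpM2l ?sqr_ge0. Qed.

Lemma em_mean_square_error (X0 : T -> 'rV[R]_d) (M l : R) (f : 'rV[R]_d -> R)
    (N k : nat) (theta0 : 'I_N -> T -> 'rV[R]_d) (Z : 'I_N -> nat -> T -> 'rV[R]_d) :
  lip l f -> random_vector X0 -> 0 <= M ->
  ('E_P[(fun w => enorm (X0 w) ^+ 2)%R] <= M%:E)%E ->
  (0 < N)%N -> iid_em_inputs P X0 theta0 Z ->
  ('E_P[(fun w => `|\int[pi]_x f x - em_estimator f a beta h theta0 Z k w| ^+ 2)%R] <=
   (l ^+ 2 * ((1 - K * h / 2) ^+ k * M + 16 * D / K * beta ^+ 2) / N%:R +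
    (l ^+ 2 / h * ((1 - K * h / 4) ^+ k * ((2 + kappa) * (2 * cm / K) + 2 * M)
      + 4 * (cd + kappa * cm) / K * h ^+ 2) + h) ^+ 2)%:E)%E.
Proof.
move=> fl mX0 M0 X0M N0 inputs; have [init noise _] := inputs.
have mth0 i : random_vector (theta0 i) by have [] := init i.
have th02 i : integrableR P (fun w => enorm (theta0 i w) ^+ 2) /\
    \int[P]_w enorm (theta0 i w) ^+ 2 <= M.
  by have [? e] := init i; exact: second_moment_le X0M.
have i0 i := proj1 (th02 i).
have mZ i j : random_vector (Z i j) by have [] := noise i j.
have ZB i j : same_law P (fun w => Num.sqrt h *: Z i j w) B.
  by apply: (gaussian_same_law ltr01 sqrth0 (noise i j)); rewrite mulr1.
have [iB _] := B_moment.
pose th i := euler_maruyama a beta h (theta0 i) (Z i) k.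
have mth i : random_vector (th i) := euler_maruyama_random_vector beta h aL (mth0 i) (mZ i) k.
have indep i j := @em_noise_independent _ _ _ _ P _ _ beta h aL _ _ _ _ inputs i j.
have th2 i := euler_maruyama_second_moment h0 aL mB iB sE (mth0 i) (i0 i) (mZ i) (ZB i) (indep i) k.
have mean i := euler_maruyama_mean h0 c0 aL ac mB iB sE (mth0 i) (i0 i) (mZ i) (ZB i) (indep i) k fl.
have var i := euler_maruyama_variance h0 c0 c1' aL ac mB iB sE (mth0 i) (i0 i) (proj2 (th02 i))
  (mZ i) (ZB i) (indep i) k fl.
have mf : measurable_fun setT (f : borel_rV R d -> R) := lip_borel fl.
have mfth i : measurable_fun setT (fun w => f (th i w)) := lip_measurable fl (mth i).
have fth2 i : integrableR P (fun w => f (th i w) ^+ 2).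
  exact: lip_sqr_integrable fl (mth i) (th2 i).
have cross i j : i != j ->
    integrableR P (fun w => f (th i w) * f (th j w)) /\
    \int[P]_w (f (th i w) * f (th j w)) = (\int[P]_w f (th i w)) * \int[P]_w f (th j w).
  move=> ij; have UZ := @em_particles_independent _ _ _ _ P _ _ beta h aL _ _ _ _ inputs i j k ij.
  exact: (independent_pair_mul (mth i) (mth j) UZ mf mf (fth2 i) (fth2 j)).
have h20 : 0 <= 2%:R^-1 :> R by [].
pose bias := l ^+ 2 / h * (q ^+ k * ((2 + kappa * h ^+ 2) * (cm * h / (1 - c)) + 2 * M)
    + (cd + kappa * cm) * h ^+ 3 / (1 - q)) + h.
have bias_le i : `|\int[pi]_x f x - \int[P]_w f (th i w)| <= bias.
  rewrite (mean i).
  have kh0 : 0 <= kappa * h ^+ 2 by rewrite mulr_ge0 ?sqr_ge0.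
  have e0 : 0 <= (cd + kappa * cm) * h ^+ 3 by nneg; rewrite exprn_ge0// ltW.
  have m0 : 0 <= cm * h by nneg.
  have inv (C : set (borel_rV R d)) : measurable C ->
      (\int[pi]_x P (X x h @^-1` C))%E = pi C by apply: invX; exact: ltW.
  have [Y1 Y2] : (forall y, random_vector (Y y)) /\
      forall y, integrableR P (fun w => enorm (Y y w) ^+ 2).
    split=> y; first exact: (em_step_random_vector beta h aL mB).
    by have [] := em_step_second_moment h0 aL mB iB sE y.
  have Xl x y : {ae P, forall w, enorm (X x h w - X y h w) <= 2 * enorm (x - y)}.
    exact: (sde_solution_lipschitz h0 L0 aL Lh (solX x) (solX y)).
  have Yl x y : {ae P, forall w, enorm (Y x w - Y y w) <= c * enorm (x - y)}.
    by apply: aeW => w; exact: em_step_lip.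
  (* The parameter [delta] is [h]: the one-step error [h ^+ 3] over [1 - q = K * h / 4] is of order
     [h ^+ 2], and [h ^+ 2 / delta] balances [delta]. *)
  exact: (stationary_bias (ler0n R 2) c0 q0 q1 e0 kh0 c0 c1' m0 mX Y1
    (fun x => proj1 (moment x)) Y2 Xl Yl (fun x y => proj1 (lyapunov x y))
    (fun x y => proj2 (lyapunov x y)) (fun x => proj2 (moment x)) inv
    k h0 fl (mth0 i) (i0 i) (proj2 (th02 i))).
have [iE leE] := average_mean_square N0 mfth fth2 cross bias_le var.
rewrite unlock -EFin_Rintegral//.
rewrite lee_fin; apply: le_trans leE _.
have q1c : 1 - c = K * h / 2 by rewrite /c; ring.
have q1q : 1 - q = K * h / 4 by rewrite /q; ring.
have NV : 0 <= N%:R^-1 :> R by rewrite invr_ge0.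
apply: lerD.
  apply: eqW; congr (_ * _ * _); congr (_ + _).
  by rewrite q1c /s; field; rewrite !gt_eqF.
have bias0 : 0 <= bias := le_trans (normr_ge0 _) (bias_le (Ordinal N0)).
suff H : bias <= l ^+ 2 / h * ((1 - K * h / 4) ^+ k * ((2 + kappa) * (2 * cm / K) + 2 * M)
      + 4 * (cd + kappa * cm) / K * h ^+ 2) + h.
  by rewrite ler_pXn2r// nnegrE// (le_trans bias0).
rewrite lerD2r; apply: ler_wpM2l; first by nneg.
apply: lerD; last first.
  by apply: eqW; rewrite q1q; field; rewrite !gt_eqF.
apply: ler_wpM2l; first exact: exprn_ge0.
rewrite lerD2r (_ : cm * h / (1 - c) = 2 * cm / K); last first.
  by rewrite q1c; field; rewrite !gt_eqF.
apply: ler_wpM2r; first by nneg.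
by rewrite lerD2l ler_piMr// expr_le1// ltW.
Qed.

End mean_square_error.

(** * Choice of the parameters *)

Lemma exists_nat_above (R : realType) (x : R) : 0 <= x ->
  exists n : nat, (0 < n)%N /\ x <= n%:R <= x + 1.
Proof.
move=> x0; have /andP[lo hi] := Num.Theory.truncn_itv x0.
exists (Num.truncn x).+1; split=> //; rewrite (ltW hi)/=.
by rewrite -natr1 lerD2r.
Qed.

Lemma asymp_with_le (R : realType) (lo hi C A B : R) : 0 < lo -> 0 <= B ->
  lo * B <= A -> A <= hi * B -> hi + lo^-1 <= C -> 0 <= hi -> asymp_with C A B.
Proof.
move=> lo0 B0 AB BA HC hi0; have iv : 0 <= lo^-1 by rewrite invr_ge0 ltW.
split; first by apply: le_trans BA _; rewrite ler_wpM2r//; lra.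
have A0 : 0 <= A by apply: le_trans AB; rewrite mulr_ge0// ltW.
apply: (@le_trans _ _ (lo^-1 * A)); last by rewrite ler_wpM2r//; lra.
by rewrite -ler_pdivrMl ?invr_gt0// invrK.
Qed.

(** Rests on [1 - r <= expR (- r)]. *)
Lemma expr_decay (R : realType) (r x : R) (k p : nat) : r <= 1 -> 0 < x ->
  p%:R * ln x^-1 <= r * k%:R -> (1 - r) ^+ k <= x ^+ p.
Proof.
move=> r1 x0 H; have r0 : 0 <= 1 - r by rewrite subr_ge0.
apply: (@le_trans _ _ (expR (- r) ^+ k)).
  by rewrite lerXn2r ?nnegrE ?expR_ge0// expR_ge1Dx.
have xE : x = expR (ln x) by rewrite lnK ?posrE.
rewrite {1}xE -!expRM_natl ler_expR.
by move: H; rewrite lnV ?posrE//; lra.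
Qed.

(** Arithmetic only: [S] gathers all smallness conditions on [h], and [C] is fixed before [m] and
    [eps]. The bias gets [eps / 2] and the variance [eps ^+ 2 / 2]. *)
Lemma parameter_choice (R : realType) (K l V1 V2 B0 E0 S eps0 : R) :
  0 < K -> 0 <= l -> 0 <= V1 -> 0 <= V2 -> 0 <= B0 -> 0 <= E0 -> K <= S ->
  0 < eps0 -> eps0 < 1 ->
  exists2 C : R, 0 < C & forall (m : nat) (eps : R), (0 < m)%N -> 0 < eps -> eps <= eps0 ->
  exists (N k : nat) (h : R),
  [/\ (0 < N)%N, 0 < h, h * (1 + S) <= 1,
    l ^+ 2 * ((1 - K * h / 2) ^+ k * V1 + V2 * m%:R^-1) / N%:R +
      (l ^+ 2 / h * ((1 - K * h / 4) ^+ k * B0 + E0 * h ^+ 2) + h) ^+ 2 <= eps ^+ 2 &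
    asymp_with C (em_cost N k h m)
      (Num.max (eps ^- 2 * m%:R^-1) 1 * ln eps^-1 * eps^-1 * m%:R)].
Proof.
move=> K0 l0 V10 V20 B00 E00 KS e00 e01.
have S0 : 0 <= S by apply: le_trans KS; exact: ltW.
(* The part of the bias that does not decay with [k] is [G * h]. The choice of [c0] below gives, for
   [h = c0 * eps], both [h * (1 + S) <= 1] and [G * h <= eps / 4]. *)
pose G := l ^+ 2 * E0 + 1.
have G0 : 0 <= G by rewrite addr_ge0// mulr_ge0 ?sqr_ge0.
pose c0 := (1 + S + 4 * G)^-1.
have s0 : 0 < 1 + S + 4 * G by lra.
have c00 : 0 < c0 by rewrite invr_gt0.
have c0S : c0 * (1 + S + 4 * G) = 1 by rewrite mulVf// gt_eqF.
(* The constant in front of the decaying part of the bias may be large. It is beaten by a power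
   [eps ^+ n], where [n] depends on [eps0 < 1] but not on [eps]. *)
have [n Hn] : exists n : nat, eps0 ^+ n * (l ^+ 2 * B0 / c0) <= 4^-1.
  have cv : (eps0 ^+ n * (l ^+ 2 * B0 / c0)) @[n --> \oo] --> (0 : R).
    rewrite -(mul0r (l ^+ 2 * B0 / c0)); apply: cvgMr_tmp.
    by apply: cvg_expr; rewrite ger0_norm// ltW.
  have q4 : 0 < 4^-1 :> R by rewrite invr_gt0.
  have [n _ /(_ n (leqnn n))] := (cvgrPdist_lt _ _).1 cv _ q4.
  rewrite /= sub0r normrN => Hn; exists n; apply: le_trans (ltW Hn).
  exact: ler_norm.
(* With [k >= c1 * lam / eps] one has [K * h / 4 * k >= n.+2%:R * lam], so the decay is at most
   [eps ^+ n.+2]. Of the two extra powers one pays for the division by [h] and the other is the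
   accuracy. *)
pose c1 := 4 * n.+2%:R / (K * c0).
have c10 : 0 < c1 by rewrite divr_gt0 ?mulr_gt0.
(* With [N >= c2 * mx] the variance term is at most [eps ^+ 2 / 2]; the [+ 1] keeps [c2] positive,
   as the lower bound on the cost requires. *)
pose c2 := 2 * l ^+ 2 * (V1 + V2) + 1.
have c20 : 0 < c2 by rewrite ltr_pwDr// mulr_ge0 ?addr_ge0// mulr_ge0 ?sqr_ge0.
(* A positive lower bound for [ln eps^-1], which is where [eps0 < 1] matters for the cost: rounding
   [k] up adds at most 1, and [1 <= lam0^-1 * (lam / eps)]. For [N], rounding is absorbed by
   [1 <= mx]. *)
pose lam0 := ln eps0^-1.
have lam00 : 0 < lam0 by rewrite ln_gt0// invf_gt1.
have hi0 : 0 < (c2 + 1) * (c1 + lam0^-1).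
  by apply: mulr_gt0; apply: addr_gt0 => //; rewrite invr_gt0.
have lo0 : 0 < c2 * c1 by exact: mulr_gt0.
exists ((c2 + 1) * (c1 + lam0^-1) + (c2 * c1)^-1).
  by rewrite addr_gt0// invr_gt0.
move=> m eps m0 eps_gt0 epse0; set lam := ln eps^-1; set mx := Num.max _ _.
have eps1 : eps <= 1 by rewrite (le_trans epse0)// ltW.
have lam_ge : lam0 <= lam.
  by rewrite ler_ln ?posrE ?invr_gt0// lef_pV2 ?posrE.
have lam_gt0 : 0 < lam by apply: lt_le_trans lam_ge.
have m1 : 1 <= m%:R :> R by rewrite ler1n.
have mR : 0 < m%:R :> R by rewrite ltr0n.
have mx1 : 1 <= mx by rewrite le_max lexx orbT.
have mxm : eps ^- 2 * m%:R^-1 <= mx by rewrite le_max lexx.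
have [N [N0 /andP[N1 N2]]] := exists_nat_above (mulr_ge0 (ltW c20) (le_trans ler01 mx1)).
have t0 : 0 <= c1 * (lam / eps) by rewrite mulr_ge0 ?divr_ge0// ltW.
have [k [_ /andP[k1 k2]]] := exists_nat_above t0.
pose h := c0 * eps.
have h0 : 0 < h by exact: mulr_gt0.
have hc0 : h <= c0 by rewrite /h ler_piMr// ltW.
have hS : h * (1 + S) <= 1.
  by rewrite -c0S; apply: ler_pM => //; [exact: ltW|lra|lra].
have Kh1 : K * h <= 1 by rewrite mulrC; apply: le_trans hS; rewrite ler_pM2l//; lra.
have Kh0 : 0 < K * h by exact: mulr_gt0.
have q40 : 0 <= 1 - K * h / 4 by lra.
have q20 : 0 <= 1 - K * h / 2 by lra.
have q24 : 1 - K * h / 2 <= 1 - K * h / 4 by lra.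
exists N, k, h; split=> //.
- have decay : (1 - K * h / 4) ^+ k <= eps ^+ n.+2.
    apply: expr_decay => //; first by lra.
    rewrite -/lam; apply: (@le_trans _ _ (K * h / 4 * (c1 * (lam / eps)))).
      apply: eqW; rewrite /c1 /h; field.
      by rewrite !gt_eqF.
    by rewrite ler_wpM2l// ltW// divr_gt0.
  have decay2 : (1 - K * h / 2) ^+ k <= eps ^+ 2.
    apply: (@le_trans _ _ ((1 - K * h / 4) ^+ k)).
      by rewrite lerXn2r ?nnegrE.
    apply: le_trans decay _; rewrite -(addn2 n) exprD ler_piMl ?sqr_ge0//.
    by rewrite exprn_ile1// ltW.
  have bias : l ^+ 2 / h * ((1 - K * h / 4) ^+ k * B0 + E0 * h ^+ 2) + h <= eps / 2.
    have lh : 0 <= l ^+ 2 / h by rewrite divr_ge0 ?sqr_ge0// ltW.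
    have b1 : l ^+ 2 / h * ((1 - K * h / 4) ^+ k * B0) <= eps / 4.
      apply: (@le_trans _ _ (l ^+ 2 / h * (eps ^+ n.+2 * B0))).
        by rewrite ler_wpM2l// ler_wpM2r.
      have -> : l ^+ 2 / h * (eps ^+ n.+2 * B0) = eps * (eps ^+ n * (l ^+ 2 * B0 / c0)).
        by rewrite /h -(addn2 n) exprD; field; rewrite !gt_eqF.
      rewrite ler_pM2l//; apply: le_trans Hn; apply: ler_wpM2r.
        by rewrite divr_ge0 ?mulr_ge0 ?sqr_ge0// ltW.
      by rewrite lerXn2r ?nnegrE// ltW.
    have -> : l ^+ 2 / h * ((1 - K * h / 4) ^+ k * B0 + E0 * h ^+ 2) + h =
        l ^+ 2 / h * ((1 - K * h / 4) ^+ k * B0) + G * c0 * eps.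
      by rewrite /G /h; field; rewrite !gt_eqF.
    have Gc : G * c0 <= 4^-1.
      have : 0 <= c0 * (1 + S) by rewrite mulr_ge0 ?addr_ge0// ltW.
      by move: c0S; lra.
    by have := ler_wpM2r (ltW eps_gt0) Gc; move: b1; lra.
  have bias0 : 0 <= l ^+ 2 / h * ((1 - K * h / 4) ^+ k * B0 + E0 * h ^+ 2) + h.
    rewrite addr_ge0 ?(ltW h0)// mulr_ge0 ?divr_ge0 ?sqr_ge0 ?(ltW h0)//.
    by apply: addr_ge0; [rewrite mulr_ge0 ?exprn_ge0|rewrite mulr_ge0 ?sqr_ge0].
  have bias2 : (l ^+ 2 / h * ((1 - K * h / 4) ^+ k * B0 + E0 * h ^+ 2) + h) ^+ 2 <= (eps / 2) ^+ 2.
    by rewrite lerXn2r ?nnegrE ?(le_trans bias0).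
  have NR : 0 < N%:R :> R by rewrite ltr0n.
  have e20 : 0 < eps ^+ 2 by rewrite exprn_gt0.
  have me : m%:R^-1 <= eps ^+ 2 * mx.
    by rewrite -ler_pdivrMl// mulrC [leLHS]mulrC.
  have ee : eps ^+ 2 <= eps ^+ 2 * mx by rewrite ler_peMr ?sqr_ge0.
  have var : l ^+ 2 * ((1 - K * h / 2) ^+ k * V1 + V2 * m%:R^-1) / N%:R <= eps ^+ 2 / 2.
    rewrite ler_pdivrMr//.
    apply: (@le_trans _ _ (l ^+ 2 * (eps ^+ 2 * mx * V1 + V2 * (eps ^+ 2 * mx)))).
      rewrite ler_wpM2l ?sqr_ge0//; apply: lerD; last by rewrite ler_wpM2l.
      by rewrite ler_wpM2r// (le_trans decay2).
    apply: (@le_trans _ _ (eps ^+ 2 / 2 * (c2 * mx))); last by rewrite ler_wpM2l// divr_ge0 ?sqr_ge0.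
    rewrite /c2; have : 0 <= eps ^+ 2 / 2 * mx.
      by rewrite mulr_ge0 ?divr_ge0 ?sqr_ge0// (le_trans ler01).
    lra.
  by move: var bias2 e20; rewrite exprMn; lra.
- have le0 : 0 <= lam / eps by rewrite divr_ge0// ltW.
  have cE : em_cost N k h m = N%:R * k%:R * m%:R.
    by rewrite /em_cost; field; rewrite gt_eqF.
  have TE : mx * lam * eps^-1 * m%:R = mx * (lam / eps) * m%:R by ring.
  have mx0 : 0 <= mx by exact: le_trans mx1.
  rewrite cE TE; apply: asymp_with_le lo0 _ _ _ (lexx _) (ltW hi0).
  + by rewrite mulr_ge0 ?ler0n// mulr_ge0.
  + have -> : c2 * c1 * (mx * (lam / eps) * m%:R) = (c2 * mx) * (c1 * (lam / eps)) * m%:R by ring.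
    by rewrite ler_pM2r//; apply: ler_pM => //; rewrite mulr_ge0// ltW.
  + have -> : (c2 + 1) * (c1 + lam0^-1) * (mx * (lam / eps) * m%:R) =
        ((c2 + 1) * mx) * ((c1 + lam0^-1) * (lam / eps)) * m%:R by ring.
    rewrite ler_pM2r//; apply: ler_pM => //.
      by apply: le_trans N2 _; rewrite (mulrDl c2 1 mx) mul1r lerD2l.
    apply: le_trans k2 _; rewrite (mulrDl c1 lam0^-1) lerD2l.
    rewrite -ler_pdivrMl ?invr_gt0// invrK mulr1.
    by apply: le_trans lam_ge _; rewrite ler_pdivlMr// ler_piMr// ltW.
Qed.

(** * The averaged drift inherits the constants of [b] *)

Section average_drift.
Context {R : realType} {d : nat}.

Lemma enorm_sum (I : Type) (r : seq I) (v : I -> 'rV[R]_d) :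
  enorm (\sum_(i <- r) v i) <= \sum_(i <- r) enorm (v i).
Proof.
elim: r => [|i r IH]; first by rewrite !big_nil enorm0.
by rewrite !big_cons; apply: le_trans (enorm_triangle _ _) _; rewrite lerD2l.
Qed.

Lemma dotp_sumr (I : Type) (r : seq I) (u : 'rV[R]_d) (v : I -> 'rV[R]_d) :
  dotp u (\sum_(i <- r) v i) = \sum_(i <- r) dotp u (v i).
Proof.
elim: r => [|i r IH]; last by rewrite !big_cons dotpDr IH.
by rewrite !big_nil; apply: big1 => j _; rewrite mxE mulr0.
Qed.

Variables (n m : nat) (b : 'rV[R]_d -> 'rV[R]_n -> 'rV[R]_d) (xi : 'I_m -> 'rV[R]_n).
Hypothesis m0 : (0 < m)%N.
Local Notation a := (average_drift b xi).

Let mV : 0 <= m%:R^-1 :> R. Proof. by rewrite invr_ge0. Qed.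

Let average_le (c : R) (F : 'I_m -> R) : (forall i, F i <= c) ->
  m%:R^-1 * \sum_i F i <= c.
Proof.
move=> Fc; rewrite ler_pdivrMl ?ltr0n// mulr_natl -[X in _ *+ X]card_ord -sumr_const.
exact: ler_sum.
Qed.

Let average_driftB x y : a x - a y = m%:R^-1 *: \sum_i (b x (xi i) - b y (xi i)).
Proof. by rewrite /average_drift -scalerBr sumrB. Qed.

Lemma average_drift_lipschitz L : (forall x y z, enorm (b x z - b y z) <= L * enorm (x - y)) ->
  forall x y, enorm (a x - a y) <= L * enorm (x - y).
Proof.
move=> bL x y; rewrite average_driftB enormZ ger0_norm//.
apply: le_trans (ler_wpM2l mV (enorm_sum _ _)) _; exact: average_le.
Qed.

Lemma average_drift_dissipative K :
  (forall x y z, dotp (x - y) (b x z - b y z) <= - K * enorm (x - y) ^+ 2) ->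
  forall x y, dotp (x - y) (a x - a y) <= - K * enorm (x - y) ^+ 2.
Proof. by move=> bK x y; rewrite average_driftB dotpZr dotp_sumr; exact: average_le. Qed.

End average_drift.

Lemma differentiable_component (R : realType) (d : nat) (a : 'rV[R]_d -> 'rV[R]_d) i x :
  differentiable a x -> differentiable (component a i) x.
Proof.
case: d a i x => [|d] a i x da; first by case: i.
exact: (differentiable_comp da (differentiable_coord (a x) 0 i)).
Qed.

Theorem theorem2p5 (R : realType) (d n : nat) (K L Lf A0 M0 eps0 : R)
    (C1 C2 : 'I_d -> R)
    (K_gt0 : 0 < K) (L_gt0 : 0 < L) (eps0_gt0 : 0 < eps0) (eps0_lt1 : eps0 < 1) :
  exists2 C : R, 0 < C &
  forall (m : nat) (eps : R)
    (b : 'rV[R]_d -> 'rV[R]_n -> 'rV[R]_d) (xi : 'I_m -> 'rV[R]_n)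
    (f : 'rV[R]_d -> R)
    (disp : measure_display) (T : measurableType disp) (P : probability T R)
    (F : R -> set_system T) (W : R -> T -> 'rV[R]_d)
    (X0 : T -> 'rV[R]_d) (X : 'rV[R]_d -> R -> T -> 'rV[R]_d)
    (pi : probability (borel_rV R d) R),
  let a := average_drift b xi in
  let beta : R := (Num.sqrt m%:R)^-1 in
  (0 < m)%N -> 0 < eps -> eps <= eps0 ->
  (forall x y, `|f x - f y| <= Lf * enorm (x - y)) ->
  (forall x y z, enorm (b x z - b y z) <= L * enorm (x - y)) ->
  (forall x y z, dotp (x - y) (b x z - b y z) <= - K * enorm (x - y) ^+ 2) ->
  twice_differentiable a ->
  (forall i x, enorm (gradient (component a i) x) <= C1 i) ->
  (forall i x, opnorm (hessian (component a i) x) <= C2 i) ->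
  enorm (a 0) <= A0 ->
  random_vector X0 ->
  ('E_P[(fun w => enorm (X0 w) ^+ 2)%R] <= M0%:E)%E ->
  filtration F ->
  brownian_motion P F W ->
  (forall x, sde_solution P F W a beta x (X x)) ->
  invariant_measure P X pi ->
  exists (Np k : nat) (h : R),
  [/\ (0 < Np)%N /\ 0 < h,
      forall (theta0 : 'I_Np -> T -> 'rV[R]_d)
             (Z : 'I_Np -> nat -> T -> 'rV[R]_d),
        iid_em_inputs P X0 theta0 Z ->
        ('E_P[(fun w => `|\int[pi]_x f x
               - em_estimator f a beta h theta0 Z k w| ^+ 2)%R] <= (eps ^+ 2)%:E)%E,
      asymp_with C (em_cost Np k h m)
        (Num.max (eps ^- 2 * m%:R^-1) 1 * ln eps^-1 * eps^-1 * m%:R),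
      m%:R < eps ^- 2 ->
        asymp_with C (em_cost Np k h m) (eps ^- 3 * ln eps^-1) &
      eps ^- 2 <= m%:R ->
        asymp_with C (em_cost Np k h m) (m%:R * eps^-1 * ln eps^-1)].
Proof.
(* The bounds in the statement are arbitrary reals; their absolute values are nonnegative and are
   available before [m], [eps] and the drift. *)
pose A : R := `|A0|; pose l : R := `|Lf|; pose M : R := `|M0|.
pose Ct : R := \sum_i `|C2 i|.
pose D : R := d%:R.
pose w := @weak_const R d L A Ct; pose st := @strong_const R d L A.
pose kap := @lyapunov_weight R d K L A Ct; pose cm := @moment_const R d K A.
pose cd := @distance_const R d K L A Ct.
have A_ge0 : 0 <= A := normr_ge0 A0.
have l_ge0 : 0 <= l := normr_ge0 Lf.
have M_ge0 : 0 <= M := normr_ge0 M0.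
have Ct_ge0 : 0 <= Ct by exact: sumr_ge0.
have D_ge0 : 0 <= D := ler0n R d.
have L_ge0 := ltW L_gt0.
have K_ge0 := ltW K_gt0.
have KV : 0 <= K^-1 by rewrite invr_ge0.
have w0 : 0 <= w by rewrite /w /weak_const; nneg.
have st0 : 0 <= st by rewrite /st /strong_const; nneg.
have cd0 : 0 <= cd by rewrite /cd /distance_const; nneg.
have cm0 : 0 <= cm by rewrite /cm /moment_const; nneg.
have kap0 : 0 <= kap by rewrite /kap /lyapunov_weight; nneg.
pose H1 := 8 * D ^+ 2 * w ^+ 2 / K + 2 * D * st.
have H10 : 0 <= H1 by rewrite /H1; nneg.
(* Each of [1], [K], [s1], [s2], [s3] encodes one smallness condition as [s * h <= 1]; all of them
   follow from [h * (1 + S) <= 1]. The condition on [h ^+ 2] is reduced to [s3] by [h <= 1]. *)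
pose s1 := 2 * D * L; pose s2 := 2 * L ^+ 2 / K; pose s3 := 2 * H1 / K.
have s10 : 0 <= s1 by rewrite /s1; nneg.
have s20 : 0 <= s2 by rewrite /s2; nneg.
have s30 : 0 <= s3 by rewrite /s3; nneg.
pose S := K + s1 + s2 + s3.
have V2 : 0 <= 16 * D / K by nneg.
have B0 : 0 <= (2 + kap) * (2 * cm / K) + 2 * M by nneg.
have E0 : 0 <= 4 * (cd + kap * cm) / K by nneg.
have KS : K <= S by rewrite /S; lra.
have [C C0 choice] := parameter_choice K_gt0 l_ge0 M_ge0 V2 B0 E0 KS eps0_gt0 eps0_lt1.
exists C => // m eps b xi f disp T P F W X0 X pi a beta m_gt0 eps_gt0 eps_le fL bL bK
  [da dga] C1a C2a a0 mX0 X0M filtF WB solX invX.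
have [N [k [h [N0 h0 hS err cost]]]] := choice m eps m_gt0 eps_gt0 eps_le.
have mR : 0 < m%:R :> R by rewrite ltr0n.
have hle (s : R) : 0 <= s -> s <= 1 + S -> s * h <= 1.
  by move=> s0 sS; rewrite mulrC; apply: le_trans hS; rewrite ler_pM2l.
exists N, k, h; split=> //.
- move=> theta0 Z inputs.
  have aL := average_drift_lipschitz xi m_gt0 bL.
  have aK := average_drift_dissipative xi m_gt0 bK.
  have fl : lip l f.
    split=> // x y; apply: le_trans (fL x y) _.
    by rewrite ler_wpM2r ?enorm_ge0// ler_norm.
  have aA : enorm (a 0) <= A := le_trans a0 (ler_norm _).
  have X0M' : ('E_P[(fun w => enorm (X0 w) ^+ 2)%R] <= M%:E)%E.
    by apply: le_trans X0M _; rewrite lee_fin ler_norm.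
  have tay i x u : `|a (x + u) 0 i - a x 0 i - dotp (gradient (component a i) x) u| <=
      Ct * enorm u ^+ 2.
    have C2C : C2 i <= Ct.
      rewrite /Ct (bigD1 i)//=; apply: le_trans (ler_norm _) _.
      by rewrite lerDl sumr_ge0.
    apply: (@taylor2_le _ _ (component a i) Ct x u) => y.
    + exact: differentiable_component.
    + exact: dga.
    + exact: le_trans (C2a i y) C2C.
  have beta0 : 0 <= beta by rewrite invr_ge0 sqrtr_ge0.
  have beta1 : beta <= 1.
    have : Num.sqrt 1 <= Num.sqrt m%:R :> R by rewrite ler_wsqrtr// ler1n.
    by rewrite sqrtr1 => s1m; rewrite invf_le1 ?sqrtr_gt0.
  have beta2 : beta ^+ 2 = m%:R^-1 by rewrite exprVn sqr_sqrtr// ltW.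
  have h1 : h <= 1 by rewrite -[h]mul1r; apply: hle => //; rewrite lerDl /S; lra.
  have Kh : K * h <= 1 by apply: hle => //; rewrite /S; lra.
  have Lh : 2 * d%:R * L * h <= 1 by apply: hle => //; rewrite -/D -/s1 /S; lra.
  have L2h : L ^+ 2 * h <= K / 2.
    have : s2 * h <= 1 by apply: hle => //; rewrite /S; lra.
    move=> /(ler_wpM2l K_ge0).
    have -> : K * (s2 * h) = 2 * (L ^+ 2 * h) by rewrite /s2; field; rewrite gt_eqF.
    by lra.
  have ch : (8 * d%:R ^+ 2 * w ^+ 2 / K + 2 * d%:R * st) * h ^+ 2 <= K / 2.
    rewrite -/D -/H1.
    have : s3 * h <= 1 by apply: hle => //; rewrite /S; lra.
    move=> /(ler_wpM2l K_ge0).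
    have -> : K * (s3 * h) = 2 * (H1 * h) by rewrite /s3; field; rewrite gt_eqF.
    have : H1 * h ^+ 2 <= H1 * h by rewrite ler_wpM2l// expr2 ler_piMr// ltW.
    by lra.
  have := em_mean_square_error filtF WB solX invX h0 h1 K_gt0 L_ge0 A_ge0 Ct_ge0 beta0 beta1
    aL aK aA tay Lh L2h Kh ch k fl mX0 M_ge0 X0M' N0 inputs.
  move=> /le_trans; apply; rewrite lee_fin beta2.
  exact: err.
(* In each regime the maximum is one of its two arguments, and the cost formula simplifies with the
   same constant [C]. *)
- move=> me; move: cost; rewrite max_l; last first.
    by rewrite ler_pdivlMr// mul1r ltW.
  congr (asymp_with _ _ _); field.
  by rewrite !gt_eqF.
- move=> me; move: cost; rewrite max_r; last by rewrite ler_pdivrMr// mul1r.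
  by congr (asymp_with _ _ _); ring.
Qed.
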